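(* Let $(b,f)$ be differentiable in $(x,a)$ and let $\mathcal H$ be convex in $(x,a)$. Suppose that $\hat\alpha$ is Lipschitz continuous. Let $x\in\mathbb R$ and $\xi\in\mathbb L^2(\mathcal F_0)$, and suppose that both of the following forward-backward systems admit unique strong solutions in $L^2_r$, where the law $\mathcal L_{X^\xi_t}$ in the second system is the one given by the solution of the first: $$\begin{cases} \mathrm dX^\xi_t=b(X^\xi_t,\mathcal L_{X^\xi_t},\hat\alpha(X^\xi_t,Y^\xi_t))\,\mathrm dt+\mathrm dB_t,\\ \mathrm dY^\xi_t=-\partial_x\mathcal H(X^\xi_t,\mathcal L_{X^\xi_t},\hat\alpha(X^\xi_t,Y^\xi_t),Y^\xi_t)\,\mathrm dt+Z^\xi_t\,\mathrm dB_t,\\ X^\xi_0=\xi,\end{cases}$$ $$\begin{cases} \mathrm dX^x_t=b(X^x_t,\mathcal L_{X^\xi_t},\hat\alpha(X^x_t,Y^x_t))\,\mathrm dt+\mathrm dB_t,\\ \mathrm dY^x_t=-\partial_x\mathcal H(X^x_t,\mathcal L_{X^\xi_t},\hat\alpha(X^x_t,Y^x_t),Y^x_t)\,\mathrm dt+Z^x_t\,\mathrm dB_t,\\ X^x_0=x.\end{cases}$$ Put $\alpha^*_t=\hat\alpha(X^x_t,Y^x_t)$, which is an admissible control in $\mathcal A$. Then $$J(\alpha^* )=\min_{\beta\in\mathcal A}J(\beta),$$ where for $\beta\in\mathcal A$ $$J(\beta)=\mathbb E\Big[\int_0^\infty e^{-rt}f(X^{x,\beta}_t,\mathcal L_{X^\xi_t},\beta_t)\,\mathrm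 dt\Big],\qquad X^{x,\beta}_t=x+\int_0^t b(X^{x,\beta}_s,\mathcal L_{X^\xi_s},\beta_s)\,\mathrm ds+B_t .$$
   Context: Setting. $(\Omega,\mathcal F,\mathbb P,\mathbb F)$ is a filtered probability space carrying a real Brownian motion $B$; $\mathbb F=(\mathcal F_t)_{t\ge0}$ is the filtration of $B$ augmented by all $\mathbb P$-null sets and by a sub-$\sigma$-algebra $\mathcal F_0$ independent of $B$ and rich enough to support every law on $\mathbb R$ with finite second moment. $\mathbb L^2(\mathcal F_0)$ is the set of real square-integrable $\mathcal F_0$-measurable random variables. $\mathcal P_2$ is the set of probability measures on $\mathbb R$ with finite second moment, with the 2-Wasserstein distance $\mathcal W_2$; $\mathcal L_X$ is the law of $X$. Fix a discount factor $r>0$. $L^2_r$ is the space of real adapted processes $(v_t)_{t\ge0}$ with $\mathbb E\int_0^\infty e^{-rt}|v_t|^2\mathrm dt<\infty$; a solution $(X,Y,Z)$ of a forward-backward system in $L^2_r$ means all components lie in $L^2_r$. $A\subset\mathbb R$ is convex and $\mathcal A=L^2_r(0,\infty,A)$ is the set of $A$-valued processes in $L^2_r$ (admissible controls). $b,f:\mathbb R\times\mathcal P_2\times A\to\mathbb R$ are measurable. Define $H_0(x,\mu,a,y)=b(x,\mu,a)y+f(x,\mu,a)$ and the generalized Hamiltonian $\mathcal H(x,\mu,a,y)=b(x,\mu,a)y+f(x,\mu,a)-rxy$. Standing assumptions. (1) $b$ is Lipschitz in $(x,\mu,a)$ and $f$ has at most quadratic growth in $(x,\mu,a)$; there is $\ell>0$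 with $|b(x,\mu,a)-b(x,\mu',a)|\le\ell\,\mathcal W_2(\mu,\mu')$ for all $x,a,\mu,\mu'$; and there is a constant $\lambda>\ell-r/2$ with $(x-x')(b(x,\mu,a)-b(x',\mu,a))\le-\lambda(x-x')^2$ for all $x,x',\mu,a$. (2) $b(x,\mu,a)=b_0(x,\mu)+b_1(x,a)$ and $f(x,\mu,a)=f_0(x,\mu)+f_1(x,a)$ with measurable $b_0,f_0,b_1,f_1$; $b,f$ are differentiable in $(x,a)$ and $\partial_ab,\partial_af$ are Lipschitz in $(x,a)$; $H_0$ is convex in $(x,a)$, and $\min_{a\in A}H_0(x,\mu,a,y)$ has a unique minimizer $\hat\alpha(x,y)$, which is Lipschitz in $(x,y)$ (by separability it does not depend on $\mu$; it is also the minimizer of $\mathcal H(x,\mu,\cdot,y)$). *)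

(* Defs.v *)
From HB Require Import structures.
From mathcomp Require Import all_boot all_order all_algebra.
From mathcomp Require Import interval_inference.
From mathcomp Require Import all_classical all_reals all_analysis.

Set Implicit Arguments.
Unset Strict Implicit.
Unset Printing Implicit Defensive.

Import Order.TTheory GRing.Theory Num.Theory.
Import numFieldNormedType.Exports.

Local Open Scope classical_set_scope.
Local Open Scope ring_scope.

Section wasserstein.
Context {R : realType}.

Notation prob := (probability R R).

Definition second_moment (mu : prob) : \bar R :=
  (\int[mu]_x (x ^+ 2)%:E)%E.

Definition P2 : set prob := [set mu | (second_moment mu < +oo)%E].

Definition coupling (mu nu : prob) (q : probability (R * R)%type R) : Prop :=
  forall U : set R, measurable U ->
    q (U `*` setT) = mu U /\ q (setT `*` U) = nu U.

(* Finite on [P2], where the product coupling has finite cost; outside of [P2]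
   the value is meaningless because [fine] sends [+oo] to [0]. *)
Definition W2 (mu nu : prob) : R :=
  Num.sqrt (fine (ereal_inf
    [set (\int[q]_z ((z.1 - z.2) ^+ 2)%:E)%E | q in coupling mu nu])).

Definition W2_open : set (set prob) :=
  [set U | U `<=` P2 /\ forall mu, U mu ->
    exists2 e : R, 0 < e & forall nu, P2 nu -> W2 mu nu < e -> U nu].

(* On the subset [P2] of this type, which is measurable, the trace of the
   sigma-algebra is the Borel sigma-algebra of the metric space [(P2, W2)].
   Two elements of [prob] that agree on measurable sets may differ elsewhere;
   in [P2] they are then at distance 0, so no set of this sigma-algebra separates them. *)
Definition P2Borel := g_sigma_algebraType W2_open.

End wasserstein.

Notation prob R := (probability R R).

Section processes.
Context {d : measure_display} {T : measurableType d} {R : realType}.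
Variable P : probability T R.

(* Processes are indexed by [R]; only the indices [0 <= t] matter. *)
Notation process := (R -> T -> R).

Definition RV_wrt (G : set (set T)) (X : T -> R) : Prop :=
  forall U : set R, measurable U -> G (X @^-1` U).

(* The value for a non-measurable [X] is a dummy. *)
Definition law (X : T -> R) : prob R :=
  match pselect (measurable_fun setT X) with
  | left mX => distribution P (mfun_Sub (mem_set mX))
  | right _ => dirac (0 : R)
  end.

Definition generated_by (B : process) (I : set R) : set (set T) :=
  <<s [set B u @^-1` U | u in I & U in measurable] >>.

Definition independent_sigma (G1 G2 : set (set T)) : Prop :=
  forall E1 E2, G1 E1 -> G2 E2 -> P (E1 `&` E2) = (P E1 * P E2)%E.

Record brownian_motion (B : process) : Prop := {
  bm_measurable : forall t : R, 0 <= t -> measurable_fun setT (B t) ;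
  bm_start : {ae P, forall w, B 0 w = 0} ;
  bm_increments : forall s t : R, 0 <= s -> s < t ->
    forall U : set R, measurable U ->
      P ((fun w => B t w - B s w) @^-1` U)
        = normal_prob 0 (Num.sqrt (t - s)) U ;
  bm_independent : forall s t : R, 0 <= s -> s < t ->
    independent_sigma
      [set (fun w => B t w - B s w) @^-1` U | U in @measurable _ R]
      (generated_by B `[0, s]) ;
  bm_continuous : {ae P, forall w,
    {within `[0, +oo[, continuous (fun t => B t w)}} }.

Record initial_sigma_algebra (B : process) (F0 : set (set T)) : Prop := {
  init_sigma : sigma_algebra setT F0 ;
  init_sub : F0 `<=` measurable ;
  init_independent : independent_sigma F0 (generated_by B `[0, +oo[) ;
  init_rich : forall mu : prob R, P2 mu ->
    exists2 X : T -> R, RV_wrt F0 X &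
      forall U : set R, measurable U -> P (X @^-1` U) = mu U }.

Definition augmented_filtration (B : process) (F0 : set (set T)) (t : R) :
    set (set T) :=
  <<s F0 `|` generated_by B `[0, t] `|` [set N | measurable N /\ P N = 0%E] >>.

Section filtered.
Variable F : R -> set (set T).

Record adapted_process (v : process) : Prop := {
  adapted_measurable : @measurable_fun _ _ (R * T)%type R
    (`[0, +oo[ `*` setT) (fun z => v z.1 z.2) ;
  adapted_to : forall t : R, 0 <= t -> RV_wrt (F t) (v t) }.

Definition L2r (r : R) (v : process) : Prop :=
  adapted_process v /\
  (\int[P]_w \int[lebesgue_measure]_(t in `[0%R, +oo[)
     (expR (- r * t) * `|v t w| ^+ 2)%:E < +oo)%E.

Record simple_process := SimpleProcess {
  simple_size : nat ;
  simple_time : nat -> R ;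
  simple_coef : nat -> T -> R }.

Record elementary (S : simple_process) : Prop := {
  elementary_start : 0 <= simple_time S 0%N ;
  elementary_nondecreasing :
    forall i, simple_time S i <= simple_time S i.+1 ;
  elementary_adapted :
    forall i, RV_wrt (F (simple_time S i)) (simple_coef S i) ;
  elementary_bounded :
    exists C, forall i w, (i < simple_size S)%N -> `|simple_coef S i w| <= C }.

Definition simple_eval (S : simple_process) (t : R) (w : T) : R :=
  \sum_(i < simple_size S)
    simple_coef S i w * \1_`]simple_time S i, simple_time S i.+1] t.

Definition simple_integral (B : process) (S : simple_process) (t : R) (w : T)
    : R :=
  \sum_(i < simple_size S) simple_coef S i w *
    (B (Num.min (simple_time S i.+1) t) w - B (Num.min (simple_time S i) t) w).

(* [M] is the continuous version of the Ito integral [t |-> \int_0^t Z dB]. *)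
Record ito_integral (B Z M : process) : Prop := {
  ito_adapted : adapted_process M ;
  ito_continuous : {ae P, forall w,
    {within `[0, +oo[, continuous (fun t => M t w)}} ;
  ito_limit : exists S : nat -> simple_process,
    (forall n, elementary (S n)) /\
    forall t : R, 0 <= t ->
      ((fun n => \int[P]_w \int[lebesgue_measure]_(s in `[0%R, t])
          ((simple_eval (S n) s w - Z s w) ^+ 2)%:E) @ \oo --> 0%E)%E /\
      ((fun n => \int[P]_w
          ((simple_integral B (S n) t w - M t w) ^+ 2)%:E) @ \oo --> 0%E)%E }.

End filtered.

Definition integral_equation (X : process) (x0 : T -> R) (g M : process)
    : Prop :=
  {ae P, forall w (t : R), 0 <= t ->
    lebesgue_measure.-integrable `[0, t] (EFin \o (fun s => g s w)) /\
    X t w = x0 w + \int[lebesgue_measure]_(s in `[0, t]) g s w + M t w}.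

End processes.

Section control.
Context {R : realType}.

Definition coefficient := R -> prob R -> R -> R.

Definition H0 (b f : coefficient) (x : R) (mu : prob R) (a y : R) : R :=
  b x mu a * y + f x mu a.

Definition Hamiltonian (b f : coefficient) (r x : R) (mu : prob R) (a y : R)
    : R :=
  b x mu a * y + f x mu a - r * x * y.

Definition dx_Hamiltonian (b f : coefficient) (r x : R) (mu : prob R) (a y : R)
    : R :=
  derive1 (fun x' : R => Hamiltonian b f r x' mu a y) x.

(* [A] may contain its end points, so differentiability at [(x, a)] is meant
   relatively to [R x A]; [p] and [q] are the partial derivatives. *)
Definition gradient_within (A : set R) (g : R -> R -> R) (x a p q : R) : Prop :=
  forall e : R, 0 < e -> exists2 dl : R, 0 < dl &
    forall x' a', A a' -> `|x' - x| < dl -> `|a' - a| < dl ->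
      `|g x' a' - g x a - p * (x' - x) - q * (a' - a)|
        <= e * (`|x' - x| + `|a' - a|).

Definition differentiable_coefficient (A : set R) (g : coefficient) : Prop :=
  exists (gx ga : coefficient) (K : R),
    (forall x mu a, P2 mu -> A a ->
      gradient_within A (fun x' a' => g x' mu a') x a (gx x mu a) (ga x mu a)) /\
    (forall x x' mu a a', P2 mu -> A a -> A a' ->
      `|ga x mu a - ga x' mu a'| <= K * (`|x - x'| + `|a - a'|)).

Definition measurable_coefficient (A : set R) (g : coefficient) : Prop :=
  @measurable_fun _ _ (R * @P2Borel R * R)%type R (setT `*` P2 `*` A)
    (fun z => g z.1.1 z.1.2 z.2).

Definition separable_coefficient (A : set R) (g : coefficient) : Prop :=
  exists (g0 : R -> prob R -> R) (g1 : R -> R -> R),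
    [/\ @measurable_fun _ _ (R * @P2Borel R)%type R (setT `*` P2)
          (fun z => g0 z.1 z.2),
        @measurable_fun _ _ (R * R)%type R (setT `*` A)
          (fun z => g1 z.1 z.2) &
        forall x mu a, P2 mu -> A a -> g x mu a = g0 x mu + g1 x a].

Definition convex_xa (A : set R) (h : R -> R -> R) : Prop :=
  @convex_function R (R^o * R^o)%type (setT `*` A) (fun z => h z.1 z.2).

Record growth_assumption (A : set R) (b f : coefficient) (r : R) : Prop := {
  b_lipschitz : exists K : R, forall x x' mu mu' a a',
    P2 mu -> P2 mu' -> A a -> A a' ->
    `|b x mu a - b x' mu' a'| <= K * (`|x - x'| + W2 mu mu' + `|a - a'|) ;
  f_growth : exists K : R, forall x mu a, P2 mu -> A a ->
    `|f x mu a| <= K * (1 + x ^+ 2 + fine (second_moment mu) + a ^+ 2) ;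
  b_dissipative : exists ell lambda : R,
    [/\ 0 < ell, lambda > ell - r / 2,
        (forall x mu mu' a, P2 mu -> P2 mu' -> A a ->
          `|b x mu a - b x mu' a| <= ell * W2 mu mu') &
        (forall x x' mu a, P2 mu -> A a ->
          (x - x') * (b x mu a - b x' mu a) <= - lambda * (x - x') ^+ 2)] }.

Definition unique_minimizer (A : set R) (b f : coefficient)
    (alpha : R -> R -> R) : Prop :=
  forall x y, A (alpha x y) /\
    forall mu, P2 mu ->
      (forall a, A a -> H0 b f x mu (alpha x y) y <= H0 b f x mu a y) /\
      (forall a, A a -> (forall a', A a' -> H0 b f x mu a y <= H0 b f x mu a' y)
         -> a = alpha x y).

Definition lipschitz2 (g : R -> R -> R) : Prop :=
  exists K : R, forall x x' y y',
    `|g x y - g x' y'| <= K * (`|x - x'| + `|y - y'|).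

Record structure_assumption (A : set R) (b f : coefficient)
    (alpha : R -> R -> R) : Prop := {
  b_separable : separable_coefficient A b ;
  f_separable : separable_coefficient A f ;
  b_differentiable : differentiable_coefficient A b ;
  f_differentiable : differentiable_coefficient A f ;
  H0_convex : forall mu y, P2 mu ->
    convex_xa A (fun x a => H0 b f x mu a y) ;
  alpha_minimizer : unique_minimizer A b f alpha ;
  alpha_lipschitz : lipschitz2 alpha }.

Context {d : measure_display} {T : measurableType d}.
Variables (P : probability T R) (F : R -> set (set T)) (B : R -> T -> R).
Variable r : R.

Notation process := (R -> T -> R).

Definition fbsde_solution (b f : coefficient) (alpha : R -> R -> R)
    (x0 : T -> R) (m : R -> prob R) (X Y Z : process) : Prop :=
  [/\ L2r P F r X, L2r P F r Y, L2r P F r Z,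
      integral_equation P X x0
        (fun s w => b (X s w) (m s) (alpha (X s w) (Y s w))) B &
      exists2 M : process, ito_integral P F B Z M &
        integral_equation P Y (Y 0)
          (fun s w => - dx_Hamiltonian b f r
             (X s w) (m s) (alpha (X s w) (Y s w)) (Y s w)) M].

Definition unique_solution (sol : process -> process -> process -> Prop)
    (X Y Z : process) : Prop :=
  sol X Y Z /\
  forall X' Y' Z', sol X' Y' Z' ->
    {ae P, forall w (t : R), 0 <= t -> X t w = X' t w /\ Y t w = Y' t w} /\
    {ae (P \x @lebesgue_measure R)%E, forall z,
      0 <= z.2 -> Z z.2 z.1 = Z' z.2 z.1}.

Definition admissible (A : set R) (beta : process) : Prop :=
  L2r P F r beta /\ forall (t : R) w, 0 <= t -> A (beta t w).

Definition controlled_state (b : coefficient) (x : R) (m : R -> prob R)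
    (beta X : process) : Prop :=
  adapted_process F X /\
  integral_equation P X (fun=> x) (fun s w => b (X s w) (m s) (beta s w)) B.

Definition cost (f : coefficient) (m : R -> prob R) (X beta : process)
    : \bar R :=
  (\int[P]_w \int[lebesgue_measure]_(t in `[0%R, +oo[)
     (expR (- r * t) * f (X t w) (m t) (beta t w))%:E)%E.

(* [J beta] is the [cost] of [beta] along any solution of its state equation,
   so the inequality for [beta = alpha] contains that [J alpha] does not depend
   on the chosen solution. *)
Definition optimal_control (A : set R) (b f : coefficient) (x : R)
    (m : R -> prob R) (alpha : process) : Prop :=
  [/\ admissible A alpha,
      exists X, controlled_state b x m alpha X &
      forall X beta X', controlled_state b x m alpha X ->
        admissible A beta -> controlled_state b x m beta X' ->
        (cost f m X alpha <= cost f m X' beta)%E].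

End control.

(* Main.v *)
(** For an admissible [be] with state [X'], the difference [D = X' - X] has absolutely
    continuous paths, because the Brownian motion cancels.  Convexity of the Hamiltonian,
    its minimality at [alpha] and the equation of [Y] bound the difference
    [e^(-rt) (f' - f)] of the discounted running costs from below by minus the derivative of
    [e^(-rt) D Y], up to the contribution of the martingale [M] of [Y].  Integrating up to
    time [t] and taking expectations removes [M], and leaves
    [- E[int_0^t e^(-rs) (f' - f) ds] <= E |e^(-rt) D_t Y_t|].  The right-hand side is
    integrable in [t]: [Y] is in [L^2_r], and the dissipativity of [b] puts [D] in [L^2_r].
    Hence the difference of the total costs cannot be negative.  The dependence on the law
    only matters for measurability: [t |-> law (Xxi t)] is [W2]-continuous, so all
    coefficients are jointly measurable in time and randomness. *)

Require Import Defs.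
From HB Require Import structures.
From mathcomp Require Import all_boot all_order all_algebra.
From mathcomp Require Import interval_inference.
From mathcomp Require Import all_classical all_reals all_analysis.
From mathcomp Require Import measurable_realfun ring lra.

Set Implicit Arguments.
Unset Strict Implicit.
Unset Printing Implicit Defensive.

Import Order.TTheory GRing.Theory Num.Theory.
Import numFieldNormedType.Exports.

Local Open Scope classical_set_scope.
Local Open Scope ring_scope.

(** * Fubini on strips *)

(** Two objects come without an integrability estimate: the state [X'] of a competing control, and
    the drift of [Y]. For the first, only the difference [D] is estimated; [lambda > ell - r/2] and
    [ell > 0] give [r/2 + lambda > 0], exactly what the weight [e^(-rt/2)] requires, and [X'] then
    inherits [L^2_r] from [X]. For the second, the [x]-derivative of [f] has no growth bound of its
    own: linear growth is extracted from the quadratic growth of the Hamiltonian by convexity, and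
    measurability from difference quotients. The term [- r x y] of the Hamiltonian is there to match
    the derivative of the discount in [e^(-rt) D]. The factors [D] and [Y] each absorb [e^(-rt/2)],
    so their product carries the full discount. Square integrability in time gives no decay at a
    given time, so the boundary term is not shown to vanish; its integrability in [t] excludes that
    it stays above a positive constant. The martingale [M] enters only through its square
    integrability and its orthogonality to the past, so a product rule for absolutely continuous
    paths suffices. *)

Section fubini_strip.
Local Open Scope ereal_scope.
Context d1 d2 (T1 : measurableType d1) (T2 : measurableType d2) (R : realType).
Variables (m1 : {sigma_finite_measure set T1 -> \bar R})
  (m2 : {sigma_finite_measure set T2 -> \bar R}).
Variables (S : set T1) (mS : measurable S).
Implicit Type f : T1 * T2 -> \bar R.

Let St : set (T1 * T2) := S `*` setT.
Local Notation mfunSt f := (@measurable_fun _ _ (T1 * T2)%type (\bar R) St f).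

Lemma measurable_strip : measurable St.
Proof. exact: measurableX. Qed.

(** Processes are measurable only over a set [S] of times. Extending by zero commutes with taking
    sections, which transports the Fubini theorems for total functions to the strip. *)
Let patch_strip f t w : (f \_ St) (t, w) = ((fun s => f (s, w)) \_ S) t.
Proof.
rewrite !patchE; congr (if _ then _ else _); apply/idP/idP; rewrite !inE.
  by case.
by move=> ?; split.
Qed.

Let patch_in f t w : S t -> (f \_ St) (t, w) = f (t, w).
Proof. by move=> tS; rewrite patch_strip patchE mem_set. Qed.

Let patch_notin f t w : ~ S t -> (f \_ St) (t, w) = 0.
Proof. by move=> tS; rewrite patch_strip patchE memNset. Qed.

Let meas_patch f : mfunSt f -> measurable_fun setT (f \_ St).
Proof. by move=> mf; apply/(measurable_restrictT _ _).1 => //; exact: measurable_strip. Qed.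

Let patch_ge0 f : (forall z, St z -> 0 <= f z) -> forall z, 0 <= (f \_ St) z.
Proof. by move=> f0 z; apply: erestrict_ge0. Qed.

Lemma measurable_strip_section1 f w : mfunSt f ->
  measurable_fun S (fun t => f (t, w)).
Proof.
move=> mf; apply/(measurable_restrictT _ mS).2.
rewrite [X in measurable_fun _ X](_ : _ = (fun t => (f \_ St) (t, w))).
  by apply: measurableT_comp; [exact: meas_patch|exact: pair2_measurable].
by apply/funext => t; rewrite patch_strip.
Qed.

Lemma measurable_strip_section2 f t : S t -> mfunSt f ->
  measurable_fun setT (fun w => f (t, w)).
Proof.
move=> tS mf.
rewrite [X in measurable_fun _ X](_ : _ = (fun w => (f \_ St) (t, w))).
  by apply: measurableT_comp; [exact: meas_patch|exact: pair1_measurable].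
by apply/funext => w; rewrite patch_in.
Qed.

Let integral_patch1 f w :
  \int[m1]_t (f \_ St) (t, w) = \int[m1]_(t in S) f (t, w).
Proof. by rewrite [RHS]integral_mkcond; apply: eq_integral => t _; rewrite patch_strip. Qed.

Let integral_patch2 f :
  (fun t => \int[m2]_w (f \_ St) (t, w)) = (fun t => \int[m2]_w f (t, w)) \_ S.
Proof.
apply/funext => t; rewrite [in RHS]patchE; case: ifPn => [/set_mem tS|/negP tS].
  by apply: eq_integral => w _; rewrite patch_in.
rewrite integral0_eq// => w _; rewrite patch_notin//.
by move=> tS'; apply: tS; exact: mem_set.
Qed.

Lemma tonelli_strip21 f : mfunSt f -> (forall z, St z -> 0 <= f z) ->
  \int[m1 \x m2]_(z in St) f z = \int[m2]_w \int[m1]_(t in S) f (t, w).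
Proof.
move=> mf f0; rewrite integral_mkcond fubini_tonelli2/=; last first.
- exact: patch_ge0.
- exact: meas_patch.
by apply: eq_integral => w _; rewrite /fubini_G integral_patch1.
Qed.

Lemma tonelli_strip12 f : mfunSt f -> (forall z, St z -> 0 <= f z) ->
  \int[m1 \x m2]_(z in St) f z = \int[m1]_(t in S) \int[m2]_w f (t, w).
Proof.
move=> mf f0; rewrite integral_mkcond fubini_tonelli1/=; last first.
- exact: patch_ge0.
- exact: meas_patch.
by rewrite [RHS]integral_mkcond -integral_patch2.
Qed.

Lemma measurable_strip_integral1 f : mfunSt f ->
  (forall z, St z -> 0 <= f z) ->
  measurable_fun setT (fun w => \int[m1]_(t in S) f (t, w)).
Proof.
move=> mf f0.
have := @measurable_fun_fubini_tonelli_G _ _ _ _ R m1 (f \_ St) (meas_patch mf) (patch_ge0 f0).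
by apply: eq_measurable_fun => w _; rewrite /fubini_G integral_patch1.
Qed.

Lemma measurable_strip_integral2 f : mfunSt f ->
  (forall z, St z -> 0 <= f z) ->
  measurable_fun S (fun t => \int[m2]_w f (t, w)).
Proof.
move=> mf f0; apply/(measurable_restrictT _ mS).2.
rewrite -integral_patch2.
exact: (@measurable_fun_fubini_tonelli_F _ _ _ _ R m2 (f \_ St) (meas_patch mf) (patch_ge0 f0)).
Qed.

Section integrable.
Variable f : T1 * T2 -> \bar R.
Hypothesis intf : (m1 \x m2).-integrable St f.

Let intp : (m1 \x m2).-integrable setT (f \_ St).
Proof. exact: (iffLR (integrable_mkcond _ measurable_strip)). Qed.

Lemma ae_integrable_strip1 :
  {ae m2, forall w, m1.-integrable S (fun t => f (t, w))}.
Proof.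
have := ae_integrable2 intp; apply: filterS => w iw.
apply/(integrable_mkcond _ mS); by apply: eq_integrable iw => // t _; rewrite patch_strip.
Qed.

Lemma ae_integrable_strip2 :
  {ae m1, forall t, S t -> m2.-integrable setT (fun w => f (t, w))}.
Proof.
have := ae_integrable1 intp; apply: filterS => t it tS.
by apply: eq_integrable it => // w _; rewrite patch_in.
Qed.

Lemma integrable_strip1 : m2.-integrable setT (fun w => \int[m1]_(t in S) f (t, w)).
Proof.
have : m2.-integrable setT (fubini_G m1 (f \_ St)).
  have mG := measurable_fubini_G intp.
  apply/integrableP; split => //.
  have := (integrable21ltyP m1 m2 (measurable_int _ intp)).1 intp.
  apply: le_lt_trans; apply: ge0_le_integral => //.
  - exact: measurableT_comp.
  - apply: (measurable_fun_fubini_tonelli_G (abse \o (f \_ St))); last first.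
      by move=> z; exact: abse_ge0.
    by apply: measurableT_comp => //; exact: measurable_int intp.
  - move=> w _; apply: le_abse_integral => //.
    apply: measurableT_comp; first exact: measurable_int intp.
    exact: pair2_measurable.
apply: eq_integrable => // w _.
by rewrite /fubini_G integral_patch1.
Qed.

Lemma fubini_strip21 :
  \int[m1 \x m2]_(z in St) f z = \int[m2]_w \int[m1]_(t in S) f (t, w).
Proof.
rewrite integral_mkcond -(integral21_prod_meas1 intp).
by apply: eq_integral => w _; rewrite /fubini_G integral_patch1.
Qed.

Lemma fubini_strip12 :
  \int[m1 \x m2]_(z in St) f z = \int[m1]_(t in S) \int[m2]_w f (t, w).
Proof.
rewrite integral_mkcond -(integral12_prod_meas1 intp).
by rewrite [RHS]integral_mkcond -integral_patch2.
Qed.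

Lemma integrable_strip2 : m1.-integrable S (fun t => \int[m2]_w f (t, w)).
Proof.
apply/(integrable_mkcond _ mS); rewrite -integral_patch2.
exact: integrable_fubini_F intp.
Qed.

End integrable.

End fubini_strip.

(** * Products of primitives *)

Section absolutely_continuous_product.
Context {R : realType}.
Notation mu := (@lebesgue_measure R).
Implicit Types f g : R -> R.

Section half.
Variables (t : R) (f g : R -> R) (c : rel R).
Let I : set R := `[0, t].
Hypothesis intf : mu.-integrable I (EFin \o f).
Hypothesis intg : mu.-integrable I (EFin \o g).
Hypothesis mc : measurable [set z : R * R | c z.1 z.2].

Let f' := f \_ I.
Let g' := g \_ I.

Let intf' : mu.-integrable setT (EFin \o f').
Proof. by rewrite -restrict_EFin; apply/(integrable_mkcond _ _).1 => //; exact: measurable_itv. Qed.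

Let intg' : mu.-integrable setT (EFin \o g').
Proof. by rewrite -restrict_EFin; apply/(integrable_mkcond _ _).1 => //; exact: measurable_itv. Qed.

Let mf' : measurable_fun setT f'.
Proof. by apply/measurable_EFinP; exact: (measurable_int mu intf'). Qed.

Let mg' : measurable_fun setT g'.
Proof. by apply/measurable_EFinP; exact: (measurable_int mu intg'). Qed.

Let k (z : R * R) : R := f' z.1 * g' z.2.

Let mk : measurable_fun setT k.
Proof. by apply: measurable_funM; apply: measurableT_comp. Qed.

(** The relation [c] selects a part of the square over [[0, t]]: a triangle on either side of the
    diagonal, or the whole square. *)
Let kc (z : R * R) : R := k z * \1_[set z | c z.1 z.2] z.

Let intk : (mu \x mu)%E.-integrable setT (EFin \o k).
Proof.
have mEk : measurable_fun setT (EFin \o k) by exact/measurable_EFinP.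
have := iffRL (integrable12ltyP mu mu mEk); apply.
have /integrableP[_ f'oo] := intf'; have /integrableP[_ g'oo] := intg'.
have -> : (\int[mu]_x \int[mu]_y `|(EFin \o k) (x, y)| =
    \int[mu]_x (`|(f' x)%:E| * \int[mu]_y `|(g' y)%:E|))%E.
  apply: eq_integral => x _; rewrite -ge0_integralZl//.
    by apply: eq_integral => y _ /=; rewrite normrM EFinM.
  by apply: measurableT_comp => //; exact/measurable_EFinP.
rewrite ge0_integralZr//.
- by rewrite lte_mul_pinfty// ?integral_ge0// ge0_fin_numE// integral_ge0.
- by apply: measurableT_comp => //; exact/measurable_EFinP.
- by rewrite integral_ge0.
Qed.

Lemma integrable_half : (mu \x mu)%E.-integrable setT (EFin \o kc).
Proof.
have mkc : measurable_fun setT (EFin \o kc).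
  by apply/measurable_EFinP; apply: measurable_funM => //; exact: measurable_indic.
apply: le_integrable intk => // z _ /=.
rewrite lee_fin normrM ler_piMr// indicE.
by case: (_ \in _); rewrite ?normr1 ?normr0.
Qed.

(** [J] is the slice at [s] of the selected part of the square. For [s] outside [I] both sides
    vanish, whatever [J] is. *)
Lemma inner_half s (J : set R) : measurable J ->
  [set u | c s u] `&` I = J `&` I -> (s \in I -> J `<=` I) ->
  (\int[mu]_u (kc (s, u))%:E =
    ((fun s => f s * \int[mu]_(u in J) g u) \_ I s)%:E)%E.
Proof.
move=> mJ cJ JI.
rewrite patchE; case: ifPn => [sI|sI]; last first.
  apply: integral0_eq => u _.
  by rewrite /kc /k /f' /= patchE (negbTE sI) !mul0r.
transitivity (\int[mu]_(u in J) ((f s)%:E * (g u)%:E))%E.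
  rewrite [RHS]integral_mkcond; apply: eq_integral => u _.
  rewrite patchE /kc /k /f' /g' /= !patchE sI indicE.
  have [uI|uI] := boolP (u \in I); last first.
    rewrite mulr0 mul0r; case: ifPn => // /set_mem/(JI sI)/mem_set uI'.
    by rewrite uI' in uI.
  have -> : ((s, u) \in [set z | c z.1 z.2]) = (u \in J).
    apply/idP/idP; rewrite !inE/= => h.
    - have : (J `&` I) u by rewrite -cJ; split => //; exact: set_mem.
      by case.
    - have : ([set u | c s u] `&` I) u by rewrite cJ; split => //; exact: set_mem.
      by case.
  by case: (u \in J); rewrite ?mulr1 ?mulr0.
have intgJ : mu.-integrable J (EFin \o g).
  by apply: integrableS intg => //; [exact: measurable_itv|exact: JI].
rewrite integralZl//= EFinM; congr (_ * _)%E.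
by rewrite /Rintegral fineK//; exact: integrable_fin_num.
Qed.

End half.

(** The function is the inner integral of [f s * g u] over the triangle [u <= s], so Fubini's
    theorem gives its integrability. *)
Lemma integrable_mul_primitive (t : R) (f g : R -> R) :
  mu.-integrable `[0, t] (EFin \o f) -> mu.-integrable `[0, t] (EFin \o g) ->
  mu.-integrable `[0, t] (fun s => (f s * \int[mu]_(u in `[0, s]) g u)%:E).
Proof.
move=> intf intg; pose c : rel R := fun s u => u <= s.
have mc : measurable [set z : R * R | c z.1 z.2].
  rewrite [X in measurable X](_ : _ = (fun z => z.1 - z.2) @^-1` `[0, +oo[).
    rewrite -[X in measurable X]setTI; apply: measurable_funB => //; exact: measurable_itv.
  by apply/seteqP; split => z /=; rewrite in_itv/= andbT subr_ge0.
have kF := integrable_fubini_F (integrable_half intf intg mc).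
apply/(integrable_mkcond _ _).2; first exact: measurable_itv.
move: kF; apply: eq_integrable => // s _; rewrite /fubini_F restrict_EFin /=.
apply: (@inner_half t f g c intg s `[0, s]) => //.
- apply/seteqP; split => u/=; rewrite !in_itv/= /c => -[].
    by move=> us /andP[u0 uT]; rewrite u0 us uT.
  by move=> /andP[u0 us] /andP[_ uT]; rewrite u0 us uT.
- rewrite inE/= in_itv/= => /andP[s0 sT].
  by apply: subset_itvl; rewrite bnd_simp.
Qed.

(** Integration by parts for merely integrable densities: it is Fubini's theorem on the square, and
    no derivative is taken. *)
Lemma primitive_product (t : R) (f g : R -> R) :
  mu.-integrable `[0, t] (EFin \o f) -> mu.-integrable `[0, t] (EFin \o g) ->
  (\int[mu]_(s in `[0, t]) f s) * (\int[mu]_(s in `[0, t]) g s) =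
  \int[mu]_(s in `[0, t]) (f s * \int[mu]_(u in `[0, s]) g u) +
  \int[mu]_(s in `[0, t]) (g s * \int[mu]_(u in `[0, s]) f u).
Proof.
move=> intf intg; pose I := [set` `[0, t]].
(* The square [0, t]^2 is cut along its diagonal into the two triangles [c1] and [c2]. *)
pose c1 : rel R := fun s u => u <= s; pose c2 : rel R := fun s u => s < u.
pose c2' : rel R := fun s u => u < s.
have mc1 : measurable [set z : R * R | c1 z.1 z.2].
  rewrite [X in measurable X](_ : _ = (fun z => z.1 - z.2) @^-1` `[0, +oo[).
    rewrite -[X in measurable X]setTI; apply: measurable_funB => //; exact: measurable_itv.
  by apply/seteqP; split => z /=; rewrite in_itv/= andbT subr_ge0.
have mc2 : measurable [set z : R * R | c2 z.1 z.2].
  rewrite [X in measurable X](_ : _ = ~` [set z | c1 z.1 z.2]).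
    exact: measurableC.
  by apply/seteqP; split => z /=; rewrite /c1 /c2 ltNge => /negP.
have i1 := integrable_half intf intg mc1.
have i2 := integrable_half intf intg mc2.
pose k (z : R * R) := (f \_ I) z.1 * (g \_ I) z.2.
have F1 s : (\int[mu]_u (k (s, u) * \1_[set z | c1 z.1 z.2] (s, u))%:E =
    ((fun s => f s * \int[mu]_(u in `[0, s]) g u) \_ I s)%:E)%E.
  apply: (@inner_half t f g c1 intg s `[0, s]) => //.
  - apply/seteqP; split => u/=; rewrite !in_itv/= /c1 => -[].
      by move=> us /andP[u0 uT]; rewrite u0 us uT.
    by move=> /andP[u0 us] /andP[_ uT]; rewrite u0 us uT.
  - rewrite inE/= in_itv/= => /andP[s0 sT].
    by apply: subset_itvl; rewrite bnd_simp.
(* On this triangle the inner variable is the first coordinate, so [f] and [g] are exchanged and the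
   relation is transposed. The strict inequality produces a half-open interval, closed at the very
   end. *)
have F2 u : (\int[mu]_s (k (s, u) * \1_[set z | c2 z.1 z.2] (s, u))%:E =
    ((fun u => g u * \int[mu]_(s in `[0, u[) f s) \_ I u)%:E)%E.
  rewrite -(@inner_half t g f c2' intf u `[0, u[) => //.
  - apply: eq_integral => s _; rewrite /k /= [(f \_ I) s * _]mulrC; congr (_ * _)%:E.
  - apply/seteqP; split => s/=; rewrite !in_itv/= /c2' => -[].
      by move=> us /andP[u0 uT]; rewrite u0 us uT.
    by move=> /andP[u0 us] /andP[_ uT]; rewrite u0 us uT.
  - rewrite inE/= in_itv/= => /andP[u0 uT].
    by apply: subset_itvl; rewrite bnd_simp.
(* The full relation gives the whole square, whose iterated integral is the product of the two
   integrals. *)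
pose c3 : rel R := fun s u => true.
have mc3 : measurable [set z : R * R | c3 z.1 z.2].
  have -> : [set z : R * R | c3 z.1 z.2] = setT by exact/seteqP.
  exact: measurableT.
have i3 := integrable_half intf intg mc3.
have F3 s : (\int[mu]_u (k (s, u) * \1_[set z | c3 z.1 z.2] (s, u))%:E =
    ((fun s => f s * \int[mu]_(u in I) g u) \_ I s)%:E)%E.
  apply: (@inner_half t f g c3 intg s I) => //.
  - exact: measurable_itv.
  - by apply/seteqP; split => u/=; rewrite !in_itv/= /c3 => -[].
  - by move=> _.
have toR h : mu.-integrable setT (fun s => ((h \_ I) s)%:E) ->
    (\int[mu]_s ((h \_ I) s)%:E = (\int[mu]_(s in I) h s)%:E)%E.
  move=> ih; rewrite /Rintegral fineK.
    by rewrite [RHS]integral_mkcond restrict_EFin.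
  apply: integrable_fin_num; first exact: measurable_itv.
  apply/(integrable_mkcond _ _).2; first exact: measurable_itv.
  by rewrite restrict_EFin.
have I1 := integrable_fubini_F i1; have I3 := integrable_fubini_F i3.
have I2 : mu.-integrable setT (fubini_G mu
    (EFin \o (fun z => k z * \1_[set z0 | c2 z0.1 z0.2] z))).
  have i2' := i2; rewrite -setXTT in i2'.
  exact: (integrable_strip1 measurableT i2').
have mI : measurable I by exact: measurable_itv.
have E1 : (\int[mu \x mu]_z (k z * \1_[set z0 | c1 z0.1 z0.2] z)%:E =
    (\int[mu]_(s in I) (f s * \int[mu]_(u in `[0, s]) g u))%:E)%E.
  rewrite -(integral12_prod_meas1 i1) -toR; last first.
    by apply: eq_integrable I1 => // x _; rewrite /fubini_F F1.
  by apply: eq_integral => s _; rewrite /fubini_F F1.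
have E2 : (\int[mu \x mu]_z (k z * \1_[set z0 | c2 z0.1 z0.2] z)%:E =
    (\int[mu]_(s in I) (g s * \int[mu]_(u in `[0, s[) f u))%:E)%E.
  rewrite -(integral21_prod_meas1 i2) -toR; last first.
    by apply: eq_integrable I2 => // x _; rewrite /fubini_G F2.
  by apply: eq_integral => s _; rewrite /fubini_G F2.
have E3 : (\int[mu \x mu]_z (k z * \1_[set z0 | c3 z0.1 z0.2] z)%:E =
    (\int[mu]_(s in I) (f s * \int[mu]_(u in I) g u))%:E)%E.
  rewrite -(integral12_prod_meas1 i3) -toR; last first.
    by apply: eq_integrable I3 => // x _; rewrite /fubini_F F3.
  by apply: eq_integral => s _; rewrite /fubini_F F3.
have E12 : (\int[mu \x mu]_z (k z * \1_[set z0 | c3 z0.1 z0.2] z)%:E =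
    \int[mu \x mu]_z (k z * \1_[set z0 | c1 z0.1 z0.2] z)%:E +
    \int[mu \x mu]_z (k z * \1_[set z0 | c2 z0.1 z0.2] z)%:E)%E.
  rewrite -integralD//=; apply: eq_integral => z _.
  rewrite -EFinD -mulrDr; congr (_ * _)%:E.
  have e3 : z \in [set z0 | c3 z0.1 z0.2] by rewrite inE.
  have e1 : (z \in [set z0 | c1 z0.1 z0.2]) = (z.2 <= z.1) by apply/idP/idP; rewrite inE.
  have e2 : (z \in [set z0 | c2 z0.1 z0.2]) = (z.1 < z.2) by apply/idP/idP; rewrite inE.
  rewrite !indicE e3 e1 e2.
  by case: ltP => //= _; rewrite ?addr0 ?add0r.
have E : (\int[mu]_(s in I) (f s * \int[mu]_(u in I) g u))%:E =
    ((\int[mu]_(s in I) (f s * \int[mu]_(u in `[0, s]) g u))%:E +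
    (\int[mu]_(s in I) (g s * \int[mu]_(u in `[0, s[) f u))%:E)%E.
  exact: (etrans (esym E3) (etrans E12 (congr2 adde E1 E2))).
have Z : \int[mu]_(s in I) (f s * \int[mu]_(u in I) g u) =
    (\int[mu]_(s in I) f s) * \int[mu]_(u in I) g u.
  by apply: RintegralZr.
rewrite -/I.
apply: (etrans (esym Z)).
apply: (etrans (EFin_inj E)); apply: (congr1 (+%R _)).
apply: eq_Rintegral => s /set_mem; rewrite /I /= in_itv => /andP[s0 sT]; congr (_ * _).
rewrite Rintegral_itv_bndo_bndc//.
apply: integrableS intf => //=; try exact: measurable_itv.
by apply: subset_itvl; rewrite bnd_simp.
Qed.

Let mitv (t : R) : @measurable _ (measurableTypeR R) ([set` `[0, t]] : set R).
Proof. exact: measurable_itv. Qed.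

Lemma integrable_mul_absolutely_continuous (t b : R) (f g G : R -> R) :
  mu.-integrable `[0, t] (EFin \o f) -> mu.-integrable `[0, t] (EFin \o g) ->
  (forall s, 0 <= s -> s <= t -> G s = b + \int[mu]_(u in `[0, s]) g u) ->
  mu.-integrable `[0, t] (EFin \o (fun s => f s * G s)).
Proof.
move=> intf intg GE.
have ifb : mu.-integrable `[0, t] (fun s => b%:E * (f s)%:E)%E.
  by apply: integrableZl => //; exact: measurable_itv.
have := integrableD (mitv t) ifb (integrable_mul_primitive intf intg).
apply: eq_integrable => [|s]; first exact: measurable_itv.
rewrite inE/= in_itv/= => /andP[s0 st].
by rewrite GE// mulrDr EFinD EFinM muleC -EFinM.
Qed.

Lemma absolutely_continuous_product (t a b : R) (f g F G : R -> R) : 0 <= t ->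
  mu.-integrable `[0, t] (EFin \o f) -> mu.-integrable `[0, t] (EFin \o g) ->
  (forall s, 0 <= s -> s <= t -> F s = a + \int[mu]_(u in `[0, s]) f u) ->
  (forall s, 0 <= s -> s <= t -> G s = b + \int[mu]_(u in `[0, s]) g u) ->
  F t * G t = a * b + \int[mu]_(s in `[0, t]) (f s * G s + g s * F s).
Proof.
move=> t0 intf intg FE GE.
have mI := mitv t.
rewrite (@eq_Rintegral _ _ _ mu _ (fun s => (f s * b + g s * a) +
    (f s * (\int[mu]_(u in `[0, s]) g u) + g s * (\int[mu]_(u in `[0, s]) f u)))); last first.
  move=> s; rewrite inE/= in_itv/= => /andP[s0 st].
  by rewrite FE// GE//; ring.
have ifb : mu.-integrable `[0, t] (fun s => (f s * b)%:E).
  by have := integrableZr mI b intf; apply: eq_integrable.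
have iga : mu.-integrable `[0, t] (fun s => (g s * a)%:E).
  by have := integrableZr mI a intg; apply: eq_integrable.
have ifg := integrable_mul_primitive intf intg.
have igf := integrable_mul_primitive intg intf.
have i1 : mu.-integrable `[0, t] (EFin \o (fun s => f s * b + g s * a)).
  by have := integrableD mI ifb iga; apply: eq_integrable.
have i2 : mu.-integrable `[0, t] (EFin \o (fun s =>
    (f s * (\int[mu]_(u in `[0, s]) g u) + g s * (\int[mu]_(u in `[0, s]) f u)))).
  by have := integrableD mI ifg igf; apply: eq_integrable.
rewrite (RintegralD mI i1 i2) (RintegralD mI ifb iga) (RintegralD mI ifg igf).
rewrite -primitive_product// RintegralZr// RintegralZr//.
by rewrite FE// GE//; ring.
Qed.

End absolutely_continuous_product.

(** * Moments of Brownian increments *)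

Section normal_moments.
Context {R : realType}.
Notation mu := (@lebesgue_measure R).
Variable s : R.
Hypothesis s0 : 0 < s.

(** The Radon-Nikodym derivative of the normal law equals [normal_pdf] almost everywhere, because
    both integrate to the law over every measurable set. *)
Lemma ge0_integral_normal_prob (f : R -> \bar R) :
  measurable_fun setT f -> (forall x, 0 <= f x)%E ->
  (\int[normal_prob 0 s]_x f x = \int[mu]_x (f x * (normal_pdf 0 s x)%:E))%E.
Proof.
move=> mf f0.
have dom := @normal_prob_dominates R 0 s.
rewrite -(Radon_Nikodym_SigmaFinite.change_of_variables dom)//.
have irn := Radon_Nikodym_SigmaFinite.f_integrable dom.
apply: ae_eq_integral => //=.
- apply: emeasurable_funM => //; exact: measurable_int irn.
- apply: emeasurable_funM => //; apply/measurable_EFinP; exact: measurable_normal_pdf.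
apply: ae_eqe_mul2l.
apply: integral_ae_eq => //=.
- apply/measurable_EFinP; exact: measurable_normal_pdf.
- move=> E _ mE; rewrite -Radon_Nikodym_SigmaFinite.f_integral//.
Qed.

(* [x ^+ 2 <= 8 s^2 expR (3 x^2 / (8 s^2))] bounds the integrand by a multiple of the
   normal density of standard deviation [2 s], so no exact moment is computed. *)
Lemma normal_second_moment :
  (\int[normal_prob 0 s]_x (x ^+ 2)%:E <= (16 * s ^+ 2)%:E)%E.
Proof.
have mx2 : measurable_fun setT (fun x : R => x ^+ 2) by exact: measurable_funX.
rewrite (@ge0_integral_normal_prob (fun x => (x ^+ 2)%:E)); last 2 first.
- exact/measurable_EFinP.
- by move=> x; rewrite lee_fin sqr_ge0.
have s20 : 2 * s != 0 by rewrite mulf_neq0// gt_eqF.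
have <- : (\int[mu]_x ((16 * s ^+ 2)%:E * (normal_pdf 0 (2 * s) x)%:E) =
    (16 * s ^+ 2)%:E)%E.
  rewrite ge0_integralZl//=.
  - by rewrite integral_normal_pdf mule1.
  - apply/measurable_EFinP; exact: measurable_normal_pdf.
  - by move=> x _; rewrite lee_fin normal_pdf_ge0.
  - by rewrite lee_fin mulr_ge0// sqr_ge0.
apply: ge0_le_integral => //=.
- by move=> x _; rewrite lee_fin mulr_ge0 ?sqr_ge0 ?normal_pdf_ge0.
- apply/measurable_EFinP; apply: measurable_funM => //; exact: measurable_normal_pdf.
- apply/measurable_EFinP; apply: measurable_funM => //; exact: measurable_normal_pdf.
move=> x _; rewrite lee_fin.
rewrite !normal_pdfE ?gt_eqF ?mulr_gt0//.
have -> : normal_peak (2 * s) = normal_peak s / 2.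
  rewrite /normal_peak.
  have -> : (2 * s) ^+ 2 * pi *+ 2 = 2 ^+ 2 * (s ^+ 2 * pi *+ 2) by ring.
  by rewrite sqrtrM ?sqr_ge0// sqrtr_sqr (ger0_norm (ler0n _ _)) invfM mulrC.
rewrite mulrCA -mulrA (mulrCA _ (normal_peak s)) ler_pM2l ?normal_peak_gt0 ?gt_eqF//.
rewrite /normal_fun !subr0; set v := x ^+ 2 / (8 * s ^+ 2).
have s2 : 0 < s ^+ 2 by rewrite exprn_gt0.
have -> : - x ^+ 2 / (s ^+ 2 *+ 2) = - (4 * v).
  by rewrite /v; field; rewrite gt_eqF.
have -> : - x ^+ 2 / ((2 * s) ^+ 2 *+ 2) = - v.
  by rewrite /v; field; rewrite gt_eqF.
have -> : x ^+ 2 = 8 * s ^+ 2 * v by rewrite /v; field; rewrite gt_eqF.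
have v0 : 0 <= v by rewrite /v divr_ge0 ?sqr_ge0// mulr_ge0// ltW.
have -> : 16 * s ^+ 2 * (2^-1 * expR (- v)) = 8 * s ^+ 2 * expR (- v) by field.
rewrite -(mulrA (8 * s ^+ 2)) ler_pM2l ?mulr_gt0//.
have -> : - (4 * v) = - (3 * v) - v by ring.
rewrite expRD mulrA ler_piMl ?expR_ge0//.
rewrite expRN ler_pdivrMr ?expR_gt0// mul1r.
apply: le_trans (expR_ge1Dx _); lra.
Qed.

(** Integrability comes from [|x| <= 1 + x^2] and the second moment. The mean vanishes because the
    law is invariant under [x |-> - x]. *)
Lemma normal_mean :
  (normal_prob 0 s).-integrable setT (EFin : R -> \bar R) /\
  (\int[normal_prob 0 s]_x x%:E = 0)%E.
Proof.
have ix : (normal_prob 0 s).-integrable setT (EFin : R -> \bar R).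
  apply/integrableP; split; first exact: EFin_measurable.
  apply: (@le_lt_trans _ _ (\int[normal_prob 0 s]_x (1 + x ^+ 2)%:E)%E).
    apply: ge0_le_integral => //=.
    - by apply: measurableT_comp => //; exact: EFin_measurable.
    - by apply/measurable_EFinP; apply: measurable_funD => //; exact: measurable_funX.
    move=> x _; rewrite lee_fin.
    have -> : x ^+ 2 = `|x| ^+ 2 by rewrite real_normK ?num_real.
    have := sqr_ge0 (`|x| - 1); nra.
  under eq_integral do rewrite EFinD.
  rewrite ge0_integralD//=.
  - rewrite (integral_cst _ _ 1%E)//.
    have -> : (1 * normal_prob 0 s setT = 1)%E by rewrite mul1e; exact: (@probability_setT _ _ R (normal_prob 0 s)).
    rewrite lte_add_pinfty ?ltry//.
    by apply: le_lt_trans normal_second_moment _; rewrite ltry.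
  - by move=> x _; rewrite lee_fin sqr_ge0.
  - by apply/measurable_EFinP; exact: measurable_funX.
split => //.
have sym A : measurable A -> pushforward (normal_prob 0 s) (-%R : _ -> measurableTypeR R) A = normal_prob 0 s A.
  move=> mA; rewrite /pushforward /normal_prob.
  have pe x : normal_pdf 0 s (- x) = normal_pdf 0 s x.
    by rewrite !normal_pdfE ?gt_eqF// /normal_fun !subr0 sqrrN.
  transitivity (\int[pushforward mu (-%R : _ -> measurableTypeR R)]_(x in A) (normal_pdf 0 s x)%:E)%E.
    rewrite ge0_integral_pushforward.
    - by apply: eq_integral => x _ /=; rewrite pe.
    - exact: oppr_measurable.
    - exact: mA.
    - by apply: measurable_funTS; apply/measurable_EFinP; exact: measurable_normal_pdf.
    - by move=> x _; rewrite lee_fin normal_pdf_ge0.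
  apply: eq_measure_integral => B mB _; exact: lebesgue_measureN.
have : (\int[pushforward (normal_prob 0 s) (-%R : _ -> measurableTypeR R)]_x x%:E =
    \int[normal_prob 0 s]_x x%:E)%E.
  by apply: eq_measure_integral => B mB _; exact: sym.
rewrite integral_pushforward//=; last first.
  by have := integrableN ix; apply: eq_integrable.
under eq_integral do rewrite EFinN.
rewrite (integralN (integrable_add_def measurableT ix)).
have /fineK <- := integrable_fin_num measurableT ix.
by rewrite -EFinN => -[h]; congr EFin; lra.
Qed.

End normal_moments.

(** * Independence and expectations of products *)

Section independence.
Context {d : measure_display} {T : measurableType d} {R : realType}.
Variable P : probability T R.

(** Both sides are finite measures in [E] with the same total mass, so agreement on the pi-system
    [G] extends to the sigma-algebra it generates. *)
Lemma independent_pi_system (G : set (set T)) (W : set T) :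
  G `<=` measurable -> setI_closed G -> measurable W ->
  (forall E, G E -> P (E `&` W) = (P E * P W)%E) ->
  forall E, <<s G >> E -> P (E `&` W) = (P E * P W)%E.
Proof.
move=> Gm GI mW GW E GE.
have PW0 : 0 <= fine (P W) by exact: fine_ge0.
have PWE : P W = (fine (P W))%:E by rewrite fineK ?fin_num_measure.
pose H := [set X | G X /\ X `<=` [set: T]].
have HG : H = G by apply/seteqP; split => [X []|X GX].
pose m1 := mrestr P mW.
pose m2 := mscale (NngNum PW0) P.
have m2E X : m2 X = (P X * P W)%E by rewrite /m2/= /mscale/= -PWE muleC.
rewrite -m2E -/(mrestr P mW E).
apply: (@g_sigma_algebra_measure_unique_trace _ R T G setT measurableT _ _ m1 m2) => //.
- by rewrite -/H HG.
- by rewrite -/H HG.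
- by rewrite /= /mscale /= /mrestr setTI probability_setT mule1 -PWE.
- by move=> X; rewrite -/(H X) HG => /GW; rewrite /= /mscale /= /mrestr -PWE muleC.
- by rewrite /m1/= /mrestr setTI PWE ltry.
- by rewrite -/H HG.
Qed.

(** The joint law of [X] and [W] is the product of their laws, and Fubini's theorem factors the
    integral of [x * y]. *)
Lemma independent_expectation (X W : T -> R) :
  measurable_fun setT X -> measurable_fun setT W ->
  (forall U V : set R, measurable U -> measurable V ->
    P (X @^-1` U `&` W @^-1` V) = (P (X @^-1` U) * P (W @^-1` V))%E) ->
  P.-integrable setT (EFin \o X) -> P.-integrable setT (EFin \o W) ->
  P.-integrable setT (EFin \o (fun w => X w * W w)) /\
  (\int[P]_w (X w * W w)%:E = \int[P]_w (X w)%:E * \int[P]_w (W w)%:E)%E.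
Proof.
move=> mX mW XW iX iW.
pose X' : {mfun T >-> R} := mfun_Sub (mem_set mX).
pose W' : {mfun T >-> R} := mfun_Sub (mem_set mW).
pose p := distribution P X'; pose q := distribution P W'.
have mXW : measurable_fun setT (fun w => (X w, W w)).
  exact: measurable_fun_pair.
pose XW' : {mfun T >-> (R * R)%type} := mfun_Sub (mem_set mXW).
pose j := distribution P XW'.
have jE A : measurable A -> (p \x q)%E A = j A.
  apply: product_measure_unique => U V mU mV.
  rewrite /j /p /q /distribution /pushforward /=.
  by rewrite -XW.
pose f (z : R * R) : \bar R := (z.1 * z.2)%:E.
have mf : measurable_fun setT f.
  by apply/measurable_EFinP; apply: measurable_funM.
have maf : measurable_fun setT (abse \o f) by exact: measurableT_comp.
have fpq : (p \x q)%E.-integrable setT f.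
  have := iffRL (integrable12ltyP p q mf); apply.
  have -> : (\int[p]_x \int[q]_y `|f (x, y)| = \int[p]_x (`|x%:E| * \int[q]_y `|y%:E|))%E.
    apply: eq_integral => x _; rewrite -ge0_integralZl//.
      by apply: eq_integral => y _ /=; rewrite normrM EFinM.
    by apply: measurableT_comp => //; exact: EFin_measurable.
  rewrite ge0_integralZr//; last 2 first.
  - by apply: measurableT_comp => //; exact: EFin_measurable.
  - by rewrite integral_ge0.
  have fin (Z : {mfun T >-> R}) : P.-integrable setT (EFin \o Z) ->
      (\int[distribution P Z]_x `|x%:E| < +oo)%E.
    move=> /integrableP[_ Zoo]; rewrite ge0_integral_distribution//.
    by apply: measurableT_comp => //; exact: EFin_measurable.
  have pX := fin X' iX; have qW := fin W' iW.
  by rewrite lte_mul_pinfty// ?integral_ge0// ge0_fin_numE// integral_ge0.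
have fj : (\int[j]_z `|f z| < +oo)%E.
  have /integrableP[_] := fpq; congr (_ < _)%E.
  by apply: eq_measure_integral => A mA _; exact: jE.
have ifXW : P.-integrable setT (f \o (fun w => (X w, W w))).
  apply/integrableP; split; first exact: measurableT_comp.
  by move: fj; rewrite ge0_integral_distribution.
split; first exact: ifXW.
transitivity (\int[j]_z f z)%E; first by rewrite integral_distribution.
transitivity (\int[p \x q]_z f z)%E.
  by apply: eq_measure_integral => A mA _; apply: esym; exact: jE.
rewrite -integral12_prod_meas1// /fubini_F.
have iq : q.-integrable setT EFin.
  by apply: integrable_pushforward => //; exact: EFin_measurable.
have ip : p.-integrable setT EFin.
  by apply: integrable_pushforward => //; exact: EFin_measurable.
have -> : (\int[P]_w (W w)%:E = \int[q]_y y%:E)%E.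
  by rewrite integral_distribution//; exact: EFin_measurable.
have -> : (\int[P]_w (X w)%:E = \int[p]_y y%:E)%E.
  by rewrite integral_distribution//; exact: EFin_measurable.
have /fineK <- := integrable_fin_num measurableT iq.
rewrite -integralZr//; apply: eq_integral => x _.
by rewrite fineK ?(integrable_fin_num measurableT iq)// -integralZl//.
Qed.
End independence.

(** * Square integrability and the filtration *)

Section square_integrable.
Context {d : measure_display} {T : measurableType d} {R : realType}.
Variables (mu : {measure set T -> \bar R}) (D : set T).
Hypothesis mD : measurable D.
Implicit Types f g : T -> R.

(** Measurability is recorded separately, since that of the square does not imply that of the
    function. *)
Definition sqint f := measurable_fun D f /\
  mu.-integrable D (EFin \o (fun x => f x ^+ 2)).

Lemma sqint_lty f : measurable_fun D f ->
  (\int[mu]_(x in D) (f x ^+ 2)%:E < +oo)%E -> sqint f.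
Proof.
move=> mf foo; split => //; apply/integrableP; split.
  by apply/measurable_EFinP; exact: measurable_funX.
by under eq_integral do rewrite /= ger0_norm ?sqr_ge0//.
Qed.

Lemma integral_sqint_lty f : sqint f -> (\int[mu]_(x in D) (f x ^+ 2)%:E < +oo)%E.
Proof. by move=> [_ /(integrable_lty mD)]. Qed.

Lemma sqint_le f g : measurable_fun D f -> sqint g ->
  (forall x, D x -> `|f x| <= `|g x|) -> sqint f.
Proof.
move=> mf [mg ig] fg; split => //; apply: le_integrable ig => //.
  by apply/measurable_EFinP; exact: measurable_funX.
move=> x Dx; rewrite lee_fin /= !normrX lerXn2r ?nnegrE//.
exact: fg.
Qed.

Lemma sqintM f g : sqint f -> sqint g ->
  mu.-integrable D (EFin \o (fun x => f x * g x)).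
Proof.
move=> [mf iF] [mg ig].
apply: le_integrable (integrableD mD iF ig) => //.
  by apply/measurable_EFinP; exact: measurable_funM.
move=> x Dx; rewrite /= lee_fin normrM.
rewrite (ger0_norm (addr_ge0 (sqr_ge0 _) (sqr_ge0 _))).
rewrite -(real_normK (num_real (f x))) -(real_normK (num_real (g x))).
have := sqr_ge0 (`|f x| - `|g x|); have := normr_ge0 (f x); have := normr_ge0 (g x).
nra.
Qed.

Lemma sqintZ k f : sqint f -> sqint (fun x => k * f x).
Proof.
move=> [mf iF]; split; first exact: measurable_funM.
have := integrableZl mD (k ^+ 2) iF; apply: eq_integrable => // x _ /=.
by rewrite exprMn EFinM.
Qed.

Lemma sqintD f g : sqint f -> sqint g -> sqint (fun x => f x + g x).
Proof.
move=> sf sg; have [mf iF] := sf; have [mg ig] := sg.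
split; first exact: measurable_funD.
have := integrableD mD (integrableD mD iF ig) (integrableZl mD 2 (sqintM sf sg)).
apply: eq_integrable => // x _ /=; rewrite -EFinM -!EFinD; congr EFin.
by ring.
Qed.

Lemma sqintN f : sqint f -> sqint (fun x => - f x).
Proof.
move=> /(sqintZ (-1)).
by under [in X in sqint X -> _]eq_fun do rewrite mulN1r.
Qed.

Lemma sqintB f g : sqint f -> sqint g -> sqint (fun x => f x - g x).
Proof. by move=> sf /sqintN; exact: sqintD. Qed.

Lemma sqint_sum (I : Type) (s : seq I) (F : I -> T -> R) :
  (mu D < +oo)%E -> (forall i, sqint (F i)) -> sqint (fun x => \sum_(i <- s) F i x).
Proof.
move=> muD sF; elim: s => [|i s IH].
  under eq_fun do rewrite big_nil; split => //.
  by rewrite /comp/=; under eq_fun do rewrite expr0n; exact: integrable0.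
by under eq_fun do rewrite big_cons; exact: sqintD.
Qed.

Lemma sqint_cst k : (mu D < +oo)%E -> sqint (fun=> k).
Proof.
move=> muD; apply: sqint_lty => //.
by rewrite (integral_cst _ mD (k ^+ 2)%:E) lte_mul_pinfty// lee_fin sqr_ge0.
Qed.

Lemma sqint_integrable f : (mu D < +oo)%E -> sqint f -> mu.-integrable D (EFin \o f).
Proof.
move=> muD sf; have := sqintM sf (sqint_cst 1 muD).
by apply: eq_integrable => // x _ /=; rewrite mulr1.
Qed.

End square_integrable.

Section measurable_wrt.
Context {d : measure_display} {T : measurableType d} {R : realType}.

Lemma RV_wrtP (C : set (set T)) (X : T -> R) :
  RV_wrt <<s C>> X <-> @measurable_fun _ _ (g_sigma_algebraType C) R setT X.
Proof.
split=> [mX _ U mU|mX U mU]; first by rewrite setTI; exact: mX.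
by rewrite -[X in <<s C>> X]setTI; exact: mX.
Qed.

Lemma RV_wrt_sub (G H : set (set T)) (X : T -> R) : G `<=` H ->
  RV_wrt G X -> RV_wrt H X.
Proof. by move=> GH GX U mU; exact/GH/GX. Qed.

Lemma RV_wrt_measurable (G : set (set T)) (X : T -> R) : G `<=` measurable ->
  RV_wrt G X -> measurable_fun setT X.
Proof. by move=> GH GX _ U mU; rewrite setTI; exact/GH/GX. Qed.

End measurable_wrt.

Section brownian.
Context {d : measure_display} {T : measurableType d} {R : realType}.
Variables (P : probability T R) (B : R -> T -> R) (F0 : set (set T)).
Hypotheses (hB : brownian_motion P B) (hF0 : initial_sigma_algebra P B F0).
Let F := augmented_filtration P B F0.

Lemma generated_by_measurable (I : set R) : (forall u, I u -> 0 <= u) ->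
  generated_by B I `<=` measurable.
Proof.
move=> I0; apply: smallest_sub; first exact: sigma_algebra_measurable.
move=> _ [u Iu [U mU <-]]; rewrite -[X in measurable X]setTI.
by apply: (bm_measurable hB) => //; exact: I0.
Qed.

Lemma filtration_measurable t : F t `<=` measurable.
Proof.
apply: smallest_sub; first exact: sigma_algebra_measurable.
move=> E [[F0E|]|[]//]; first exact: (init_sub hF0).
by apply: generated_by_measurable => u /=; rewrite in_itv/= => /andP[].
Qed.

Lemma generated_by_sub (I J : set R) : I `<=` J ->
  generated_by B I `<=` generated_by B J.
Proof.
by move=> IJ; apply: sub_sigma_algebra2 => _ [u Iu [U mU <-]]; exists u; [exact: IJ|exists U].
Qed.

Lemma filtration_le s t : s <= t -> F s `<=` F t.
Proof.
move=> st; apply: sub_sigma_algebra2 => E [[F0E|BE]|NE].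
- by left; left.
- left; right; apply: generated_by_sub BE.
  by apply: subset_itvl; rewrite bnd_simp.
- by right.
Qed.

Lemma increment_generated s t : 0 <= s -> 0 <= t ->
  RV_wrt (generated_by B `[0, +oo[) (fun w => B t w - B s w).
Proof.
move=> s0 t0; apply/RV_wrtP; apply: measurable_funB; apply/RV_wrtP => U mU.
- by apply: sub_sigma_algebra; exists t; [rewrite /= in_itv/= t0|exists U].
- by apply: sub_sigma_algebra; exists s; [rewrite /= in_itv/= s0|exists U].
Qed.

(** The sets [E0 & E1], with [E0] in [F0] and [E1] in the past of [B], form together with the null
    sets a pi-system that generates [F s]. On it the product formula follows from the independence
    of [F0] and [B] and from that of the increments. *)
Lemma increment_independent s t (E : set T) (U : set R) : 0 <= s -> s < t ->
  F s E -> measurable U ->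
  let W := (fun w => B t w - B s w) @^-1` U in P (E `&` W) = (P E * P W)%E.
Proof.
move=> s0 st FE mU W.
have t0 : 0 <= t by rewrite (le_trans s0)// ltW.
have bW : generated_by B `[0, +oo[ W by exact: increment_generated.
have b0oo : generated_by B `[0, +oo[ `<=` measurable.
  by apply: generated_by_measurable => u /=; rewrite in_itv/= => /andP[].
have b0s : generated_by B `[0, s] `<=` generated_by B `[0, +oo[.
  by apply: generated_by_sub => u /=; rewrite !in_itv/= => /andP[->].
have mW : measurable W by exact: b0oo.
have F0T : F0 setT /\ setI_closed F0.
  by have [] := iffLR (sigma_algebraP (fun _ _ => @subsetT _ _)) (init_sigma hF0).
have bT I : generated_by B I setT /\ setI_closed (generated_by B I).
  have /(iffLR (sigma_algebraP (fun _ _ => @subsetT _ _)))[] :=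
    @smallest_sigma_algebra _ setT [set B u @^-1` U | u in I & U in measurable].
  by [].
pose N : set (set T) := [set N | measurable N /\ P N = 0%E].
pose G : set (set T) := [set E0 `&` E1 | E0 in F0 & E1 in generated_by B `[0, s]] `|` N.
have Gm : G `<=` measurable.
  move=> _ [[E0 F0E0 [E1 bE1 <-]]|[]//]; apply: measurableI.
    exact: (init_sub hF0).
  by apply: b0oo; exact: b0s.
apply: (@independent_pi_system _ _ _ P G) => //.
- move=> A1 A2 GA1 GA2; have mA1 := Gm _ GA1; have mA2 := Gm _ GA2.
  case: GA1 => [[E0 F0E0 [E1 bE1 EA1]]|[_ A10]]; last first.
    right; split; first exact: measurableI.
    by apply: (subset_measure0 _ mA1 _ A10) => //; exact: measurableI.
  case: GA2 => [[E0' F0E0' [E1' bE1' EA2]]|[_ A20]]; last first.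
    right; split; first exact: measurableI.
    by apply: (subset_measure0 _ mA2 _ A20) => //; exact: measurableI.
  left; exists (E0 `&` E0'); first exact: F0T.2.
  exists (E1 `&` E1'); first exact: (bT _).2.
  by rewrite -EA1 -EA2 setIACA.
- move=> A' [[E0 F0E0 [E1 bE1 <-]]|[mN PN]]; last first.
    rewrite PN mul0e; apply: (subset_measure0 _ mN _ PN) => //.
    exact: measurableI.
  (* [E1] and the increment event together belong to the sigma-algebra of the whole path, so [E0]
     splits off first; only the increment against the past of [B] remains. *)
  rewrite -setIA (init_independent hF0)//; last by apply: (bT _).2 => //; exact: b0s.
  rewrite (init_independent hF0 F0E0 (b0s _ bE1)) -muleA; congr (_ * _)%E.
  rewrite setIC muleC; apply: (bm_independent hB s0 st) => //.
  by exists U.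
- move: E FE; apply: sub_sigma_algebra2 => A [[F0A|bA]|NA]; last by right.
  + by left; exists A => //; exists setT; [exact: (bT _).1|rewrite setIT].
  + by left; exists setT; [exact: F0T.1|exists A => //; rewrite setTI].
Qed.

End brownian.

(** * Martingale property of simple integrals *)

Section martingale.
Context {d : measure_display} {T : measurableType d} {R : realType}.
Variables (P : probability T R) (B : R -> T -> R) (F0 : set (set T)).
Hypotheses (hB : brownian_motion P B) (hF0 : initial_sigma_algebra P B F0).
Let F := augmented_filtration P B F0.

Let PT : (P setT < +oo)%E. Proof. by rewrite probability_setT ltry. Qed.

(** The factor 16 is that of [normal_second_moment]; what is used later is that the bound is linear
    in [t - s]. Equal times are treated apart, as the normal law is prescribed for [s < t]. *)
Lemma increment_moments s t : 0 <= s -> s <= t ->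
  [/\ sqint P setT (fun w => B t w - B s w),
      (\int[P]_w ((B t w - B s w) ^+ 2)%:E <= (16 * (t - s))%:E)%E &
      (\int[P]_w (B t w - B s w)%:E = 0)%E].
Proof.
move=> s0; rewrite le_eqVlt => /predU1P[->|st].
  split; under eq_fun do rewrite subrr ?expr0n.
  - exact: sqint_cst.
  - by rewrite integral0_eq// subrr mulr0.
  - by rewrite integral0_eq.
have t0 : 0 <= t by rewrite (le_trans s0)// ltW.
have mW : measurable_fun setT (fun w => B t w - B s w).
  by apply: measurable_funB; exact: (bm_measurable hB).
have mW' : @measurable_fun _ _ T (measurableTypeR R) setT (fun w => B t w - B s w).
  by [].
pose W : {mfun T >-> measurableTypeR R} := @mfun_Sub _ _ T (measurableTypeR R) _ (mem_set mW').
have WE A : measurable A -> distribution P W A = normal_prob 0 (Num.sqrt (t - s)) A.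
  by move=> mA; rewrite -(bm_increments hB s0 st).
have ts0 : 0 < Num.sqrt (t - s) by rewrite sqrtr_gt0 subr_gt0.
have E2 : (\int[P]_w ((B t w - B s w) ^+ 2)%:E <= (16 * (t - s))%:E)%E.
  have := normal_second_moment ts0; rewrite sqr_sqrtr ?subr_ge0 ?(ltW st)//.
  move=> h; apply: le_trans h; rewrite le_eqVlt; apply/orP; left; apply/eqP.
  transitivity (\int[distribution P W]_x (x ^+ 2)%:E)%E.
    rewrite ge0_integral_distribution//.
    - by apply/measurable_EFinP; exact: measurable_funX.
    - by move=> x; rewrite lee_fin sqr_ge0.
  by apply: eq_measure_integral => A mA _; exact: WE.
have sW : sqint P setT (fun w => B t w - B s w).
  by apply: sqint_lty => //; apply: le_lt_trans E2 _; rewrite ltry.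
split => //.
have [_ <-] := normal_mean ts0.
transitivity (\int[distribution P W]_x x%:E)%E.
  rewrite integral_distribution//.
  exact: sqint_integrable sW.
by apply: eq_measure_integral => A mA _; exact: WE.
Qed.

(** [X] is independent of the increment, which has mean zero. *)
Lemma increment_orthogonal s t (X : T -> R) : 0 <= s -> s <= t ->
  RV_wrt (F s) X -> P.-integrable setT (EFin \o X) ->
  P.-integrable setT (EFin \o (fun w => X w * (B t w - B s w))) /\
  \int[P]_w (X w * (B t w - B s w)) = 0.
Proof.
move=> s0; rewrite le_eqVlt => /predU1P[->|st] FX iX.
  split; under eq_fun do rewrite subrr mulr0; first exact: integrable0.
  by rewrite Rintegral_cst// mul0r.
have [sW _ W0] := increment_moments s0 (ltW st).
have iW := sqint_integrable measurableT PT sW.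
have mX := RV_wrt_measurable (@filtration_measurable _ _ _ P B F0 hB hF0 s) FX.
have mW := sW.1.
have [] := @independent_expectation _ _ _ P X _ mX mW _ iX iW.
  move=> U V mU mV; apply: (increment_independent hB hF0) => //; exact: FX.
by move=> ? E; split => //; rewrite /Rintegral E W0 mule0.
Qed.

Section simple.
Variable S : @simple_process d T R.
Hypothesis eS : elementary F S.

Let u := simple_time S.
Let c := simple_coef S.
Let n := simple_size S.

Let u0 i : 0 <= u i.
Proof.
elim: i => [|i IH]; first exact: (elementary_start eS).
exact: (le_trans IH (elementary_nondecreasing eS i)).
Qed.

Let incr i t w := B (Num.min (u i.+1) t) w - B (Num.min (u i) t) w.

Let sqint_incr i t : 0 <= t -> sqint P setT (incr i t).
Proof.
move=> t0; have := elementary_nondecreasing eS i; rewrite -/u => ui.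
have [] := @increment_moments (Num.min (u i) t) (Num.min (u i.+1) t) => //.
- by rewrite le_min u0.
- by rewrite le_min !ge_min lexx orbT ui.
Qed.

Let sqint_bounded i X : (i < n)%N -> sqint P setT X ->
  sqint P setT (fun w => c i w * X w).
Proof.
move=> ni sX; have [C Cb] := elementary_bounded eS.
have mc : measurable_fun setT (c i).
  apply: (RV_wrt_measurable (@filtration_measurable _ _ _ P B F0 hB hF0 (u i))).
  exact: (elementary_adapted eS).
apply: (sqint_le measurableT _ (sqintZ measurableT C sX)).
  by apply: measurable_funM => //; case: sX.
move=> w _; rewrite !normrM ler_wpM2r//.
by apply: le_trans (ler_norm _); exact: Cb.
Qed.

Lemma sqint_simple_integral t : 0 <= t -> sqint P setT (simple_integral B S t).
Proof.
move=> t0; rewrite /simple_integral.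
apply: (@sqint_sum _ _ _ P setT measurableT _ (index_enum 'I_n) (fun i w => c i w * incr i t w)) => // i.
by apply: sqint_bounded => //; exact: sqint_incr.
Qed.

(** Term by term: [X] times the coefficient is known at the left end of the part of the step that
    lies in [[s, t]], hence orthogonal to the increment over that part. *)
Lemma simple_integral_martingale s t (X : T -> R) : 0 <= s -> s <= t ->
  RV_wrt (F s) X -> sqint P setT X ->
  \int[P]_w (X w * (simple_integral B S t w - simple_integral B S s w)) = 0.
Proof.
move=> s0 st FX sX; have t0 := le_trans s0 st.
(* [lo i] is the node [u i] clamped to [[s, t]]; between [s] and [t], the [i]-th summand moves by
   its coefficient times the increment of [B] from [lo i] to [lo i.+1]. *)
pose lo i := Num.max (Num.min (u i) t) s.
have loE i w : (B (Num.min (u i) t) w - B (Num.min (u i) s) w) = B (lo i) w - B s w.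
  rewrite /lo; case: (leP s (u i)) => [su|us].
    by rewrite (@max_l _ _ _ s)// le_min su st.
  rewrite min_l ?(le_trans (ltW us))// max_r ?ltW//.
  by rewrite !subrr.
have term (i : 'I_n) :
    P.-integrable setT (EFin \o (fun w => X w * (c i w * (incr i t w - incr i s w)))) /\
    \int[P]_w (X w * (c i w * (incr i t w - incr i s w))) = 0.
  have incrE w : incr i t w - incr i s w = B (lo i.+1) w - B (lo i) w.
    rewrite /incr; have := loE i w; have := loE i.+1 w; lra.
  have -> : (fun w => X w * (c i w * (incr i t w - incr i s w))) =
      (fun w => (X w * c i w) * (B (lo i.+1) w - B (lo i) w)).
    by apply/funext => w; rewrite incrE mulrA.
  have ui : u i <= u i.+1 := elementary_nondecreasing eS i.
  (* A step that starts after [t] has a coefficient that need not be known at [lo i = t], but its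
     increment is zero. *)
  case: (leP (u i) t) => [ut|tu]; last first.
    have lot : lo i = t by rewrite /lo min_r ?ltW// max_l.
    have lot1 : lo i.+1 = t.
      by rewrite /lo min_r ?max_l// ltW// (lt_le_trans tu).
    rewrite lot lot1; split.
      by under eq_fun do rewrite subrr mulr0; exact: integrable0.
    under eq_Rintegral do rewrite subrr mulr0.
    by rewrite Rintegral_cst// mul0r.
  have lo0 : 0 <= lo i by rewrite /lo le_max s0 orbT.
  have lolo : lo i <= lo i.+1.
    rewrite /lo ge_max !le_max lexx orbT andbT le_min !ge_min ui lexx orbT.
    by [].
  apply: increment_orthogonal => //.
    apply/RV_wrtP; apply: measurable_funM; apply/RV_wrtP.
      by apply: RV_wrt_sub FX; apply: filtration_le; rewrite /lo le_max lexx orbT.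
    apply: RV_wrt_sub (elementary_adapted eS i); apply: filtration_le.
    by rewrite /lo (min_l ut) le_max lexx.
  apply: (sqint_integrable measurableT PT).
  have := @sqint_bounded i X (ltn_ord i) sX.
  by congr (sqint _ _ _); apply/funext => w; rewrite mulrC.
rewrite (@eq_Rintegral _ _ _ P _ (fun w => \sum_(i < n) (X w * (c i w * (incr i t w - incr i s w))))); last first.
  move=> w _; rewrite /simple_integral -sumrB mulr_sumr; apply: eq_bigr => i _.
  by rewrite -mulrBr.
rewrite /Rintegral; under eq_integral do rewrite -sumEFin.
rewrite integral_sum//; last by move=> i; exact: (term i).1.
rewrite big1// => i _; have [iX] := term i; rewrite /Rintegral => h.
by rewrite -[LHS]fineK ?h//; exact: integrable_fin_num.
Qed.

End simple.

End martingale.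

(** * The Ito integral is a martingale *)

Lemma cvge0_near_lt {R : realType} (u : nat -> \bar R) (e : R) :
  u @ \oo --> 0%E -> 0 < e -> \forall n \near \oo, (u n < e%:E)%E.
Proof.
move=> /fine_cvgP[ufin /cvgr0_norm_lt u0] e0; near=> n.
have un : u n \is a fin_num by near: n.
rewrite -(fineK un) lte_fin; apply: le_lt_trans (ler_norm _) _.
by near: n; exact: u0.
Unshelve. all: by end_near. Qed.

Section ito_martingale.
Context {d : measure_display} {T : measurableType d} {R : realType}.
Variables (P : probability T R) (B : R -> T -> R) (F0 : set (set T)).
Hypotheses (hB : brownian_motion P B) (hF0 : initial_sigma_algebra P B F0).
Let F := augmented_filtration P B F0.
Variables (Z M : R -> T -> R).
Hypothesis ZM : ito_integral P F B Z M.

Let PT : (P setT < +oo)%E. Proof. by rewrite probability_setT ltry. Qed.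

Let mM t : 0 <= t -> measurable_fun setT (M t).
Proof.
move=> t0; apply: (RV_wrt_measurable (@filtration_measurable _ _ _ P B F0 hB hF0 t)).
exact: (adapted_to (ito_adapted ZM)).
Qed.

(** One simple process serves both times, so that its martingale identity between [s] and [t] can be
    compared with [M]. *)
Let ito_approx s t (e : R) : 0 <= s -> 0 <= t -> 0 < e ->
  exists S : @simple_process d T R, [/\ elementary F S,
    (\int[P]_w ((simple_integral B S s w - M s w) ^+ 2)%:E < e%:E)%E &
    (\int[P]_w ((simple_integral B S t w - M t w) ^+ 2)%:E < e%:E)%E].
Proof.
move=> s0 t0 e0; have [S [eS SM]] := ito_limit ZM.
have [_ Is] := SM s s0; have [_ It] := SM t t0.
have Js := cvge0_near_lt Is e0; have Jt := cvge0_near_lt It e0.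
have [n [ns nt]] := @filter_ex _ \oo%classic _ _ (filterI Js Jt).
by exists (S n).
Qed.

Lemma sqint_ito t : 0 <= t -> sqint P setT (M t).
Proof.
move=> t0; have [S [eS Slt _]] := ito_approx t0 t0 (@ltr01 R).
have sS := sqint_simple_integral hB hF0 eS t0.
have sD : sqint P setT (fun w => simple_integral B S t w - M t w).
  apply: sqint_lty; last by apply: lt_trans Slt _; rewrite ltry.
  by apply: measurable_funB; [case: sS|exact: mM].
have := sqintB measurableT sS sD; congr (sqint _ _ _).
by apply/funext => w; rewrite subKr.
Qed.

(** The identity holds for simple integrals and passes to the [L^2] limit, because [X] is square
    integrable: the errors are bounded by [|X D| <= h X^2 + D^2 / h]. *)
Lemma ito_martingale s t (X : T -> R) : 0 <= s -> s <= t ->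
  RV_wrt (F s) X -> sqint P setT X ->
  \int[P]_w (X w * M t w) = \int[P]_w (X w * M s w).
Proof.
move=> s0 st FX sX; have t0 := le_trans s0 st.
have sMt := sqint_ito t0; have sMs := sqint_ito s0.
have iMt := sqintM measurableT sX sMt; have iMs := sqintM measurableT sX sMs.
apply/eqP; rewrite -subr_eq0 -normr_le0; apply/eqP.
apply/eqP/ler_addgt0Pl => e e0; rewrite addr0.
pose K := \int[P]_w (X w ^+ 2).
have K0 : 0 <= K by apply: Rintegral_ge0 => w _; exact: sqr_ge0.
(* With a mean square error below [h^2], each of the two error terms is at most [h K + h]; together
   they give [h (2 K + 2) = e]. *)
pose h := e / (2 * K + 2).
have h0 : 0 < h by rewrite divr_gt0// ltr_wpDl// mulr_ge0.
have [S [eS Ss St]] := ito_approx s0 t0 (exprn_gt0 2 h0).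
have sSt := sqint_simple_integral hB hF0 eS t0.
have sSs := sqint_simple_integral hB hF0 eS s0.
have sDt := sqintB measurableT sSt sMt; have sDs := sqintB measurableT sSs sMs.
have iDt := sqintM measurableT sX sDt; have iDs := sqintM measurableT sX sDs.
have iS := sqintM measurableT sX (sqintB measurableT sSt sSs).
have bound (D : T -> R) : sqint P setT D -> (\int[P]_w ((D w) ^+ 2)%:E < (h ^+ 2)%:E)%E ->
    `|\int[P]_w (X w * D w)| <= h * K + h.
  move=> sD Dh; have iXD := sqintM measurableT sX sD.
  apply: le_trans (le_normr_Rintegral measurableT iXD) _.
  have iX2 : P.-integrable setT (EFin \o (fun w => h * X w ^+ 2)).
    by have := integrableZl measurableT h sX.2; apply: eq_integrable.
  have iD2 : P.-integrable setT (EFin \o (fun w => h^-1 * D w ^+ 2)).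
    by have := integrableZl measurableT h^-1 sD.2; apply: eq_integrable.
  have iXD2 : P.-integrable setT (EFin \o (fun w => h * X w ^+ 2 + h^-1 * D w ^+ 2)).
    by have := integrableD measurableT iX2 iD2; apply: eq_integrable.
  apply: (@le_trans _ _ (\int[P]_w (h * X w ^+ 2 + h^-1 * D w ^+ 2))).
    apply: le_Rintegral => //.
      by have := integrable_norm iXD; apply: eq_integrable.
    move=> w _; have hi : h^-1 > 0 by rewrite invr_gt0.
    rewrite normrM -(real_normK (num_real (X w))) -(real_normK (num_real (D w))).
    have := sqr_ge0 (h * `|X w| - `|D w|).
    have -> : h * `|X w| ^+ 2 + h^-1 * `|D w| ^+ 2 =
      h^-1 * ((h * `|X w| - `|D w|) ^+ 2 + h * `|X w| * `|D w|) + `|X w| * `|D w|.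
      by field; rewrite gt_eqF.
    move=> q; rewrite lerDr; apply: (mulr_ge0 (ltW hi)); apply: (addr_ge0 q).
    exact: (mulr_ge0 (mulr_ge0 (ltW h0) (normr_ge0 _)) (normr_ge0 _)).
  rewrite RintegralD// (RintegralZl _ measurableT sX.2) (RintegralZl _ measurableT sD.2).
  rewrite lerD2l mulrC ler_pdivrMr// -expr2.
  rewrite -lee_fin /Rintegral fineK; first exact: ltW.
  exact: (integrable_fin_num measurableT sD.2).
have E : \int[P]_w (X w * M t w) - \int[P]_w (X w * M s w) =
    \int[P]_w (X w * (simple_integral B S s w - M s w)) -
    \int[P]_w (X w * (simple_integral B S t w - M t w)).
  have := simple_integral_martingale hB hF0 eS s0 st FX sX.
  under eq_Rintegral do rewrite mulrBr.
  rewrite (RintegralB measurableT (sqintM measurableT sX sSt) (sqintM measurableT sX sSs)).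
  under [X in _ -> _ = X - _]eq_Rintegral do rewrite mulrBr.
  under [X in _ -> _ = _ - X]eq_Rintegral do rewrite mulrBr.
  rewrite (RintegralB measurableT (sqintM measurableT sX sSt) iMt).
  rewrite (RintegralB measurableT (sqintM measurableT sX sSs) iMs).
  lra.
rewrite E; apply: le_trans (ler_normB _ _) _.
apply: le_trans (lerD (bound _ sDs Ss) (bound _ sDt St)) _.
rewrite le_eqVlt; apply/orP; left; apply/eqP; rewrite /h; field.
by rewrite gt_eqF// ltr_wpDl// mulr_ge0.
Qed.

(** Testing the martingale identity against [M s] gives [E (M_t - M_s)^2 = E M_t^2 - E M_s^2]. *)
Lemma ito_second_moment_le s t : 0 <= s -> s <= t ->
  \int[P]_w (M s w ^+ 2) <= \int[P]_w (M t w ^+ 2).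
Proof.
move=> s0 st; have t0 := le_trans s0 st.
have sMt := sqint_ito t0; have sMs := sqint_ito s0.
have := ito_martingale s0 st (adapted_to (ito_adapted ZM) s0) sMs.
have sD := sqintB measurableT sMt sMs.
have : 0 <= \int[P]_w ((M t w - M s w) ^+ 2) by apply: Rintegral_ge0 => w _; exact: sqr_ge0.
rewrite (@eq_Rintegral _ _ _ P _ (fun w => (M t w ^+ 2 + M s w ^+ 2) - 2 * (M s w * M t w))); last first.
  by move=> w _; ring.
have i1 : P.-integrable setT (EFin \o (fun w => M t w ^+ 2 + M s w ^+ 2)).
  by have := integrableD measurableT sMt.2 sMs.2; apply: eq_integrable.
have ist := sqintM measurableT sMs sMt.
have i2 : P.-integrable setT (EFin \o (fun w => 2 * (M s w * M t w))).
  by have := integrableZl measurableT 2 ist; apply: eq_integrable.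
rewrite (RintegralB measurableT i1 i2) (RintegralD measurableT sMt.2 sMs.2).
rewrite (RintegralZl _ measurableT ist).
rewrite (@eq_Rintegral _ _ _ P _ (fun w => M s w ^+ 2) (fun w => M s w * M s w)); last first.
  by move=> w _; rewrite expr2.
move=> /[swap] ->; lra.
Qed.

End ito_martingale.

(** * Laws and the Wasserstein distance *)

Section law.
Context {d : measure_display} {T : measurableType d} {R : realType}.
Variable P : probability T R.
Implicit Types U V : T -> R.

Let PT : (P setT < +oo)%E. Proof. by rewrite probability_setT ltry. Qed.

Lemma lawE U (A : set R) : measurable_fun setT U -> measurable A ->
  law P U A = P (U @^-1` A).
Proof. by rewrite /law; case: pselect. Qed.

Lemma second_moment_law U : measurable_fun setT U ->
  second_moment (law P U) = (\int[P]_w (U w ^+ 2)%:E)%E.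
Proof.
move=> mU; rewrite /second_moment /law; case: pselect => // mU'.
rewrite ge0_integral_distribution//.
- by apply/measurable_EFinP; exact: measurable_funX.
- by move=> x; rewrite lee_fin sqr_ge0.
Qed.

Lemma P2_law U : sqint P setT U -> P2 (law P U).
Proof.
by move=> sU; rewrite /P2/= second_moment_law ?(integral_sqint_lty measurableT sU)//; case: sU.
Qed.

(** The joint law of [U] and [V] is a coupling, and its cost is the right-hand side squared. *)
Lemma W2_law_le U V : sqint P setT U -> sqint P setT V ->
  W2 (law P U) (law P V) <= Num.sqrt (\int[P]_w ((U w - V w) ^+ 2)).
Proof.
move=> sU sV; have mU := sU.1; have mV := sV.1.
have sUV := sqintB measurableT sU sV.
have mUV : measurable_fun setT (fun w => (U w, V w)) by exact: measurable_fun_pair.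
pose UV : {mfun T >-> (R * R)%type} := mfun_Sub (mem_set mUV).
pose q : probability (R * R)%type R := distribution P UV.
have qc : coupling (law P U) (law P V) q.
  move=> A mA; rewrite !lawE// /q /distribution /pushforward/=; split; congr (P _).
    by apply/seteqP; split => w //= -[].
  by apply/seteqP; split => w //= -[].
have qE : (\int[q]_z ((z.1 - z.2) ^+ 2)%:E = \int[P]_w ((U w - V w) ^+ 2)%:E)%E.
  rewrite ge0_integral_distribution//.
  - by apply/measurable_EFinP; apply: measurable_funX; apply: measurable_funB.
  - by move=> x; rewrite lee_fin sqr_ge0.
(* Finiteness of the infimum has to be checked, since [fine] is monotone only between finite
   values. *)
apply: ler_wsqrtr; apply: fine_le.
- rewrite ge0_fin_numE.
    apply: le_lt_trans (integral_sqint_lty measurableT sUV).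
    by apply: ereal_inf_lbound; exists q.
  apply: le_ereal_inf_tmp => _ [q' _ <-]; apply: integral_ge0 => z _.
  by rewrite lee_fin sqr_ge0.
- exact: (integrable_fin_num measurableT sUV.2).
- by apply: ereal_inf_lbound; exists q.
Qed.

Lemma P2Borel_P2 : @measurable _ (@P2Borel R) P2.
Proof.
apply: sub_sigma_algebra; split => // mu mu2; exists 1 => //.
Qed.

Lemma measurable_law (X : R -> T -> R) :
  (forall t, 0 <= t -> sqint P setT (X t)) ->
  (forall t, 0 <= t -> forall e, 0 < e -> exists2 dl, 0 < dl &
    forall s, 0 <= s -> `|s - t| < dl -> \int[P]_w ((X t w - X s w) ^+ 2) < e) ->
  @measurable_fun _ _ R (@P2Borel R) `[0, +oo[ (fun t => law P (X t)).
Proof.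
move=> sX cX.
apply: (@measurability _ _ R (@P2Borel R) `[0%R, +oo[ _ (@W2_open R)) => //.
move=> _ [U [UP2 openU] <-].
(* The preimage of a [W2]-open set by a [W2]-continuous curve is the trace of an open set. *)
pose O : set R := \bigcup_(z in [set z : R * R | forall s, 0 <= s -> `|s - z.1| < z.2 ->
   U (law P (X s))]) ball z.1 z.2.
have -> : `[0, +oo[ `&` (fun t => law P (X t)) @^-1` U = `[0, +oo[ `&` O.
  apply/seteqP; split => t /= [t0]; rewrite /= in_itv/= andbT in t0.
    move=> Ut; split; first by rewrite in_itv/= t0.
    have [e e0 eU] := openU _ Ut.
    have [dl dl0 dlX] := cX t t0 (e ^+ 2) (exprn_gt0 _ e0).
    exists (t, dl); last exact: ballxx.
    move=> s s0 /(dlX s s0) Xe; apply: eU; first exact/P2_law/sX.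
    apply: le_lt_trans (W2_law_le (sX t t0) (sX s s0)) _.
    by rewrite -(ger0_norm (ltW e0)) -sqrtr_sqr ltr_sqrt// exprn_gt0.
  move=> [[c e] /= ceU] ct; split; first by rewrite in_itv/= t0.
  by apply: ceU => //; move: ct; rewrite /ball/= distrC.
apply: measurableI; first exact: measurable_itv.
apply: open_measurable; apply: bigcup_open => z _.
exact: ball_open.
Qed.

End law.

(** * Convex functions and their gradients *)

Section convexity.
Context {R : realType}.
Implicit Types (A : set R) (h : R -> R -> R).

Lemma convex_setE A (t a a' : R) : @convex_set R R^o A -> 0 <= t -> t <= 1 ->
  A a -> A a' -> A (t * a + (1 - t) * a').
Proof.
move=> cA t0 t1 Aa Aa'.
have := cA a a' (Itv01 t0 t1) (mem_set Aa) (mem_set Aa').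
by move=> /set_mem.
Qed.

Lemma convex_xaE A h (t x x' a a' : R) : convex_xa A h -> 0 <= t -> t <= 1 ->
  A a -> A a' ->
  h (t * x + (1 - t) * x') (t * a + (1 - t) * a') <= t * h x a + (1 - t) * h x' a'.
Proof.
move=> ch t0 t1 Aa Aa'.
have xaA (y b : R) : A b -> (y, b) \in ([set: R] `*` A) by move=> Ab; rewrite inE.
exact: (ch (Itv01 t0 t1) (x, a) (x', a') (xaA _ _ Aa) (xaA _ _ Aa')).
Qed.

Let gradient_quotient A h (x a p q : R) : A a -> gradient_within A h x a p q ->
  forall e : R, 0 < e -> exists2 dl : R, 0 < dl &
    forall t, t != 0 -> `|t| < dl -> `|p - t^-1 * (h (t + x) a - h x a)| <= e.
Proof.
move=> Aa gh e e0; have [dl dl0 ghdl] := gh e e0; exists dl => // t t0 tdl.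
have := ghdl (t + x) a Aa.
rewrite addrK !subrr normr0 mulr0 subr0 addr0 => /(_ tdl dl0).
have -> : h (t + x) a - h x a - p * t = - t * (p - t^-1 * (h (t + x) a - h x a)).
  by field.
by rewrite normrM normrN mulrC ler_pM2r// normr_gt0.
Qed.

Lemma gradient_within_derive1 A h (x a p q : R) : A a ->
  gradient_within A h x a p q -> derive1 (fun x' => h x' a) x = p.
Proof.
move=> Aa gh; rewrite derive1E /derive; apply: cvg_lim => //.
apply/cvgrPdist_le => e e0.
have [dl dl0 gdl] := gradient_quotient Aa gh e0.
apply/nbhs_ballP; exists dl => //= t; rewrite /ball/= sub0r normrN => tdl t0.
by have := gdl t t0 tdl; rewrite /= scaler1.
Qed.

(** Writing the partial derivative as the limit of a sequence is what later yields its measurability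
    along processes. *)
Lemma gradient_within_cvg A h (x a p q : R) : A a -> gradient_within A h x a p q ->
  (fun n : nat => n.+1%:R * (h (n.+1%:R^-1 + x) a - h x a)) @ \oo --> p.
Proof.
move=> Aa gh; apply/cvgrPdist_le => e e0.
have [dl dl0 gdl] := gradient_quotient Aa gh e0.
near=> n.
have := gdl n.+1%:R^-1; rewrite invrK; apply; first by rewrite invr_eq0 pnatr_eq0.
rewrite ger0_norm ?invr_ge0//; near: n; exact: near_infty_natSinv_lt (PosNum dl0).
Unshelve. all: by end_near. Qed.

(** A tangent inequality without a term in [a' - a]. Along the segment to [(x', a')], the expansions
    of [h] at the moved point and at the point where only [a] has moved share the contribution of
    [q], which cancels in their difference. Minimality then replaces the value at the second point
    by [h x a]. This works also at an end point of [A], where [q] need not vanish. *)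
Lemma gradient_lower_bound A h (x a p q : R) :
  @convex_set R R^o A -> convex_xa A h -> A a ->
  gradient_within A h x a p q -> (forall a', A a' -> h x a <= h x a') ->
  forall x' a', A a' -> h x a + p * (x' - x) <= h x' a'.
Proof.
move=> cA ch Aa gh mina x' a' Aa'.
apply/ler_addgt0Pl => e e0.
set dx := x' - x; pose da := a' - a.
(* The two expansions have a total error [(e / N) t (|dx| + 2 |da|)], at most [t e]; the added 1
   keeps [N] positive. *)
pose N := `|dx| + 2 * `|da| + 1.
have N0 : 0 < N by rewrite /N; have := normr_ge0 dx; have := normr_ge0 da; lra.
have [dl dl0 ghdl] := gh (e / N) (divr_gt0 e0 N0).
pose t := Num.min 1 (dl / (2 * N)).
have dlN : 0 < dl / (2 * N) by rewrite divr_gt0// mulr_gt0.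
have t0 : 0 < t by rewrite /t lt_min ltr01.
have t1 : t <= 1 by rewrite /t ge_min lexx.
have tN : t * N < dl.
  have : t <= dl / (2 * N) by rewrite /t ge_min lexx orbT.
  rewrite ler_pdivlMr ?mulr_gt0//; lra.
have tdx : `|t * dx| < dl.
  rewrite normrM gtr0_norm//; apply: le_lt_trans tN; rewrite ler_pM2l// /N.
  have := normr_ge0 da; lra.
have tda : `|t * da| < dl.
  rewrite normrM gtr0_norm//; apply: le_lt_trans tN; rewrite ler_pM2l// /N.
  have := normr_ge0 da; have := normr_ge0 dx; lra.
have Ata : A (a + t * da).
  have -> : a + t * da = t * a' + (1 - t) * a by rewrite /da; ring.
  by apply: convex_setE => //; exact: ltW.
have g1 := ghdl (x + t * dx) (a + t * da) Ata.
have g2 := ghdl x (a + t * da) Ata.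
rewrite !(addrC _ (t * _)) !addrK in g1 g2.
rewrite subrr normr0 mulr0 subr0 add0r in g2.
have {}g1 := g1 tdx tda; have {}g2 := g2 dl0 tda.
have c1 := @convex_xaE A h t x' x a' a ch (ltW t0) t1 Aa' Aa.
have min2 := mina _ Ata.
have Ex : t * x' + (1 - t) * x = t * dx + x by rewrite /dx; ring.
have Ea : t * a' + (1 - t) * a = t * da + a by rewrite /da; ring.
rewrite Ex Ea in c1; rewrite addrC in min2.
move: g1 g2; rewrite !ler_norml => /andP[g1 _] /andP[_ g2].
rewrite !normrM (gtr0_norm t0) in g1 g2.
rewrite -(ler_pM2l t0).
have eN : (e / N) * (t * `|dx| + t * `|da|) + (e / N) * (t * `|da|) <= t * e.
  have -> : (e / N) * (t * `|dx| + t * `|da|) + (e / N) * (t * `|da|) =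
    t * e * ((`|dx| + 2 * `|da|) / N) by field; rewrite gt_eqF.
  rewrite ler_piMr ?mulr_ge0 ?(ltW t0) ?(ltW e0)// ler_pdivrMr// /N; lra.
nra.
Qed.

End convexity.

(** * Discounted estimates on the half-line *)

Section half_line.
Context {R : realType}.
Notation mu := (@lebesgue_measure R).

Let mitv (i : interval R) : @measurable _ (measurableTypeR R) ([set` i] : set R).
Proof. exact: measurable_itv. Qed.

Let exp_continuous (c : R) : continuous (fun z : R^o => expR (- c * z) : R^o).
Proof.
move=> z; apply: continuous_comp; last exact: continuous_expR.
by apply: cvgM; [exact: cvg_cst|exact: cvg_id].
Qed.

Let integrable_exp_itv (c t : R) :
  mu.-integrable `[0, t] (EFin \o (fun s => - c * expR (- c * s))).
Proof.
apply: continuous_compact_integrable; first exact: segment_compact.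
apply: continuous_subspaceT => z.
by apply: cvgM; [exact: cvg_cst|exact: exp_continuous].
Qed.

Let exp_primitive (c t : R) : 0 <= t ->
  expR (- c * t) = 1 + \int[mu]_(s in `[0, t]) (- c * expR (- c * s)).
Proof.
rewrite le_eqVlt => /predU1P[<-|t0].
  by rewrite set_itv1 Rintegral_set1 mulr0 expR0 addr0.
have dF (x : R) : is_derive x (1 : R) (fun s => expR (- c * s)) (- c * expR (- c * x)).
  have dg : is_derive x (1 : R) (fun s => - c * s) (- c).
    have := @is_deriveZ R R R id (- c) x 1 1 _.
    by rewrite /GRing.scale/= mulr1; apply; exact: is_derive_id.
  have := @is_derive1_comp R expR (fun s => - c * s) x _ _ (is_derive_expR _) dg.
  by rewrite (mulrC (- c) (expR _)).
rewrite /Rintegral (@continuous_FTC2 _ (fun s => - c * expR (- c * s))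
  (fun s => expR (- c * s)) 0 t t0).
- by rewrite -EFinB /= mulr0 expR0 subrKC.
- apply: continuous_subspaceT => z.
  by apply: cvgM; [exact: cvg_cst|exact: exp_continuous].
- split.
  + by move=> x _; have [] := dF x.
  + by apply: cvg_at_right_filter; exact: exp_continuous.
  + by apply: cvg_at_left_filter; exact: exp_continuous.
- by move=> x _; rewrite derive1E; exact: (@derive_val _ _ _ _ _ _ _ (dF x)).
Qed.

Lemma discounted_primitive (c t : R) (dl D : R -> R) : 0 <= t ->
  mu.-integrable `[0, t] (EFin \o dl) ->
  (forall s, 0 <= s -> s <= t -> D s = \int[mu]_(u in `[0, s]) dl u) ->
  mu.-integrable `[0, t] (EFin \o (fun s => expR (- c * s) * (dl s - c * D s))) /\
  (forall s, 0 <= s -> s <= t -> expR (- c * s) * D s =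
    \int[mu]_(u in `[0, s]) (expR (- c * u) * (dl u - c * D u))).
Proof.
move=> t0 idl DE.
have sub s : s <= t -> `[0, s]%classic `<=` `[0, t]%classic.
  by move=> st; apply: subset_itvl; rewrite bnd_simp.
have E s u : 0 <= u -> u <= s -> expR (- c * u) = 1 + \int[mu]_(v in `[0, u]) (- c * expR (- c * v)).
  by move=> u0 _; exact: exp_primitive.
have DE' s u : s <= t -> 0 <= u -> u <= s -> D u = 0 + \int[mu]_(v in `[0, u]) dl v.
  by move=> st u0 us; rewrite add0r DE// (le_trans us).
have idls s : s <= t -> mu.-integrable `[0, s] (EFin \o dl).
  by move=> st; apply: integrableS idl => //; exact: sub.
have i1 := integrable_mul_absolutely_continuous idl (integrable_exp_itv c t) (E t).
have i2 := integrable_mul_absolutely_continuous (integrable_exp_itv c t) idl (DE' t ^~ (lexx t)).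
split.
  have := integrableD (mitv `[0, t]) i1 i2; apply: eq_integrable => // s _.
  by rewrite /= -EFinD; congr EFin; ring.
move=> s s0 st.
rewrite (absolutely_continuous_product s0 (integrable_exp_itv c s) (idls s st)
  (E s) (DE' s ^~ st)) mul1r?mulr0 ?add0r.
by apply: eq_Rintegral => u _; ring.
Qed.

(** An energy estimate for [E = e^(-cs) D]. The derivative of [E^2] is
    [e^(-2cs) (2 D dl - 2 c D^2)]; dissipativity bounds it by [e^(-2cs) (- 2 (c + lam) D^2 + 2 K |D|
    ga)], and Young's inequality spends half of the negative term on the product, at the price
    [K^2 ga^2 / (c + lam)]. *)
Lemma dissipative_bound (c lam K : R) (D dl ga : R -> R) :
  0 < c + lam ->
  (forall t, 0 <= t -> mu.-integrable `[0, t] (EFin \o dl)) ->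
  (forall t, 0 <= t -> D t = \int[mu]_(u in `[0, t]) dl u) ->
  (forall t, 0 <= t -> D t * dl t <= - lam * D t ^+ 2 + K * `|D t| * ga t) ->
  (forall t, 0 <= t ->
    mu.-integrable `[0, t] (EFin \o (fun s => (expR (- c * s) * ga s) ^+ 2))) ->
  forall t, 0 <= t ->
  mu.-integrable `[0, t] (EFin \o (fun s => (expR (- c * s) * D s) ^+ 2)) /\
  (expR (- c * t) * D t) ^+ 2 +
    (c + lam) * \int[mu]_(s in `[0, t]) (expR (- c * s) * D s) ^+ 2 <=
    K ^+ 2 / (c + lam) * \int[mu]_(s in `[0, t]) (expR (- c * s) * ga s) ^+ 2.
Proof.
move=> cl idl DE dis iga t t0.
pose E s := expR (- c * s) * D s.
pose e s := expR (- c * s) * (dl s - c * D s).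
have [ie EE] := discounted_primitive c t0 (idl t t0) (fun s s0 _ => DE s s0).
have EE' s : 0 <= s -> s <= t -> E s = 0 + \int[mu]_(u in `[0, s]) e u.
  by move=> s0 st; rewrite add0r; exact: EE.
have ieE := integrable_mul_absolutely_continuous ie ie EE'.
have i1 : mu.-integrable `[0, t] (EFin \o cst (1 : R)).
  apply: continuous_compact_integrable; first exact: segment_compact.
  by apply: continuous_subspaceT; exact: cst_continuous.
have iE : mu.-integrable `[0, t] (EFin \o E).
  have := integrable_mul_absolutely_continuous i1 ie EE'.
  by apply: eq_integrable => // s _ /=; rewrite mul1r.
have iE2 : mu.-integrable `[0, t] (EFin \o (fun s => E s ^+ 2)).
  have := integrable_mul_absolutely_continuous iE ie EE'.
  by apply: eq_integrable.
split => //.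
rewrite -/(E t) expr2 (absolutely_continuous_product t0 ie ie EE' EE') mul0r add0r.
have iEc : mu.-integrable `[0, t] (EFin \o (fun s => (c + lam) * E s ^+ 2)).
  by have := integrableZl (mitv `[0, t]) (c + lam) iE2; apply: eq_integrable.
have igc : mu.-integrable `[0, t]
    (EFin \o (fun s => (K ^+ 2 / (c + lam)) * (expR (- c * s) * ga s) ^+ 2)).
  by have := integrableZl (mitv `[0, t]) (K ^+ 2 / (c + lam)) (iga t t0); apply: eq_integrable.
have ieE2 : mu.-integrable `[0, t] (EFin \o (fun s => e s * E s + e s * E s)).
  by have := integrableD (mitv `[0, t]) ieE ieE; apply: eq_integrable.
rewrite -(RintegralZl _ (mitv `[0, t]) iE2) -(RintegralZl _ (mitv `[0, t]) (iga t t0)).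
rewrite -(RintegralD (mitv `[0, t]) ieE2 iEc).
apply: le_Rintegral => //.
  by have := integrableD (mitv `[0, t]) ieE2 iEc; apply: eq_integrable.
move=> s; rewrite /= in_itv/= => /andP[s0 _].
rewrite /e /E; set x := expR _.
have -> : x * (dl s - c * D s) * (x * D s) + x * (dl s - c * D s) * (x * D s) +
    (c + lam) * (x * D s) ^+ 2 =
    x ^+ 2 * (2 * (D s * dl s) + (lam - c) * D s ^+ 2) by ring.
have -> : K ^+ 2 / (c + lam) * (x * ga s) ^+ 2 =
    x ^+ 2 * (K ^+ 2 / (c + lam) * ga s ^+ 2) by ring.
rewrite ler_wpM2l ?sqr_ge0//.
have := dis s s0; rewrite -(real_normK (num_real (D s))).
set n := `|D s| => h.
have := sqr_ge0 ((c + lam) * n - K * ga s).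
have -> : K ^+ 2 / (c + lam) * ga s ^+ 2 = (c + lam)^-1 *
    (((c + lam) * n - K * ga s) ^+ 2) - (c + lam) * n ^+ 2 + 2 * (K * n * ga s).
  by field; rewrite gt_eqF.
move=> q; have : 0 <= (c + lam)^-1 * ((c + lam) * n - K * ga s) ^+ 2.
  by rewrite mulr_ge0// invr_ge0 ltW.
lra.
Qed.

Let tail_arith (I a b J x y z c : R) : I - a = b -> J - x = y -> `|b| <= y ->
  z <= x -> `|J - z| < c -> I = - 2 * c -> c <= - a.
Proof. by rewrite ler_norml ltr_norml => ? ? /andP[? ?] ? /andP[? ?] ?; lra. Qed.

(* Otherwise [q] would eventually stay above a positive constant. *)
Lemma transversality (Phi : R -> R) (q : R -> \bar R) :
  mu.-integrable `[0, +oo[ (EFin \o Phi) ->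
  @measurable_fun _ _ R (\bar R) `[0, +oo[ q -> (forall t, 0 <= t -> (0 <= q t)%E) ->
  (\int[mu]_(t in `[0%R, +oo[) q t < +oo)%E ->
  (forall t, 0 <= t -> ((- \int[mu]_(s in `[0, t]) Phi s)%:E <= q t)%E) ->
  0 <= \int[mu]_(s in `[0, +oo[) Phi s.
Proof.
move=> iPhi mq q0 qoo Phiq; rewrite leNgt; apply/negP.
set I := \int[mu]_(s in `[0, +oo[) Phi s => I0.
(* Since [I = - 2 c], once the tail of the integral of [|Phi|] is below [c] the integral up to time
   [t] is at most [- c]. *)
pose c := - I / 2; have c0 : 0 < c by rewrite /c; lra.
have iN : mu.-integrable `[0, +oo[ (EFin \o (fun s => `|Phi s|)).
  by have := integrable_norm iPhi; apply: eq_integrable.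
have iNt t : 0 <= t -> mu.-integrable `[0, t] (EFin \o (fun s => `|Phi s|)).
  move=> t0; apply: integrableS iN => //.
  by apply: subset_itvl; rewrite bnd_simp.
pose N := (fun s => `|Phi s|) \_ `[0, +oo[.
have mN : measurable_fun setT N.
  have /measurable_EFinP mabs := measurable_int mu iN.
  exact: (iffLR (measurable_restrictT _ (measurable_itv _)) mabs).
have N0 s : 0 <= N s by rewrite /N patchE; case: ifPn.
have NE (t : R) : (\int[mu]_(s in `[0%R, t]) (N s)%:E = \int[mu]_(s in `[0%R, t]) (`|Phi s|)%:E)%E.
  apply: eq_integral => s; rewrite inE/= in_itv/= => /andP[s0 _].
  by rewrite /N patchE mem_set//= in_itv/= s0.
have cN := @ge0_cvgn_integral R mu N N0 mN.
set J := \int[mu]_(s in `[0, +oo[) `|Phi s|.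
have JE : (\int[mu]_(s in `[0%R, +oo[) (N s)%:E = J%:E)%E.
  rewrite /J /Rintegral fineK.
    apply: eq_integral => s; rewrite inE/= => sD.
    by rewrite /N patchE mem_set.
  exact: (integrable_fin_num (mitv _) iN).
rewrite JE in cN.
have /fine_cvgP[_ /cvgrPdist_lt/(_ c c0)] := cN.
move=> [n _ /(_ n (leqnn n))] /=; rewrite NE => Jn.
have tail t : n%:R <= t -> c <= - \int[mu]_(s in `[0, t]) Phi s.
  move=> nt; have t0 : 0 <= t by rewrite (le_trans _ nt).
  have sub : `]t, +oo[%classic `<=` `[0, +oo[%classic.
    by apply: subset_itvr; rewrite bnd_simp.
  have i1 : mu.-integrable `]t, +oo[ (EFin \o Phi) by apply: integrableS iPhi => //.
  have i2 : mu.-integrable `]t, +oo[ (EFin \o (fun s => `|Phi s|)) by apply: integrableS iN => //.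
  have e1 := @Rintegral_itvB R Phi (BLeft 0) +oo%O t iPhi.
  have e2 := @Rintegral_itvB R (fun s => `|Phi s|) (BLeft 0) +oo%O t iN.
  rewrite !bnd_simp in e1 e2; have {}e1 := e1 t0 isT; have {}e2 := e2 t0 isT.
  rewrite -/I in e1; rewrite -/J in e2.
  have l1 := le_normr_Rintegral (mitv _) i1.
  have l2 : \int[mu]_(s in `[0, n%:R]) `|Phi s| <= \int[mu]_(s in `[0, t]) `|Phi s|.
    rewrite /Rintegral fine_le//.
    - exact: (integrable_fin_num (mitv _) (iNt _ _)).
    - exact: (integrable_fin_num (mitv _) (iNt _ _)).
    - apply: ge0_subset_integral => //.
      + exact: (measurable_int mu (iNt t t0)).
      + by apply: subset_itvl; rewrite bnd_simp.
  by apply: (tail_arith e1 e2 l1 l2 Jn); rewrite /c; field.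
have : (\int[mu]_(t in `[n%:R, +oo[) c%:E <= \int[mu]_(t in `[0%R, +oo[) q t)%E.
  apply: (@le_trans _ _ (\int[mu]_(t in `[n%:R, +oo[) q t)%E).
    apply: ge0_le_integral => //.
    - by move=> t _; rewrite lee_fin ltW.
    - apply: measurable_funS mq => //.
      by apply: subset_itvr; rewrite bnd_simp.
    - move=> t; rewrite /= in_itv/= andbT => nt.
      apply: le_trans (Phiq t _); last by rewrite (le_trans _ nt).
      by rewrite lee_fin; exact: tail.
  apply: ge0_subset_integral => //.
  - by move=> t; rewrite /= in_itv/= andbT; exact: q0.
  - by apply: subset_itvr; rewrite bnd_simp.
have -> : (\int[mu]_(t in `[n%:R, +oo[) c%:E = +oo)%E.
  transitivity (c%:E * mu [set` `[n%:R, +oo[])%E; first exact: (integral_cst mu (mitv _)).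
  by rewrite lebesgue_measure_itv/= ltry gt0_muley ?lte_fin.
by move=> /le_lt_trans/(_ qoo); rewrite ltxx.
Qed.

End half_line.

(** * Discounted square-integrable processes *)

Section discounted_processes.
Context {d : measure_display} {T : measurableType d} {R : realType}.
Variable P : probability T R.
Notation mu := (@lebesgue_measure R).
Notation L := (mu \x P)%E.
Notation process := (R -> T -> R).
Implicit Types u v : process.

Let D : set (measurableTypeR R) := [set` `[0, +oo[].
Let DT : set (measurableTypeR R * T) := D `*` setT.

Let mitv (i : interval R) : @measurable _ (measurableTypeR R) ([set` i] : set R).
Proof. exact: measurable_itv. Qed.

Let DTP z : DT z -> 0 <= z.1.
Proof. by move=> [+ _]; rewrite /D/= in_itv/= andbT. Qed.

Let PDT t w : 0 <= t -> DT (t, w).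
Proof. by move=> t0; split => //; rewrite /D/= in_itv/= t0. Qed.

Let mDT : measurable DT. Proof. exact: measurable_strip (mitv _). Qed.

Definition measurable_process v := @measurable_fun _ _ (R * T)%type R
  (`[0, +oo[ `*` setT) (fun z => v z.1 z.2).

Definition discounted (c : R) v (z : R * T) : R := expR (- c * z.1) * v z.1 z.2.

(** For [c = r / 2] the squared weight is [e^(-rt)], so this is the condition of [L^2_r] without
    adaptedness, read as square integrability on the product of time and sample space. *)
Definition disc_sqint (c : R) v := measurable_process v /\
  sqint L DT (discounted c v).

Lemma measurable_discount (c : R) : measurable_fun DT (fun z => expR (- c * z.1)).
Proof.
apply: measurableT_comp => //; apply: measurable_funM => //.
exact: measurable_funS measurableT (@subsetT _ _) measurable_fst.
Qed.

Lemma measurable_discounted (c : R) v : measurable_process v ->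
  measurable_fun DT (discounted c v).
Proof. by move=> mv; apply: measurable_funM => //; exact: measurable_discount. Qed.

Lemma disc_sqint_le c u v : measurable_process u -> disc_sqint c v ->
  (forall t w, 0 <= t -> `|u t w| <= `|v t w|) -> disc_sqint c u.
Proof.
move=> mu' [mv sv] uv; split => //.
apply: (sqint_le mDT _ sv); first exact: measurable_discounted.
move=> [t w] /DTP t0.
by rewrite /discounted !normrM ler_wpM2l//; exact: uv.
Qed.

Lemma disc_sqintD c u v : disc_sqint c u -> disc_sqint c v ->
  disc_sqint c (fun t w => u t w + v t w).
Proof.
move=> [mu' su] [mv sv]; split; first exact: measurable_funD.
have := sqintD mDT su sv; congr (sqint _ _ _).
by apply/funext => z; rewrite /discounted mulrDr.
Qed.

Lemma disc_sqintZ c k v : disc_sqint c v -> disc_sqint c (fun t w => k * v t w).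
Proof.
move=> [mv sv]; split; first exact: measurable_funM.
have := sqintZ mDT k sv; congr (sqint _ _ _).
by apply/funext => z; rewrite /discounted mulrCA.
Qed.

Lemma disc_sqintB c u v : disc_sqint c u -> disc_sqint c v ->
  disc_sqint c (fun t w => u t w - v t w).
Proof.
move=> su /(disc_sqintZ (-1)) /(disc_sqintD su).
by congr disc_sqint; apply/funext => t; apply/funext => w; rewrite mulN1r.
Qed.

Lemma disc_sqint_norm c v : disc_sqint c v -> disc_sqint c (fun t w => `|v t w|).
Proof.
move=> sv; apply: disc_sqint_le (sv) _; last by move=> t w _; rewrite normr_id.
by apply: measurableT_comp => //; case: sv.
Qed.

Lemma disc_sqint_deterministic c (k : R -> R) : measurable_fun D k ->
  (\int[mu]_(t in D) ((expR (- c * t) * k t) ^+ 2)%:E < +oo)%E ->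
  disc_sqint c (fun t _ => k t).
Proof.
move=> mk koo.
have mk' : measurable_process (fun t _ => k t).
  apply: (@measurable_comp _ _ _ _ _ _ D _ _ (fst : R * T -> R)) => //.
  - exact: mitv.
  - by move=> _ [[t w] [/= tD _] <-].
  - exact: measurable_funS measurableT (@subsetT _ _) measurable_fst.
split=> //; apply: sqint_lty; first exact: measurable_discounted.
rewrite (@tonelli_strip12 _ _ _ _ _ mu P D (mitv _)
   (fun z => (discounted c (fun t _ => k t) z ^+ 2)%:E)).
- move: koo; congr (_ < _)%E; apply: eq_integral => t _.
  transitivity (((expR (- c * t) * k t) ^+ 2)%:E * P setT)%E.
    by rewrite probability_setT mule1.
  apply/esym; exact: (integral_cst P measurableT ((expR (- c * t) * k t) ^+ 2)%:E).
- by apply/measurable_EFinP; apply: measurable_funX; exact: measurable_discounted.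
- by move=> z _; rewrite lee_fin sqr_ge0.
Qed.

(** The integrand is [k^2 / (2 c)] times the exponential density of rate [2 c]. *)
Lemma disc_sqint_cst c k : 0 < c -> disc_sqint c (fun _ _ => k).
Proof.
move=> c0; apply: (@disc_sqint_deterministic c (fun=> k)) => //.
have c20 : 0 < 2 * c by rewrite mulr_gt0.
have ie := integrable_exponential_pdf c20.
apply: le_lt_trans (integrable_lty measurableT (integrableZl measurableT (k ^+ 2 / (2 * c)) ie)).
rewrite [leLHS]integral_mkcond; apply: ge0_le_integral => //.
- by move=> t _; apply: erestrict_ge0 => s _; rewrite lee_fin sqr_ge0.
- have m1 : measurable_fun D (fun t => ((expR (- c * t) * k) ^+ 2)%:E).
    apply/measurable_EFinP; apply: measurable_funX; apply: measurable_funM => //.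
    by apply: measurableT_comp => //; exact: measurable_funM.
  exact: (iffLR (measurable_restrictT _ (mitv _)) m1).
- apply/measurable_EFinP; apply: measurable_funM => //.
  exact: measurable_exponential_pdf.
- move=> t _; rewrite patchE; case: ifPn => [|_]; last first.
    rewrite lee_fin mulr_ge0 ?exponential_pdf_ge0 ?(ltW c20)//.
    by rewrite divr_ge0 ?sqr_ge0// ltW.
  rewrite inE /D/= in_itv/= andbT => t0; rewrite lee_fin.
  rewrite exponential_pdfE//.
  have -> : (expR (- c * t) * k) ^+ 2 = expR (- (2 * c) * t) * k ^+ 2.
    by rewrite exprMn expr2 -expRD; congr (expR _ * _); ring.
  rewrite le_eqVlt; apply/orP; left; apply/eqP; field.
  by rewrite gt_eqF.
Qed.

(** On [[0, t]] the weight is at least [e^(-ct)], so it can be removed at the price of a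
    constant. *)
Lemma disc_sqint_strip c t v : 0 <= c -> disc_sqint c v ->
  sqint L ([set` `[0, t]] `*` setT) (fun z => v z.1 z.2).
Proof.
move=> c0 [mv sv].
have sub : [set` `[0, t]] `*` [set: T] `<=` DT.
  by move=> [s w] [/=]; rewrite in_itv/= => /andP[s0 _] _; exact: PDT.
have mS : measurable ([set` `[0, t]] `*` [set: T] : set (measurableTypeR R * T)).
  exact: measurable_strip (mitv _).
have sS : sqint L ([set` `[0, t]] `*` [set: T]) (discounted c v).
  split; first exact: measurable_funS sv.1.
  exact: integrableS sv.2.
apply: (sqint_le mS _ (sqintZ mS (expR (c * t)) sS)).
  exact: measurable_funS mv.
move=> [s w] [/=]; rewrite in_itv/= => /andP[s0 st] _.
rewrite /discounted !normrM mulrA ler_peMl// !ger0_norm ?expR_ge0//.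
rewrite -expRD -expR0 ler_expR mulNr subr_ge0.
exact: ler_wpM2l.
Qed.

Lemma measurable_process_time v t : measurable_process v -> 0 <= t ->
  measurable_fun setT (v t).
Proof.
move=> mv t0; have tD : D t by rewrite /D/= in_itv/= t0.
have mE : @measurable_fun _ _ (measurableTypeR R * T)%type (\bar R) DT (fun z => (v z.1 z.2)%:E).
  exact/measurable_EFinP.
have := @measurable_strip_section2 _ _ _ _ _ D (mitv _) _ t tD mE.
by move/measurable_EFinP.
Qed.

Lemma measurable_process_path v w : measurable_process v ->
  @measurable_fun _ _ (measurableTypeR R) R D (v ^~ w).
Proof.
move=> mv.
have mE : @measurable_fun _ _ (measurableTypeR R * T)%type (\bar R) DT (fun z => (v z.1 z.2)%:E).
  exact/measurable_EFinP.
have := @measurable_strip_section1 _ _ _ _ _ D (mitv _) _ w mE.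
by move/measurable_EFinP.
Qed.

Lemma ae_disc_sqint_time c v : disc_sqint c v ->
  {ae mu, forall t, 0 <= t -> sqint P setT (v t)}.
Proof.
move=> [mv sv].
have := @ae_integrable_strip2 _ _ _ _ _ mu P D (mitv _) _ sv.2.
apply: filterS => t it t0; have tD : D t by rewrite /D/= in_itv/= t0.
have st : sqint P setT (fun w => expR (- c * t) * v t w).
  split; last exact: it.
  by apply: measurable_funM => //; exact: measurable_process_time.
have := sqintZ measurableT (expR (c * t)) st; congr (sqint _ _ _).
apply/funext => w; rewrite mulrA -expRD mulNr subrr expR0 mul1r.
by [].
Qed.

Lemma ae_disc_sqint_path c v : disc_sqint c v ->
  {ae P, forall w, sqint mu D (fun t => discounted c v (t, w))}.
Proof.
move=> [mv sv].
have := @ae_integrable_strip1 _ _ _ _ _ mu P D (mitv _) _ sv.2.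
apply: filterS => w iw; split; last exact: iw.
exact: (@measurable_process_path (fun t w => discounted c v (t, w)) w sv.1).
Qed.

Lemma L2rP (F : R -> set (set T)) (r : R) v : adapted_process F v ->
  L2r P F r v <-> disc_sqint (r / 2) v.
Proof.
move=> av; have mv : measurable_process v := adapted_measurable av.
have msd := measurable_discounted (r / 2) mv.
have E : (\int[P]_w \int[mu]_(t in `[0%R, +oo[) (expR (- r * t) * `|v t w| ^+ 2)%:E =
    \int[L]_(z in DT) (discounted (r / 2) v z ^+ 2)%:E)%E.
  rewrite (@tonelli_strip21 _ _ _ _ _ mu P D (mitv _)
    (fun z => (discounted (r / 2) v z ^+ 2)%:E)).
  - apply: eq_integral => w _; apply: eq_integral => t _; congr EFin.
    rewrite /discounted/= exprMn real_normK ?num_real//; congr (_ * _).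
    by rewrite [RHS]expr2 -expRD; congr expR; field.
  - by apply/measurable_EFinP; exact: measurable_funX.
  - by move=> z _; rewrite lee_fin sqr_ge0.
split=> [[_]|[_ sv]].
  by rewrite E => voo; split => //; exact: sqint_lty.
by split => //; rewrite E; exact: integral_sqint_lty.
Qed.

End discounted_processes.

(** * Measurability of the coefficients along processes *)

Lemma measurable_fun_pair_on d d1 d2 (T : measurableType d)
    (T1 : measurableType d1) (T2 : measurableType d2)
    (E : set T) (f : T -> T1) (g : T -> T2) :
  measurable_fun E f -> measurable_fun E g -> measurable_fun E (fun x => (f x, g x)).
Proof.
move=> mf mg mE.
apply: (measurability _ (measurable_prod_measurableType T1 T2)) => //.
move=> _ [_ [A mA [B mB <-]] <-].
have -> : E `&` (fun x => (f x, g x)) @^-1` (A `*` B) = (E `&` f @^-1` A) `&` (E `&` g @^-1` B).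
  by apply/seteqP; split => x [] => [? []|[? ?] []].
by apply: measurableI; [exact: mf|exact: mg].
Qed.

Section coefficients.
Context {R : realType}.
Implicit Types (A : set R) (g : @coefficient R).

(** A convex subset of the line is an interval. *)
Lemma convex_set_measurable A : @convex_set R R^o A -> measurable A.
Proof.
move=> cA; apply: is_interval_measurable => x y Ax Ay z /andP[xz zy].
have [xy|xy] := eqVneq x y.
  by have -> : z = x by apply/eqP; rewrite eq_le xz xy zy.
have yx : y - x != 0 by rewrite subr_eq0 eq_sym.
have yx0 : 0 < y - x by rewrite lt_neqAle eq_sym yx subr_ge0 (le_trans xz).
have -> : z = ((y - z) / (y - x)) * x + (1 - (y - z) / (y - x)) * y by field.
apply: convex_setE => //.
  by rewrite divr_ge0 ?(ltW yx0)// subr_ge0.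
by rewrite ler_pdivrMr// mul1r lerB.
Qed.

Lemma measurable_coefficient_comp (d' : measure_display) (T' : measurableType d')
    A g (E : set T') (x a : T' -> R) (m : T' -> @P2Borel R) :
  @convex_set R R^o A -> measurable_coefficient A g -> measurable E ->
  measurable_fun E x -> measurable_fun E m -> measurable_fun E a ->
  (forall z, E z -> P2 (m z)) -> (forall z, E z -> A (a z)) ->
  measurable_fun E (fun z => g (x z) (m z) (a z)).
Proof.
move=> cA mg mE mx mm ma Em Ea.
have mPA : @measurable _ (R * @P2Borel R * R)%type ([set: R] `*` P2 `*` A).
  apply: measurableX; last exact: convex_set_measurable.
  by apply: measurableX => //; exact: P2Borel_P2.
have mxma : @measurable_fun _ _ T' (R * @P2Borel R * R)%type E (fun z => (x z, m z, a z)).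
  exact: (measurable_fun_pair_on (measurable_fun_pair_on mx mm) ma).
apply: (measurable_comp mPA _ mg mxma).
by move=> _ [z Ez <-]; split; [split => //; exact: Em|exact: Ea].
Qed.

End coefficients.

(** * Moments along the curve of laws *)

Section law_curve.
Context {d : measure_display} {T : measurableType d} {R : realType}.
Variable P : probability T R.
Notation mu := (@lebesgue_measure R).
Variable X : R -> T -> R.

Let PT : (P setT < +oo)%E. Proof. by rewrite probability_setT ltry. Qed.

Let w t := Num.sqrt (\int[P]_u (X t u ^+ 2)).

Let w2 t : w t ^+ 2 = \int[P]_u (X t u ^+ 2).
Proof. by rewrite sqr_sqrtr// Rintegral_ge0// => u _; exact: sqr_ge0. Qed.

Lemma W2_law0 t : sqint P setT (X t) ->
  W2 (law P (X t)) (law P (fun=> 0)) <= w t.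
Proof.
move=> sX; apply: le_trans (W2_law_le sX (sqint_cst measurableT 0 PT)) _.
by rewrite /w; under eq_Rintegral do rewrite subr0.
Qed.

Lemma fine_second_moment t : sqint P setT (X t) ->
  fine (second_moment (law P (X t))) = w t ^+ 2.
Proof. by move=> [mX _]; rewrite second_moment_law// w2. Qed.

(** The size of the law in the growth bounds can thus be handled as one more process of the same
    space. *)
Lemma disc_sqint_moment c : disc_sqint P c X -> disc_sqint P c (fun t _ => w t).
Proof.
move=> [mX sX].
pose D : set (measurableTypeR R) := [set` `[0, +oo[].
have mD : measurable D by exact: measurable_itv.
have mX2 : @measurable_fun _ _ (measurableTypeR R * T)%type (\bar R) (D `*` setT)
    (fun z => (X z.1 z.2 ^+ 2)%:E).
  by apply/measurable_EFinP; exact: measurable_funX.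
have X20 z : (0 <= (X z.1 z.2 ^+ 2)%:E)%E by rewrite lee_fin sqr_ge0.
have mI := @measurable_strip_integral2 _ _ _ _ _ P D mD _ mX2 (fun z _ => X20 z).
have mw : measurable_fun D w.
  apply: measurableT_comp; first exact: (continuous_measurable_fun (@sqrt_continuous R)).
  by apply: measurableT_comp => //; exact: measurable_fine.
apply: disc_sqint_deterministic => //.
apply: le_lt_trans (integral_sqint_lty (measurable_strip mD) sX).
rewrite (@tonelli_strip12 _ _ _ _ _ mu P D mD
  (fun z => (discounted c X z ^+ 2)%:E)).
- apply: ge0_le_integral => //=.
  + by move=> t _; rewrite lee_fin sqr_ge0.
  + apply/measurable_EFinP; apply: measurable_funX; apply: measurable_funM => //.
    by apply: measurableT_comp => //; exact: measurable_funM.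
  + apply: (@measurable_strip_integral2 _ _ _ _ _ P D mD (fun z => (discounted c X z ^+ 2)%:E)).
      by apply/measurable_EFinP; apply: measurable_funX; case: sX.
    by move=> z _; rewrite lee_fin sqr_ge0.
  + move=> t; rewrite /D/= in_itv/= andbT => t0.
    rewrite /discounted/=; under [leRHS]eq_integral do rewrite exprMn EFinM.
    rewrite ge0_integralZl//=.
    * rewrite exprMn w2 EFinM lee_wpmul2l ?lee_fin ?sqr_ge0// /Rintegral.
      have : (0 <= \int[P]_u (X t u ^+ 2)%:E)%E.
        by apply: integral_ge0 => u _; rewrite lee_fin sqr_ge0.
      (* At a time where the second moment is infinite, [w t] is 0 by the convention of [fine], and
         the inequality still holds. *)
      by case: (integral _ _ _) => [r| |] //= _; rewrite leey.
    * by apply/measurable_EFinP; apply: measurable_funX; exact: measurable_process_time mX t0.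
    * by move=> u _; rewrite lee_fin sqr_ge0.
- by apply/measurable_EFinP; apply: measurable_funX; case: sX.
- by move=> z _; rewrite lee_fin sqr_ge0.
Qed.

End law_curve.

(** * Mean-square continuity under a dominated drift *)

Lemma Rintegral_cauchy_schwarz d (T : measurableType d) (R : realType)
    (mu : {measure set T -> \bar R}) (E : set T) (c : R) (f : T -> R) : measurable E ->
  mu E = c%:E -> sqint mu E f ->
  (\int[mu]_(x in E) f x) ^+ 2 <= c * \int[mu]_(x in E) f x ^+ 2.
Proof.
move=> mE Ec sf; have Eoo : (mu E < +oo)%E by rewrite Ec ltry.
set I := \int[mu]_(x in E) f x; set J := \int[mu]_(x in E) f x ^+ 2.
have c0 : 0 <= c by rewrite -lee_fin -Ec.
have iF := sqint_integrable mE Eoo sf.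
have J0 : 0 <= J by apply: Rintegral_ge0 => x _; exact: sqr_ge0.
have [c00|c00] := eqVneq c 0.
  have E0 : mu E = 0%E by rewrite Ec c00.
  suff -> : I = 0 by rewrite expr0n c00 mul0r.
  by rewrite /I /Rintegral (null_set_integral mE (measurable_int mu iF) E0).
have cp : 0 < c by rewrite lt_neqAle eq_sym c00.
(* With [c] the mass of [E], this integral equals [c (c J - I^2)], and [c > 0] can be divided
   out. *)
have : 0 <= \int[mu]_(x in E) (c * f x - I) ^+ 2.
  by apply: Rintegral_ge0 => x _; exact: sqr_ge0.
rewrite (@eq_Rintegral _ _ _ mu _ (fun x => (c ^+ 2 * f x ^+ 2 + (- 2 * c * I) * f x) + I ^+ 2)); last first.
  by move=> x _; ring.
have i1 : mu.-integrable E (EFin \o (fun x => c ^+ 2 * f x ^+ 2)).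
  by have := integrableZl mE (c ^+ 2) sf.2; apply: eq_integrable.
have i2 : mu.-integrable E (EFin \o (fun x => (- 2 * c * I) * f x)).
  by have := integrableZl mE (- 2 * c * I) iF; apply: eq_integrable.
have i3 : mu.-integrable E (EFin \o (fun x => I ^+ 2)).
  exact: (sqint_integrable mE Eoo (sqint_cst mE (I ^+ 2) Eoo)).
have i12 : mu.-integrable E (EFin \o (fun x => c ^+ 2 * f x ^+ 2 + (- 2 * c * I) * f x)).
  by have := integrableD mE i1 i2; apply: eq_integrable.
rewrite (RintegralD mE i12 i3) (RintegralD mE i1 i2) (RintegralZl _ mE sf.2).
rewrite (RintegralZl _ mE iF) Rintegral_cst// -/I -/J Ec /= => q.
have {}q : 0 <= c * (c * J - I ^+ 2) by move: q; congr (_ <= _); ring.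
by move: q; rewrite pmulr_rge0// subr_ge0.
Qed.

Lemma ae_lebesgueS (R : realType) (A B : R -> Prop) : (forall x, A x -> B x) ->
  {ae @lebesgue_measure R, forall x, A x} -> {ae @lebesgue_measure R, forall x, B x}.
Proof. exact: (@filterS _ _ (ae_filter_ringOfSetsType (@lebesgue_measure R))). Qed.

Section path_bound.
Context {R : realType}.
Notation mu := (@lebesgue_measure R).

Let mitv (i : interval R) : @measurable _ (measurableTypeR R) ([set` i] : set R).
Proof. exact: measurable_itv. Qed.

(** Cauchy-Schwarz on []s, t]]: its length gives the factor [t - s], and the energy of [phi] is
    taken over the fixed interval [[0, N]] to be uniform in [s] and [t]. *)
Lemma sqr_increment_bound (g phi : R -> R) (s t N : R) :
  0 <= s -> s <= t -> t <= N -> mu.-integrable `[0, t] (EFin \o g) ->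
  sqint mu [set` `[0, N]] phi ->
  {ae mu, forall u, 0 <= u -> `|g u| <= phi u} ->
  (\int[mu]_(u in `[0, t]) g u - \int[mu]_(u in `[0, s]) g u) ^+ 2 <=
  (t - s) * \int[mu]_(u in `[0, N]) phi u ^+ 2.
Proof.
move=> s0 st tN ig sphi gphi.
have e1 := @Rintegral_itvB R g (BLeft 0) (BRight t) s ig.
rewrite !bnd_simp in e1; rewrite e1//.
have sub0 : `]s, t]%classic `<=` `[0, t]%classic.
  by apply: subset_itvr; rewrite bnd_simp.
have subN : `]s, t]%classic `<=` `[0, N]%classic.
  by apply: subset_itv; rewrite bnd_simp.
have igst : mu.-integrable `]s, t] (EFin \o g) by exact: integrableS ig.
have mg : measurable_fun [set` `]s, t]] g.
  by apply/measurable_EFinP; exact: (measurable_int mu igst).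
have must : mu ([set` `]s, t]] : set R) = (t - s)%:E.
  rewrite lebesgue_measure_itv/= lte_fin; case: ltP => // ts.
  have -> : s = t by apply/eqP; rewrite eq_le st ts.
  by rewrite subrr.
have mphi : measurable_fun [set` `]s, t]] phi by exact: measurable_funS sphi.1.
have le1 : (\int[mu]_(u in `]s, t]) (g u ^+ 2)%:E <= \int[mu]_(u in `]s, t]) (phi u ^+ 2)%:E)%E.
  apply: ae_ge0_le_integral => //.
  - by move=> u _; rewrite lee_fin sqr_ge0.
  - by apply/measurable_EFinP; exact: measurable_funX.
  - by move=> u _; rewrite lee_fin sqr_ge0.
  - by apply/measurable_EFinP; exact: measurable_funX.
  - move: gphi; apply: ae_lebesgueS => u gu; rewrite /= in_itv/= => /andP[su _].
    rewrite lee_fin -(real_normK (num_real (g u))).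
    have u0 : 0 <= u by rewrite (le_trans s0)// ltW.
    have := gu u0; have := normr_ge0 (g u); nra.
have le2 : (\int[mu]_(u in `]s, t]) (phi u ^+ 2)%:E <= \int[mu]_(u in `[0%R, N]) (phi u ^+ 2)%:E)%E.
  apply: ge0_subset_integral => //.
  - by apply/measurable_EFinP; apply: measurable_funX; exact: sphi.1.
  - by move=> u _; rewrite lee_fin sqr_ge0.
have phioo := integral_sqint_lty (mitv _) sphi.
have sg : sqint mu [set` `]s, t]] g.
  by apply: sqint_lty => //; apply: le_lt_trans (le_trans le1 le2) phioo.
apply: le_trans (Rintegral_cauchy_schwarz (mitv _) must sg) _.
rewrite ler_wpM2l ?subr_ge0// /Rintegral fine_le//.
- exact: (integrable_fin_num (mitv _) sg.2).
- exact: (integrable_fin_num (mitv _) sphi.2).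
- exact: le_trans le1 le2.
Qed.

End path_bound.

Section dominated_drift.
Context {d : measure_display} {T : measurableType d} {R : realType}.
Variables (P : probability T R) (B : R -> T -> R).
Hypothesis hB : brownian_motion P B.
Notation mu := (@lebesgue_measure R).
Variables (X : R -> T -> R) (x0 : T -> R) (g phi : R -> T -> R) (c : R).
Hypotheses (c0 : 0 <= c) (mX : measurable_process X) (sx0 : sqint P setT x0).
Hypotheses (eqX : integral_equation P X x0 g B) (sphi : disc_sqint P c phi).
(** The bound is asked at almost every time: in the application it needs a finite second moment of
    the state, which membership in [L^2_r] provides only at almost every time. *)
Hypothesis gphi : {ae mu, forall s, 0 <= s -> forall w, `|g s w| <= phi s w}.

Let PT : (P setT < +oo)%E. Proof. by rewrite probability_setT ltry. Qed.

Let mitv (i : interval R) : @measurable _ (measurableTypeR R) ([set` i] : set R).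
Proof. exact: measurable_itv. Qed.

Let energy N := (\int[P]_w \int[mu]_(u in `[0%R, N]) (phi u w ^+ 2)%:E)%E.

Let energyE N : energy N = (\int[mu \x P]_(z in [set` `[0%R, N]] `*` setT) (phi z.1 z.2 ^+ 2)%:E)%E.
Proof.
have s := disc_sqint_strip N c0 sphi.
rewrite (@tonelli_strip21 _ _ _ _ _ mu P _ (mitv `[0, N]) (fun z => (phi z.1 z.2 ^+ 2)%:E)) //.
- by apply/measurable_EFinP; apply: measurable_funX; exact: s.1.
- by move=> z _; rewrite lee_fin sqr_ge0.
Qed.

Let energy_fin N : energy N \is a fin_num.
Proof.
rewrite energyE; apply: integrable_fin_num; last exact: (disc_sqint_strip N c0 sphi).2.
exact: measurable_strip (mitv _).
Qed.

(** An increment is a drift part plus a Brownian part, and [(p + q)^2 <= 2 p^2 + 2 q^2]. The first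
    contributes twice the energy of [phi], the second [2 * 16]. *)
Lemma drift_increment N : exists2 C : R, 0 <= C & forall s t : R, 0 <= s -> s <= t -> t <= N ->
  (\int[P]_w ((X t w - X s w) ^+ 2)%:E <= (C * (t - s))%:E)%E.
Proof.
exists (2 * fine (energy N) + 32).
  rewrite addr_ge0// mulr_ge0// fine_ge0// integral_ge0// => w _.
  by apply: integral_ge0 => u _; rewrite lee_fin sqr_ge0.
move=> s t s0 st tN; have t0 := le_trans s0 st.
have sN := disc_sqint_strip N c0 sphi.
have mE : measurable_fun setT (fun w => \int[mu]_(u in `[0%R, N]) (phi u w ^+ 2)%:E)%E.
  apply: (@measurable_strip_integral1 _ _ _ _ _ mu _ (mitv `[0, N]) (fun z => (phi z.1 z.2 ^+ 2)%:E)).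
  - by apply/measurable_EFinP; apply: measurable_funX; exact: sN.1.
  - by move=> z _; rewrite lee_fin sqr_ge0.
have E0 w : (0 <= \int[mu]_(u in `[0%R, N]) (phi u w ^+ 2)%:E)%E.
  by apply: integral_ge0 => u _; rewrite lee_fin sqr_ge0.
have [sB EB _] := increment_moments hB s0 st.
have mXt := measurable_process_time mX t0; have mXs := measurable_process_time mX s0.
have gphi' w : {ae mu, forall u, 0 <= u -> `|g u w| <= phi u w}.
  by move: gphi; apply: ae_lebesgueS => u h u0; exact: h.
have path := @ae_integrable_strip1 _ _ _ _ _ mu P _ (mitv `[0, N]) _ sN.2.
have k0 : 0 <= 2 * (t - s) by rewrite mulr_ge0// subr_ge0.
apply: (@le_trans _ _ (\int[P]_w ((2 * (t - s))%:E * \int[mu]_(u in `[0%R, N]) (phi u w ^+ 2)%:E +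
    2%:E * ((B t w - B s w) ^+ 2)%:E))%E).
  apply: ae_ge0_le_integral => //.
  - by move=> w _; rewrite lee_fin sqr_ge0.
  - by apply/measurable_EFinP; apply: measurable_funX; exact: measurable_funB.
  - by move=> w _; rewrite adde_ge0// ?mule_ge0// lee_fin ?sqr_ge0.
  - apply: emeasurable_funD; first exact: measurable_funeM.
    apply: measurable_funeM; apply/measurable_EFinP; apply: measurable_funX; exact: sB.1.
  - apply: filterS2 eqX path => w eqw pathw _.
    have [igt Xt] := eqw t t0; have [_ Xs] := eqw s s0.
    have sp : sqint mu [set` `[0, N]] (phi ^~ w).
      split; last exact: pathw.
      apply: measurable_funS (measurable_process_path w sphi.1) => //.
      by apply: subset_itvl; rewrite bnd_simp.
    have bnd := sqr_increment_bound s0 st tN igt sp (gphi' w).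
    rewrite Xt Xs.
    have fE : (\int[mu]_(u in `[0%R, N]) (phi u w ^+ 2)%:E =
        (\int[mu]_(u in `[0, N]) (phi u w ^+ 2))%:E)%E.
      by rewrite /Rintegral fineK//; exact: (integrable_fin_num (mitv _) sp.2).
    rewrite fE -!EFinM -EFinD lee_fin.
    move: bnd; set p := _ - _; set q := Rintegral _ _ _ => bnd.
    have := sqr_ge0 (p - (B t w - B s w)).
    have -> : x0 w + \int[mu]_(u in `[0, t]) g u w + B t w -
      (x0 w + \int[mu]_(u in `[0, s]) g u w + B s w) = p + (B t w - B s w).
      by rewrite /p; ring.
    move: (B t w - B s w) => r; nra.
rewrite ge0_integralD//.
- rewrite ge0_integralZl// ge0_integralZl//.
  + rewrite -/(energy N) -(fineK (energy_fin N)) -EFinM.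
    apply: (@le_trans _ _ ((2 * (t - s) * fine (energy N))%:E + 2%:E * (16 * (t - s))%:E)%E).
      by rewrite leeD2l// lee_wpmul2l// lee_fin.
    by rewrite -EFinM -EFinD lee_fin le_eqVlt; apply/orP; left; apply/eqP; ring.
  + by apply/measurable_EFinP; apply: measurable_funX; exact: sB.1.
  + by move=> w _; rewrite lee_fin sqr_ge0.
- by move=> w _; rewrite mule_ge0// lee_fin.
- exact: measurable_funeM.
- by move=> w _; rewrite mule_ge0// lee_fin sqr_ge0.
- by apply: measurable_funeM; apply/measurable_EFinP; apply: measurable_funX; exact: sB.1.
Qed.

(** This improves almost every time to every time: [X t - X 0] is controlled by the increment bound,
    and [X 0] equals [x0] almost surely because [B] starts at 0. *)
Lemma drift_sqint t : 0 <= t -> sqint P setT (X t).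
Proof.
move=> t0; have [C C0 XC] := drift_increment t.
have mXt := measurable_process_time mX t0.
have mX0 := measurable_process_time mX (lexx 0).
have sD : sqint P setT (fun w => X t w - X 0 w).
  apply: sqint_lty; first exact: measurable_funB.
  by apply: le_lt_trans (XC 0 t (lexx _) t0 (lexx _)) _; rewrite ltry.
have sX0 : sqint P setT (X 0).
  split => //; apply/integrableP; split.
    by apply/measurable_EFinP; exact: measurable_funX.
  have [_ /integrableP[_]] := sx0; congr (_ < _)%E.
  apply: ge0_ae_eq_integral => //.
  - by apply: measurableT_comp => //; apply/measurable_EFinP; apply: measurable_funX; exact: sx0.1.
  - by apply: measurableT_comp => //; apply/measurable_EFinP; exact: measurable_funX.
  - apply: filterS2 eqX (bm_start hB) => w eqw B0 _.
    have [_ E0] := eqw 0 (lexx 0); rewrite /= E0.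
    by rewrite set_itv1 Rintegral_set1 addr0 B0 addr0.
have := sqintD measurableT sD sX0; congr (sqint _ _ _).
by apply/funext => w; rewrite subrK.
Qed.

Lemma drift_measurable_law :
  @measurable_fun _ _ R (@P2Borel R) `[0, +oo[ (fun t => law P (X t)).
Proof.
apply: measurable_law => [|t t0 e e0]; first exact: drift_sqint.
have [C C0 XC] := drift_increment (t + 1).
(* The cap 1 keeps [s] below the horizon [t + 1] of the constant [C]; [C + 1] avoids a division by
   zero. *)
pose dl := Num.min 1 (e / (C + 1)).
have C1 : 0 < C + 1 by rewrite ltr_wpDl.
exists dl; first by rewrite /dl lt_min ltr01 divr_gt0.
move=> s s0 std.
have std1 : `|s - t| < 1 by apply: lt_le_trans std _; rewrite /dl ge_min lexx.
have stde : `|s - t| < e / (C + 1) by apply: lt_le_trans std _; rewrite /dl ge_min lexx orbT.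
rewrite ltr_pdivlMr// in stde.
have key a b : 0 <= a -> a <= b -> b <= t + 1 -> `|s - t| = b - a ->
    \int[P]_w ((X b w - X a w) ^+ 2) < e.
  move=> a0 ab bt sE; have := XC a b a0 ab bt.
  have sab := sqintB measurableT (drift_sqint (le_trans a0 ab)) (drift_sqint a0).
  have fE : (\int[P]_w ((X b w - X a w) ^+ 2)%:E = (\int[P]_w ((X b w - X a w) ^+ 2))%:E)%E.
    by rewrite /Rintegral fineK//; exact: (integrable_fin_num measurableT sab.2).
  rewrite fE lee_fin => /le_lt_trans; apply; rewrite -sE.
  apply: le_lt_trans stde; rewrite mulrC ler_wpM2l//; lra.
have [st|ts] := leP s t.
  apply: key => //; first by rewrite lerDl.
  by rewrite distrC ger0_norm// subr_ge0.
rewrite (@eq_Rintegral _ _ _ P _ (fun w => (X s w - X t w) ^+ 2)); last first.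
  by move=> w _; rewrite -sqrrN opprB.
apply: key => //; first exact: ltW.
  by move: std1; rewrite ltr_norml => /andP[_]; lra.
by rewrite ger0_norm// subr_ge0 ltW.
Qed.

End dominated_drift.

(** * Stability of the controlled state *)

Section half_line_comparison.
Context {R : realType}.
Notation mu := (@lebesgue_measure R).

Let mitv (i : interval R) : @measurable _ (measurableTypeR R) ([set` i] : set R).
Proof. exact: measurable_itv. Qed.

Lemma half_line_le (f : R -> R) (M : \bar R) :
  @measurable_fun _ _ (measurableTypeR R) R [set` `[0, +oo[] f ->
  (forall s, 0 <= s -> 0 <= f s) ->
  (forall t, 0 <= t -> (\int[mu]_(s in `[0%R, t]) (f s)%:E <= M)%E) ->
  (\int[mu]_(s in `[0%R, +oo[) (f s)%:E <= M)%E.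
Proof.
move=> mf f0 fM; pose N := f \_ `[0, +oo[.
have mN : measurable_fun setT N.
  exact: (iffLR (measurable_restrictT _ (mitv _)) mf).
have N0 s : 0 <= N s.
  by rewrite /N patchE; case: ifPn => //; rewrite inE/= in_itv/= andbT; exact: f0.
have -> : (\int[mu]_(s in `[0%R, +oo[) (f s)%:E = \int[mu]_(s in `[0%R, +oo[) (N s)%:E)%E.
  by apply: eq_integral => s sD; rewrite /N patchE sD.
rewrite (@ge0_integral_ereal_sup R mu N N0 mN).
apply: ge_ereal_sup => _ [n _ <-].
apply: le_trans (fM n.+1%:R (ler0n _ _)).
rewrite le_eqVlt; apply/orP; left; apply/eqP; apply: eq_integral => s.
by rewrite inE/= in_itv/= => /andP[s0 _]; rewrite /N patchE mem_set//= in_itv/= s0.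
Qed.

End half_line_comparison.

Section bounds.
Context {d : measure_display} {T : measurableType d} {R : realType}.
Variables (P : probability T R) (r : R) (A : set R) (b f : @coefficient R).
Hypothesis h1 : growth_assumption A b f r.
Variables (Xi : R -> T -> R) (a0 : R).
Hypothesis Aa0 : A a0.
Let m t := law P (Xi t).
Let w t := Num.sqrt (\int[P]_u (Xi t u ^+ 2)).

Let PT : (P setT < +oo)%E. Proof. by rewrite probability_setT ltry. Qed.

(** Linear growth from the Lipschitz property, anchored at the point 0, the law of the constant 0
    and the control [a0]; the distance of [m t] to that law is at most [w t]. *)
Lemma drift_bound : exists2 C : R, 0 <= C & forall t x a, sqint P setT (Xi t) -> A a ->
  `|b x (m t) a| <= C * (1 + `|x| + w t + `|a|).
Proof.
have [K bK] := b_lipschitz h1.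
pose m0 := law P (fun=> 0).
pose C := `|b 0 m0 a0| + `|K| * (1 + `|a0|).
have C0 : 0 <= C by rewrite addr_ge0// mulr_ge0// addr_ge0.
have KC : `|K| <= C.
  rewrite /C mulrDr mulr1; have := normr_ge0 (b 0 m0 a0).
  have := mulr_ge0 (normr_ge0 K) (normr_ge0 a0); lra.
exists C => // t x a sX Aa.
have Pm0 : P2 m0 by apply: P2_law; exact: sqint_cst.
have := bK x 0 (m t) m0 a a0 (P2_law sX) Pm0 Aa Aa0.
have W := W2_law0 sX; rewrite -/(w t) -/(m t) -/m0 in W.
have W0 : 0 <= W2 (m t) m0 by rewrite sqrtr_ge0.
rewrite subr0 => bb.
have {}bb : `|b x (m t) a - b 0 m0 a0| <= `|K| * (`|x| + w t + (`|a| + `|a0|)).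
  apply: le_trans bb _; apply: le_trans (_ : `|K| * (`|x| + W2 (m t) m0 + `|a - a0|) <= _).
    by rewrite ler_wpM2r ?ler_norm// !addr_ge0.
  rewrite ler_wpM2l// lerD ?ler_normB// lerD2l.
  exact: W.
have := lerD bb (lexx `|b 0 m0 a0|); rewrite -/m0 => /(le_trans _) h.
have {}h : `|b x (m t) a| <= `|K| * (`|x| + w t + (`|a| + `|a0|)) + `|b 0 m0 a0|.
  by apply: h; rewrite -[in leLHS](subrK (b 0 m0 a0) (b x (m t) a)) ler_normD.
apply: le_trans h _.
have w0 : 0 <= w t by rewrite sqrtr_ge0.
have S0 : 0 <= `|x| + w t + `|a| by rewrite !addr_ge0.
have := ler_wpM2r S0 KC; have := normr_ge0 K; rewrite /C; nra.
Qed.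

Lemma running_cost_bound : exists2 C : R, 0 <= C & forall t x a, sqint P setT (Xi t) -> A a ->
  `|f x (m t) a| <= C * (1 + x ^+ 2 + w t ^+ 2 + a ^+ 2).
Proof.
have [K fK] := f_growth h1; exists `|K| => // t x a sX Aa.
have := fK x (m t) a (P2_law sX) Aa; rewrite (fine_second_moment sX) -/(w t).
move/le_trans; apply; rewrite ler_wpM2r ?ler_norm//.
by rewrite !addr_ge0// ?sqr_ge0.
Qed.

Lemma drift_lipschitz : exists2 K : R, 0 <= K & forall t x x' a a',
  sqint P setT (Xi t) -> A a -> A a' ->
  `|b x (m t) a - b x' (m t) a'| <= K * (`|x - x'| + `|a - a'|).
Proof.
have [K bK] := b_lipschitz h1; exists `|K| => // t x x' a a' sX Aa Aa'.
have := bK x x' (m t) (m t) a a' (P2_law sX) (P2_law sX) Aa Aa'.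
have W0 : W2 (m t) (m t) = 0.
  apply/eqP; rewrite eq_le sqrtr_ge0 andbT.
  apply: le_trans (W2_law_le sX sX) _.
  under eq_Rintegral do rewrite subrr expr0n/=.
  by rewrite Rintegral_cst// mul0r sqrtr0.
rewrite W0 addr0 => /le_trans; apply; rewrite ler_wpM2r ?ler_norm ?addr_ge0//.
Qed.

End bounds.

Section stability.
Context {d : measure_display} {T : measurableType d} {R : realType}.
Variables (P : probability T R) (B : R -> T -> R) (F : R -> set (set T)).
Variables (r : R) (A : set R) (b f : @coefficient R).
Hypotheses (hr : 0 < r) (h1 : growth_assumption A b f r).
Variable Xi : R -> T -> R.
Hypothesis sXi : forall t, 0 <= t -> sqint P setT (Xi t).
Let m t := law P (Xi t).
Notation mu := (@lebesgue_measure R).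
Variables (x : R) (X1 X2 be1 be2 : R -> T -> R).
Hypotheses (cX1 : controlled_state P F B b x m be1 X1).
Hypotheses (cX2 : controlled_state P F B b x m be2 X2).
Hypotheses (abe1 : admissible P F r A be1) (abe2 : admissible P F r A be2).

Let mitv (i : interval R) : @measurable _ (measurableTypeR R) ([set` i] : set R).
Proof. exact: measurable_itv. Qed.

Let c := r / 2.

Let sbe : disc_sqint P c (fun t w => be1 t w - be2 t w).
Proof.
apply: disc_sqintB.
- exact: (iffLR (L2rP P r abe1.1.1) abe1.1).
- exact: (iffLR (L2rP P r abe2.1.1) abe2.1).
Qed.

Lemma state_difference : {ae P, forall w t, 0 <= t ->
  mu.-integrable `[0, t] (EFin \o (fun s => b (X1 s w) (m s) (be1 s w) - b (X2 s w) (m s) (be2 s w))) /\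
  X1 t w - X2 t w =
    \int[mu]_(s in `[0, t]) (b (X1 s w) (m s) (be1 s w) - b (X2 s w) (m s) (be2 s w))}.
Proof.
have [_ e1] := cX1; have [_ e2] := cX2.
apply: filterS2 e1 e2 => w e1 e2 t t0.
have [i1 E1] := e1 t t0; have [i2 E2] := e2 t t0; split.
  by have := integrableB (mitv `[0, t]) i1 i2; apply: eq_integrable.
by rewrite (RintegralB (mitv `[0, t]) i1 i2) E1 E2; ring.
Qed.

(** The noise cancels in [X1 - X2], so the deterministic energy estimate applies to almost every
    path. *)
Lemma state_stability : exists2 k : R * R, 0 < k.1 /\ 0 <= k.2 &
  {ae P, forall w t, 0 <= t ->
  (expR (- c * t) * (X1 t w - X2 t w)) ^+ 2 +
    k.1 * \int[mu]_(s in `[0, t]) (expR (- c * s) * (X1 s w - X2 s w)) ^+ 2 <=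
    k.2 * \int[mu]_(s in `[0, t]) (expR (- c * s) * (be1 s w - be2 s w)) ^+ 2 /\
  mu.-integrable `[0, t] (EFin \o (fun s => (expR (- c * s) * (X1 s w - X2 s w)) ^+ 2)) /\
  mu.-integrable `[0, t] (EFin \o (fun s => (expR (- c * s) * (be1 s w - be2 s w)) ^+ 2))}.
Proof.
have [ell [lam [ell0 lam_gt _ dis]]] := b_dissipative h1.
have [K K0 bK] := drift_lipschitz P h1 Xi.
(* This is where [lambda > ell - r/2] enters, with [ell > 0]. *)
have cl : 0 < c + lam by rewrite /c; lra.
exists (c + lam, K ^+ 2 / (c + lam)).
  by split => //=; rewrite divr_ge0 ?sqr_ge0// ltW.
have path := ae_disc_sqint_path sbe.
apply: filterS2 state_difference path => w Dw gw t t0 /=.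
have ig s : 0 <= s ->
    mu.-integrable `[0, s] (EFin \o (fun s => (expR (- c * s) * `|be1 s w - be2 s w|) ^+ 2)).
  move=> s0; have := gw.2; rewrite /discounted/= => gi.
  have := integrableS (mitv _) (mitv `[0, s]) _ gi.
  have sub : [set` `[0, s]] `<=` [set` `[0, +oo[] by apply: subset_itvl; rewrite bnd_simp.
  move=> /(_ sub); apply: eq_integrable => // u _ /=.
  by congr EFin; rewrite !exprMn real_normK ?num_real.
pose D s := X1 s w - X2 s w.
pose dl s := b (X1 s w) (m s) (be1 s w) - b (X2 s w) (m s) (be2 s w).
have dis' s : 0 <= s -> D s * dl s <= - lam * D s ^+ 2 + K * `|D s| * `|be1 s w - be2 s w|.
  move=> s0; have sX := sXi s0; have A1 := abe1.2 s w s0; have A2 := abe2.2 s w s0.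
  have d1 := dis (X1 s w) (X2 s w) (m s) (be1 s w) (P2_law sX) A1.
  have l1 := bK s (X2 s w) (X2 s w) (be1 s w) (be2 s w) sX A1 A2.
  rewrite subrr normr0 add0r in l1.
  (* The state moves first, with the control fixed at [be1], and uses dissipativity; then the
     control moves, at the fixed state [X2], and uses the Lipschitz bound. *)
  have -> : D s * dl s = (X1 s w - X2 s w) * (b (X1 s w) (m s) (be1 s w) - b (X2 s w) (m s) (be1 s w))
      + D s * (b (X2 s w) (m s) (be1 s w) - b (X2 s w) (m s) (be2 s w)).
    by rewrite /D /dl; ring.
  apply: lerD => //; apply: le_trans (ler_norm _) _.
  by rewrite normrM -mulrA mulrCA; apply: ler_wpM2l => //; rewrite normr_ge0.
have [iD bnd] := @dissipative_bound R c lam K D dl (fun s => `|be1 s w - be2 s w|) cl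
  (fun s s0 => (Dw s s0).1) (fun s s0 => (Dw s s0).2) dis' ig t t0.
have gE : (fun s => (expR (- c * s) * `|be1 s w - be2 s w|) ^+ 2) =
    (fun s => (expR (- c * s) * (be1 s w - be2 s w)) ^+ 2).
  by apply/funext => s; rewrite !exprMn real_normK ?num_real.
split; first by move: bnd; rewrite gE.
by split => //; rewrite -gE; exact: ig.
Qed.

Lemma state_unique : (forall t w, 0 <= t -> be1 t w = be2 t w) ->
  {ae P, forall w t, 0 <= t -> X1 t w = X2 t w}.
Proof.
move=> bee; have [[k1 k2] [/= k10 k20] st] := state_stability.
apply: filterS st => w st t t0; have [bnd _] := st t t0.
rewrite [X in _ <= _ * X](_ : _ = 0) in bnd; last first.
  rewrite (@eq_Rintegral _ _ _ mu _ (fun=> 0)).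
    by rewrite Rintegral_cst// mul0r.
  by move=> s; rewrite inE/= in_itv/= => /andP[s0 _]; rewrite bee// subrr mulr0 expr0n.
rewrite mulr0 in bnd.
have I0 : 0 <= \int[mu]_(s in `[0, t]) (expR (- c * s) * (X1 s w - X2 s w)) ^+ 2.
  by apply: Rintegral_ge0 => s _; exact: sqr_ge0.
have := mulr_ge0 (ltW k10) I0 => kI.
have : (expR (- c * t) * (X1 t w - X2 t w)) ^+ 2 <= 0 by apply: le_trans bnd; rewrite lerDl.
rewrite real_exprn_even_le0 ?num_real//= mulf_eq0 gt_eqF ?expR_gt0//=.
by rewrite subr_eq0 => /eqP.
Qed.

(** The nonnegative pointwise term of the stability estimate is dropped, and its time integral
    passes to the half-line by monotone convergence before the expectation is taken. *)
Lemma disc_sqint_state_difference : disc_sqint P c (fun t w => X1 t w - X2 t w).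
Proof.
have mX1 : measurable_process X1 := adapted_measurable cX1.1.
have mX2 : measurable_process X2 := adapted_measurable cX2.1.
have mD : measurable_process (fun t w => X1 t w - X2 t w) by exact: measurable_funB.
split => //; have msd := measurable_discounted c mD.
apply: sqint_lty => //.
have [[k1 k2] [/= k10 k20] st] := state_stability.
pose S : set (measurableTypeR R) := [set` `[0, +oo[].
have mS : measurable S := mitv _.
have be_lty := integral_sqint_lty (measurable_strip mS) sbe.2.
have mE (v : R -> T -> R) : measurable_process v ->
    @measurable_fun _ _ (measurableTypeR R * T)%type (\bar R) (S `*` setT)
      (fun z => (discounted c v z ^+ 2)%:E).
  by move=> mv; apply/measurable_EFinP; apply: measurable_funX; exact: measurable_discounted.
have pE (v : R -> T -> R) z : (0 <= (discounted c v z ^+ 2)%:E)%E.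
  by rewrite lee_fin sqr_ge0.
rewrite (@tonelli_strip21 _ _ _ _ _ mu P S mS _ (mE _ sbe.1) (fun z _ => pE _ z)) in be_lty.
rewrite (@tonelli_strip21 _ _ _ _ _ mu P S mS _ (mE _ mD) (fun z _ => pE _ z)).
apply: (@le_lt_trans _ _ (\int[P]_w ((k2 / k1)%:E * \int[mu]_(s in S)
    (discounted c (fun t w => be1 t w - be2 t w) (s, w) ^+ 2)%:E))%E).
  apply: ae_ge0_le_integral => //.
  - by move=> w _; apply: integral_ge0.
  - exact: (@measurable_strip_integral1 _ _ _ _ _ mu S mS _ (mE _ mD) (fun z _ => pE _ z)).
  - by move=> w _; rewrite mule_ge0 ?lee_fin ?divr_ge0 ?(ltW k10)//; exact: integral_ge0.
  - apply: measurable_funeM.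
    exact: (@measurable_strip_integral1 _ _ _ _ _ mu S mS _ (mE _ sbe.1) (fun z _ => pE _ z)).
  - apply: filterS st => w st _; apply: half_line_le.
    + apply: measurable_funX.
      exact: (@measurable_process_path d T R (fun t w => discounted c (fun t w => X1 t w - X2 t w) (t, w)) w msd).
    + by move=> s _; exact: sqr_ge0.
    + move=> t t0; have [bnd [iD ibe]] := st t t0.
      apply: (@le_trans _ _ ((k2 / k1)%:E * \int[mu]_(s in `[0%R, t])
          (discounted c (fun t w => be1 t w - be2 t w) (s, w) ^+ 2)%:E)%E); last first.
        rewrite lee_wpmul2l ?lee_fin ?divr_ge0 ?(ltW k10)//.
        apply: ge0_subset_integral => //.
        * by apply/measurable_EFinP; apply: measurable_funX; exact: (@measurable_process_path d T R (fun t w => discounted c (fun t w => be1 t w - be2 t w) (t, w)) w sbe.2.1).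
        * by apply: subset_itvl; rewrite bnd_simp.
      rewrite /discounted/= -(fineK (integrable_fin_num (mitv _) iD)).
      rewrite -(fineK (integrable_fin_num (mitv _) ibe)) -EFinM lee_fin.
      rewrite -/(Rintegral _ _ _) -/(Rintegral _ _ _) mulrAC ler_pdivlMr// mulrC.
      by move: bnd; have := sqr_ge0 (expR (- c * t) * (X1 t w - X2 t w)); lra.
rewrite ge0_integralZl//.
- by rewrite lte_mul_pinfty// lee_fin divr_ge0// ltW.
- exact: (@measurable_strip_integral1 _ _ _ _ _ mu S mS _ (mE _ sbe.1) (fun z _ => pE _ z)).
- by move=> w _; apply: integral_ge0.
- by rewrite lee_fin divr_ge0// ltW.
Qed.

End stability.

(** * The Hamiltonian *)

Section hamiltonian.
Context {R : realType}.
Variables (A : set R) (b f : @coefficient R) (r : R) (alpha : R -> R -> R).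
Hypotheses (hA : @convex_set R R^o A) (h2 : structure_assumption A b f alpha).
Hypothesis hH : forall mu y, P2 mu -> convex_xa A (fun x a => Hamiltonian b f r x mu a y).

Let dxH x mu y := dx_Hamiltonian b f r x mu (alpha x y) y.

Lemma hamiltonian_gradient x mu y : P2 mu -> exists q,
  gradient_within A (fun x' a' => Hamiltonian b f r x' mu a' y) x (alpha x y) (dxH x mu y) q.
Proof.
move=> Pmu; have [Aa _] := alpha_minimizer h2 x y.
have [bx [ba [Kb [gb _]]]] := b_differentiable h2.
have [fx [fa [Kf [gf _]]]] := f_differentiable h2.
set a := alpha x y in Aa *.
have gH : gradient_within A (fun x' a' => Hamiltonian b f r x' mu a' y) x a
    (bx x mu a * y + fx x mu a - r * y) (ba x mu a * y + fa x mu a).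
  (* Half of [e] goes to [f] and half to [b], whose error gets multiplied by [y]; the term [- r x y]
     is linear in [x] and adds no error. *)
  move=> e e0; have e2 : 0 < e / (2 * (1 + `|y|)) by rewrite divr_gt0// mulr_gt0// ltr_wpDr.
  have [d1 d10 gd1] := gb x mu a Pmu Aa _ e2.
  have e3 : 0 < e / 2 by rewrite divr_gt0.
  have [d2 d20 gd2] := gf x mu a Pmu Aa _ e3.
  exists (Num.min d1 d2); first by rewrite lt_min d10.
  move=> x' a' Aa'; rewrite !lt_min => /andP[x1 x2] /andP[a1 a2].
  have := gd1 x' a' Aa' x1 a1; have := gd2 x' a' Aa' x2 a2.
  rewrite /Hamiltonian.
  set u := _ - _ - _ - _; set v := _ - _ - _ - _ => hu hv.
  have -> : b x' mu a' * y + f x' mu a' - r * x' * y - (b x mu a * y + f x mu a - r * x * y) -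
      (bx x mu a * y + fx x mu a - r * y) * (x' - x) - (ba x mu a * y + fa x mu a) * (a' - a) =
      v * y + u by rewrite /u /v; ring.
  apply: le_trans (ler_normD _ _) _; rewrite normrM.
  set N := `|x' - x| + `|a' - a| in hu hv *.
  have N0 : 0 <= N by rewrite addr_ge0.
  apply: le_trans (lerD (ler_wpM2r (normr_ge0 y) hv) hu) _.
  have y1 : 0 < 1 + `|y| by rewrite ltr_wpDr.
  have -> : e / (2 * (1 + `|y|)) * N * `|y| = e / 2 * N * (`|y| / (1 + `|y|)).
    by field; rewrite gt_eqF.
  have q : `|y| / (1 + `|y|) <= 1 by rewrite ler_pdivrMr// mul1r lerDr.
  have eN : 0 <= e / 2 * N by rewrite mulr_ge0// ltW.
  have := ler_wpM2l eN q.
  have -> : e * N = e / 2 * N + e / 2 * N by field.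
  by rewrite mulr1 lerD2r.
exists (ba x mu a * y + fa x mu a).
have -> : dxH x mu y = bx x mu a * y + fx x mu a - r * y; last exact: gH.
exact: gradient_within_derive1 gH.
Qed.

Lemma hamiltonian_min x mu y a : P2 mu -> A a ->
  Hamiltonian b f r x mu (alpha x y) y <= Hamiltonian b f r x mu a y.
Proof.
move=> Pmu Aa; have [_ /(_ mu Pmu)[m0 _]] := alpha_minimizer h2 x y.
by rewrite /Hamiltonian lerD2r; exact: m0.
Qed.

(** The pointwise form of the sufficient maximum principle: joint convexity lets state and control
    vary together, while minimality at [alpha x y] leaves only the derivative in [x]. *)
Lemma hamiltonian_tangent x mu y x' a' : P2 mu -> A a' ->
  Hamiltonian b f r x mu (alpha x y) y + dxH x mu y * (x' - x) <=
  Hamiltonian b f r x' mu a' y.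
Proof.
move=> Pmu Aa'; have [q gq] := hamiltonian_gradient x y Pmu.
apply: (gradient_lower_bound hA (hH y Pmu) _ gq) => //.
- exact: (alpha_minimizer h2 x y).1.
- by move=> a Aa; exact: hamiltonian_min.
Qed.

(* The tangent inequality at the two points [x + rho] and [x - rho], with [rho] of the order
   of the linear bound, turns the quadratic growth of the Hamiltonian into linear growth of
   its derivative. *)
Lemma dx_hamiltonian_bound mu (Cb Cf m : R) :
  0 <= r -> 0 <= Cb -> 0 <= Cf -> 0 <= m -> P2 mu ->
  (forall x a, A a -> `|b x mu a| <= Cb * (1 + `|x| + m + `|a|)) ->
  (forall x a, A a -> `|f x mu a| <= Cf * (1 + x ^+ 2 + m ^+ 2 + a ^+ 2)) ->
  forall x y, `|dxH x mu y| <=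
    2 * (2 * Cb + 4 * Cf + 2 * r) * (1 + `|x| + m + `|alpha x y| + `|y|).
Proof.
move=> r0 Cb0 Cf0 m0 Pmu bb ff x y.
set a := alpha x y; set p := dxH x mu y.
have Aa : A a by exact: (alpha_minimizer h2 x y).1.
set rho := 1 + `|x| + m + `|a| + `|y|.
have := normr_ge0 x; have := normr_ge0 a; have := normr_ge0 y => y0 a00 x0.
have rho1 : 1 <= rho by rewrite /rho; lra.
have rho0 : 0 < rho by rewrite (lt_le_trans ltr01).
set C := 2 * Cb + 4 * Cf + 2 * r.
have Hb x' : `|x'| <= `|x| + rho -> `|Hamiltonian b f r x' mu a y| <= C * rho ^+ 2.
  move=> xx'; rewrite /Hamiltonian.
  have x'0 := normr_ge0 x'.
  have s2 : 1 + `|x'| + m + `|a| <= 2 * rho by rewrite /rho in xx' *; lra.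
  have yr : `|y| <= rho by rewrite /rho; lra.
  have xr : `|x'| <= 2 * rho by lra.
  apply: le_trans (ler_normB _ _) _; apply: le_trans (lerD (ler_normD _ _) (lexx _)) _.
  rewrite !normrM (ger0_norm r0).
  have t1 : `|b x' mu a| * `|y| <= (2 * Cb) * rho ^+ 2.
    apply: (@le_trans _ _ ((Cb * (2 * rho)) * rho)).
      apply: ler_pM => //; apply: le_trans (bb x' a Aa) _.
      by rewrite ler_wpM2l.
    by rewrite le_eqVlt; apply/orP; left; apply/eqP; ring.
  have t2 : `|f x' mu a| <= (4 * Cf) * rho ^+ 2.
    apply: le_trans (ff x' a Aa) _.
    have -> : (4 * Cf) * rho ^+ 2 = Cf * (2 * rho) ^+ 2 by ring.
    rewrite ler_wpM2l//; apply: (@le_trans _ _ ((1 + `|x'| + m + `|a|) ^+ 2)).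
      rewrite -(real_normK (num_real x')) -(real_normK (num_real a)).
      have := mulr_ge0 x'0 m0; have := mulr_ge0 x'0 a00; have := mulr_ge0 m0 a00; nra.
    rewrite ler_sqr ?nnegrE//; last by rewrite mulr_ge0// ltW.
    by rewrite !addr_ge0.
  have t3 : r * `|x'| * `|y| <= (2 * r) * rho ^+ 2.
    have -> : (2 * r) * rho ^+ 2 = (r * (2 * rho)) * rho by ring.
    by apply: ler_pM => //; [rewrite mulr_ge0|rewrite ler_wpM2l].
  by rewrite /C 2!mulrDl !lerD.
have C0 : 0 <= C by rewrite /C !addr_ge0// mulr_ge0.
have H0 := Hb x _; rewrite lerDl (ltW rho0) in H0; have {}H0 := H0 isT.
have tan s : `|s| = rho -> p * s <= 2 * C * rho ^+ 2.
  move=> srho; have H1 := Hb (x + s) _.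
  have xs : `|x + s| <= `|x| + rho by rewrite -srho ler_normD.
  have {}H1 := H1 xs.
  have := hamiltonian_tangent x y (x + s) Pmu Aa.
  rewrite -/a -/p (addrC x s) addrK.
  move: H0 H1; rewrite (addrC x s) !ler_norml => /andP[? ?] /andP[? ?]; lra.
have t1 := tan rho (ger0_norm (ltW rho0)).
have t2 := tan (- rho); rewrite normrN in t2; have {}t2 := t2 (ger0_norm (ltW rho0)).
have {}t1 : p <= 2 * C * rho by rewrite -(ler_pM2r rho0); move: t1; congr (_ <= _); ring.
have {}t2 : - p <= 2 * C * rho.
  by rewrite -(ler_pM2r rho0); move: t2; congr (_ <= _); ring.
by rewrite ler_norml t1 andbT lerNl.
Qed.

Lemma hamiltonian_quotient_cvg x mu y : P2 mu ->
  (fun n : nat => n.+1%:R * (Hamiltonian b f r (n.+1%:R^-1 + x) mu (alpha x y) y -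
     Hamiltonian b f r x mu (alpha x y) y)) @ \oo --> dxH x mu y.
Proof.
move=> Pmu; have [q gq] := hamiltonian_gradient x y Pmu.
exact: gradient_within_cvg (alpha_minimizer h2 x y).1 gq.
Qed.

End hamiltonian.

(** * Duality with the adjoint process *)

(** [f] is signed and the integral of [g] may be infinite, so the comparison passes through the
    positive part of [f]. *)
Lemma ae_le_integrable d (T : measurableType d) (R : realType)
    (mu : {measure set T -> \bar R}) (f g : T -> \bar R) :
  mu.-integrable setT f -> measurable_fun setT g -> (forall x, 0 <= g x)%E ->
  {ae mu, forall x, (f x <= g x)%E} ->
  (\int[mu]_x f x <= \int[mu]_x g x)%E.
Proof.
move=> iF mg g0 fg; apply: (@le_trans _ _ (\int[mu]_x f^\+ x)%E).
  apply: le_integral => //; first exact: integrable_funepos.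
  by move=> x _; rewrite funeposE le_max lexx.
apply: ae_ge0_le_integral => //.
- by apply: measurable_funepos; exact: measurable_int iF.
- by move: fg; apply: filterS => x fgx _; rewrite funeposE ge_max fgx g0.
Qed.

Section Rintegral_strip.
Context {d : measure_display} {T : measurableType d} {R : realType}.
Variable P : probability T R.
Notation mu := (@lebesgue_measure R).
Variables (S : set (measurableTypeR R)) (v : R -> T -> R).
Hypothesis mS : measurable S.
Hypothesis iv : (mu \x P)%E.-integrable (S `*` setT) (fun z => (v z.1 z.2)%:E).

(** The two sides can differ only at times where [v s] is not integrable and [fine] replaces an
    infinite value by 0; these times form a null set. *)
Let ae_fine : {ae mu, forall s, S s ->
  (\int[P]_w (v s w)%:E = (\int[P]_w v s w)%:E)%E}.
Proof.
have := @ae_integrable_strip2 _ _ _ _ _ mu P S mS _ iv.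
apply: ae_lebesgueS => s ivs Ss; rewrite /Rintegral fineK//.
exact: (integrable_fin_num measurableT (ivs Ss)).
Qed.

Let i2 := @integrable_strip2 _ _ _ _ _ mu P S mS _ iv.

Let mfine : measurable_fun S (fun s => (\int[P]_w v s w)%:E).
Proof.
apply/measurable_EFinP; rewrite /Rintegral.
by apply: measurableT_comp => //; exact: (measurable_int mu i2).
Qed.

Lemma integrable_expectation_process :
  mu.-integrable S (EFin \o (fun s => \int[P]_w v s w)).
Proof.
apply/integrableP; split => //; have /integrableP[_] := i2.
apply: le_lt_trans; rewrite le_eqVlt; apply/orP; left; apply/eqP.
apply: ae_eq_integral => //.
- exact: measurableT_comp.
- by apply: measurableT_comp => //; exact: (measurable_int mu i2).
- by move: ae_fine; apply: ae_lebesgueS => s /[apply] /= ->.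
Qed.

Lemma Rintegral_strip12 :
  (\int[mu \x P]_(z in S `*` setT) (v z.1 z.2)%:E =
   (\int[mu]_(s in S) \int[P]_w v s w)%:E)%E.
Proof.
rewrite (@fubini_strip12 _ _ _ _ _ mu P S mS _ iv) /=.
rewrite [in RHS]/Rintegral fineK; last first.
  exact: (integrable_fin_num mS integrable_expectation_process).
by apply: ae_eq_integral => //; exact: (measurable_int mu i2).
Qed.

End Rintegral_strip.

Section adjoint_duality.
Context {d : measure_display} {T : measurableType d} {R : realType}.
Variables (P : probability T R) (B : R -> T -> R) (F0 : set (set T)).
Hypotheses (hB : brownian_motion P B) (hF0 : initial_sigma_algebra P B F0).
Let F := augmented_filtration P B F0.
Notation mu := (@lebesgue_measure R).
Notation L := (mu \x P)%E.
Variables (Z M : R -> T -> R).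
Hypothesis ZM : ito_integral P F B Z M.

Let mitv (i : interval R) : @measurable _ (measurableTypeR R) ([set` i] : set R).
Proof. exact: measurable_itv. Qed.

Variables (t : R).
Hypothesis t0 : 0 <= t.

Let S : set (measurableTypeR R) := [set` `[0, t]].
Let St : set (measurableTypeR R * T) := S `*` setT.
Let mS : measurable S. Proof. exact: mitv. Qed.
Let mSt : measurable St. Proof. exact: measurable_strip. Qed.

Lemma sqint_strip_bounded (v : R -> T -> R) (C : R) :
  @measurable_fun _ _ (measurableTypeR R * T)%type R St (fun z => v z.1 z.2) ->
  (forall s, 0 <= s -> s <= t -> (\int[P]_w (v s w ^+ 2)%:E <= C%:E)%E) ->
  sqint L St (fun z => v z.1 z.2).
Proof.
move=> mv vC; apply: sqint_lty => //.
have mv2 : @measurable_fun _ _ (measurableTypeR R * T)%type (\bar R) St (fun z => (v z.1 z.2 ^+ 2)%:E).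
  by apply/measurable_EFinP; exact: measurable_funX.
have v0 z : (0 <= (v z.1 z.2 ^+ 2)%:E)%E by rewrite lee_fin sqr_ge0.
rewrite (@tonelli_strip12 _ _ _ _ _ mu P S mS _ mv2 (fun z _ => v0 z)).
apply: (@le_lt_trans _ _ (\int[mu]_(s in S) (`|C|)%:E)%E).
  apply: ge0_le_integral => //.
  - by move=> s _; apply: integral_ge0 => w _; exact: (v0 (s, w)).
  - exact: (@measurable_strip_integral2 _ _ _ _ _ P S mS _ mv2 (fun z _ => v0 z)).
  - move=> s; rewrite /S/= in_itv/= => /andP[s0 st].
    by apply: le_trans (vC s s0 st) _; rewrite lee_fin ler_norm.
apply: (@le_lt_trans _ _ ((`|C|)%:E * mu S)%E).
  by rewrite le_eqVlt; apply/orP; left; apply/eqP; exact: (integral_cst mu mS `|C|%:E).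
have -> : mu S = t%:E by rewrite /S lebesgue_measure_itv/= lte_fin; case: ltgtP t0 => // [_ _|<- _]; rewrite ?oppr0 ?adde0.
by rewrite -EFinM ltry.
Qed.

(** The second moment of a martingale is nondecreasing, so its value at [t] bounds it on all of
    [[0, t]]. *)
Let sM : sqint L St (fun z => M z.1 z.2).
Proof.
apply: (@sqint_strip_bounded M (\int[P]_w (M t w ^+ 2))).
  apply: measurable_funS (adapted_measurable (ito_adapted ZM)) => //.
    exact: (measurable_strip (mitv `[0, +oo[)).
  by move=> [s w] [/=]; rewrite /S/= !in_itv/= => /andP[-> _].
move=> s s0 st; have := ito_second_moment_le hB hF0 ZM s0 st.
rewrite -lee_fin /Rintegral fineK//.
exact: (integrable_fin_num measurableT (sqint_ito hB hF0 ZM s0).2).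
Qed.

Let sMt : sqint L St (fun z => M t z.2).
Proof.
have smt := sqint_ito hB hF0 ZM t0.
apply: (@sqint_strip_bounded (fun _ w => M t w) (\int[P]_w (M t w ^+ 2))).
  apply: measurable_funS measurableT (@subsetT _ _) _.
  by apply: measurableT_comp; [exact: smt.1|exact: measurable_snd].
move=> s _ _; rewrite /Rintegral fineK//.
exact: (integrable_fin_num measurableT smt.2).
Qed.

(** In the application [G] is the discounted difference of the states, [g] its density in time, [h]
    the drift of [Y], and [psi] the difference of the discounted running costs. *)
Variables (g h G Y psi : R -> T -> R).
Hypothesis sg : sqint L St (fun z => g z.1 z.2).
Hypothesis sh : sqint L St (fun z => h z.1 z.2).
Hypothesis sG : sqint L St (fun z => G z.1 z.2).
Hypothesis sY : sqint L St (fun z => Y z.1 z.2).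
Hypothesis Fg : forall s, 0 <= s -> RV_wrt (F s) (g s).
Hypothesis GE : {ae P, forall w,
  mu.-integrable `[0, t] (EFin \o (g ^~ w)) /\
  forall s, 0 <= s -> s <= t -> G s w = \int[mu]_(u in `[0, s]) g u w}.
Hypothesis YE : integral_equation P Y (Y 0) h M.
Hypothesis ipsi : L.-integrable St (fun z => (psi z.1 z.2)%:E).
Hypothesis psiE : forall s w, 0 <= s -> s <= t ->
  - psi s w <= g s w * Y s w + h s w * G s w.

Let iM : L.-integrable St (fun z => (g z.1 z.2 * (M t z.2 - M z.1 z.2))%:E).
Proof. exact: (sqintM mSt sg (sqintB mSt sMt sM)). Qed.

(** At almost every [s], [g s] is square integrable and known at time [s], hence orthogonal to
    [M t - M s]; Fubini's theorem integrates this over [s]. *)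
Let iM0 : (\int[L]_(z in St) (g z.1 z.2 * (M t z.2 - M z.1 z.2))%:E = 0)%E.
Proof.
rewrite (@fubini_strip12 _ _ _ _ _ mu P S mS _ iM) /=.
have ae0 : {ae mu, forall s, S s -> (\int[P]_w (g s w * (M t w - M s w))%:E = 0)%E}.
  have := @ae_integrable_strip2 _ _ _ _ _ mu P S mS _ sg.2.
  apply: ae_lebesgueS => s igs Ss.
  have /andP[s0 st] : 0 <= s <= t by move: Ss; rewrite /S/= in_itv/=.
  have sgs : sqint P setT (g s).
    split; last exact: igs.
    exact: (RV_wrt_measurable (@filtration_measurable _ _ _ P B F0 hB hF0 s) (Fg s0)).
  have smt := sqint_ito hB hF0 ZM t0; have sms := sqint_ito hB hF0 ZM s0.
  have := ito_martingale hB hF0 ZM s0 st (Fg s0) sgs.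
  have it := sqintM measurableT sgs smt; have iss := sqintM measurableT sgs sms.
  move=> E; under eq_integral do rewrite mulrBr EFinB.
  rewrite (integralB_EFin measurableT it iss).
  rewrite -(fineK (integrable_fin_num measurableT it)) -(fineK (integrable_fin_num measurableT iss)).
  by rewrite -EFinB -/(Rintegral P setT _) -/(Rintegral P setT _) E subrr.
have i2 := @integrable_strip2 _ _ _ _ _ mu P S mS _ iM.
rewrite (@ae_eq_integral _ _ _ mu S (cst 0%E)) ?integral0//.
exact: (measurable_int mu i2).
Qed.

(* The process [Y - M] has absolutely continuous paths, so [G * Y] is computed path by path
   with the ordinary product rule; what remains of [M] is the integral of
   [g s * (M t - M s)], whose expectation vanishes because [M] is a martingale. *)
Lemma adjoint_duality :
  ((- \int[mu]_(s in `[0, t]) \int[P]_w psi s w)%:E <= \int[P]_w (`|G t w * Y t w|)%:E)%E.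
Proof.
(* On almost every path the time integral of [U] is at most [G t * Y t] by [psiE], while its total
   integral is that of [- psi] by [iM0]. *)
pose U z := ((- psi z.1 z.2 + g z.1 z.2 * (M t z.2 - M z.1 z.2))%:E : \bar R).
have iNpsi : L.-integrable St (fun z => (- psi z.1 z.2)%:E).
  by have := integrableN ipsi; apply: eq_integrable.
have iU : L.-integrable St U.
  by have := integrableD mSt iNpsi iM; apply: eq_integrable.
have IU : (\int[L]_(z in St) U z = (- \int[mu]_(s in `[0, t]) \int[P]_w psi s w)%:E)%E.
  rewrite /U; under eq_integral do rewrite EFinD.
  rewrite integralD// iM0 adde0.
  rewrite EFinN -(Rintegral_strip12 mS ipsi) -integralN//.
  exact: (integrable_add_def mSt ipsi).
rewrite -IU (@fubini_strip21 _ _ _ _ _ mu P S mS _ iU).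
apply: ae_le_integrable.
- exact: (@integrable_strip1 _ _ _ _ _ mu P S mS _ iU).
- apply/measurable_EFinP; apply: measurableT_comp => //.
  have msec (v : R -> T -> R) : sqint L St (fun z => v z.1 z.2) -> measurable_fun setT (v t).
    move=> [mv _]; have mE : @measurable_fun _ _ (measurableTypeR R * T)%type (\bar R) St
        (fun z => (v z.1 z.2)%:E) by exact/measurable_EFinP.
    have tS : S t by rewrite /S/= in_itv/= t0 lexx.
    have := @measurable_strip_section2 _ _ _ _ _ S mS _ t tS mE.
    by move/measurable_EFinP.
  by apply: measurable_funM; exact: msec.
- by move=> w; rewrite lee_fin.
- have igY := sqintM mSt sg sY; have ihG := sqintM mSt sh sG.
  have igM := sqintM mSt sg sM; have igMt := sqintM mSt sg sMt.
  have ae1 (v : R -> T -> R) : L.-integrable St (fun z => (v z.1 z.2)%:E) ->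
      {ae P, forall w, mu.-integrable S (EFin \o (v ^~ w))}.
    by move=> iv; exact: (@ae_integrable_strip1 _ _ _ _ _ mu P S mS _ iv).
  have aeY := ae1 (fun s w => g s w * Y s w) igY.
  have aeG := ae1 (fun s w => h s w * G s w) ihG.
  have aeM := ae1 (fun s w => g s w * M s w) igM.
  have aeMt := ae1 (fun s w => g s w * M t w) igMt.
  have aepsi := ae1 psi ipsi.
  have aeA : {ae P, forall w, [/\ mu.-integrable S (EFin \o (fun s => g s w * Y s w)),
      mu.-integrable S (EFin \o (fun s => h s w * G s w)) &
      mu.-integrable S (EFin \o (fun s => g s w * M s w))]}.
    by apply: filterS3 aeY aeG aeM => w.
  have aeB : {ae P, forall w, mu.-integrable S (EFin \o (fun s => g s w * M t w)) /\
      mu.-integrable S (EFin \o (psi ^~ w))}.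
    by apply: filterS2 aeMt aepsi => w.
  have aeC : {ae P, forall w,
      [/\ mu.-integrable S (EFin \o (fun s => g s w * Y s w)),
      mu.-integrable S (EFin \o (fun s => h s w * G s w)) &
      mu.-integrable S (EFin \o (fun s => g s w * M s w))] /\
      (mu.-integrable S (EFin \o (fun s => g s w * M t w)) /\
      mu.-integrable S (EFin \o (psi ^~ w)))}.
    by apply: filterS2 aeA aeB => w.
  apply: filterS3 aeC GE YE => w [[iY iG iMw] [iMtw ipsiw]] [ig Gw] Yw.
  have ih s : 0 <= s -> mu.-integrable `[0, s] (EFin \o (h ^~ w)) by move=> /Yw[].
  have GE0 s : 0 <= s -> s <= t -> G s w = 0 + \int[mu]_(u in `[0, s]) g u w.
    by move=> s0 st; rewrite add0r Gw.
  have VE s : 0 <= s -> s <= t -> Y s w - M s w = Y 0 w + \int[mu]_(u in `[0, s]) h u w.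
    by move=> s0 _; have [_ ->] := Yw s s0; rewrite addrK.
  have prod := absolutely_continuous_product t0 ig (ih t t0) GE0 VE.
  rewrite mul0r add0r in prod.
  have iN : mu.-integrable S (EFin \o (fun s => - psi s w)).
    by have := integrableN ipsiw; apply: eq_integrable.
  have iMM : mu.-integrable S (EFin \o (fun s => g s w * (M t w - M s w))).
    have := integrableB mS iMtw iMw; apply: eq_integrable => // s _ /=.
    by rewrite -EFinB; congr EFin; ring.
  have iL : mu.-integrable S (EFin \o (fun s => - psi s w + g s w * (M t w - M s w))).
    by have := integrableD mS iN iMM; apply: eq_integrable.
  have iR1 : mu.-integrable S (EFin \o (fun s => g s w * (Y s w - M s w) + h s w * G s w)).
    have := integrableD mS (integrableB mS iY iMw) iG; apply: eq_integrable => // s _ /=.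
    by rewrite -EFinB -EFinD; congr EFin; ring.
  have iR : mu.-integrable S (EFin \o (fun s => (g s w * (Y s w - M s w) + h s w * G s w) + g s w * M t w)).
    by have := integrableD mS iR1 iMtw; apply: eq_integrable.
  have GY : G t w * Y t w = \int[mu]_(s in S)
      ((g s w * (Y s w - M s w) + h s w * G s w) + g s w * M t w).
    rewrite (RintegralD mS iR1 iMtw) -prod RintegralZr//.
    by rewrite -Gw//; ring.
  rewrite /U /=.
  have -> : (\int[mu]_(s in S) (- psi s w + g s w * (M t w - M s w))%:E =
      (\int[mu]_(s in S) (- psi s w + g s w * (M t w - M s w)))%:E)%E.
    by rewrite /Rintegral fineK//; exact: (integrable_fin_num mS iL).
  rewrite lee_fin; apply: le_trans (ler_norm _); rewrite GY.
  apply: (le_Rintegral mS iL iR) => s.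
  rewrite /S/= in_itv/= => /andP[s0 st].
  have -> : g s w * (Y s w - M s w) + h s w * G s w + g s w * M t w =
    g s w * Y s w + h s w * G s w + g s w * (M t w - M s w) by ring.
  by rewrite lerD2r; exact: psiE.
Qed.

End adjoint_duality.

(** * Optimality *)

Section lipschitz_feedback.
Context {R : realType}.
Variable al : R -> R -> R.
Hypothesis lal : lipschitz2 al.

Lemma lipschitz2_bound : exists2 K : R, 0 <= K &
  (forall x x' y y', `|al x y - al x' y'| <= K * (`|x - x'| + `|y - y'|)) /\
  forall x y, `|al x y| <= `|al 0 0| + K * (`|x| + `|y|).
Proof.
have [K alK] := lal.
have lip x x' y y' : `|al x y - al x' y'| <= `|K| * (`|x - x'| + `|y - y'|).
  by apply: le_trans (alK _ _ _ _) _; rewrite ler_wpM2r ?ler_norm// addr_ge0.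
exists `|K| => //; split => // x y.
have := lip x 0 y 0; rewrite !subr0 => h.
rewrite -[in leLHS](subrK (al 0 0) (al x y)) addrC.
by apply: le_trans (ler_normD _ _) _; rewrite lerD2l.
Qed.

(** A Lipschitz function is the supremum over rational points of its lower cones, so each superlevel
    set is a countable union of measurable sets. *)
Lemma measurable_lipschitz2 d' (T' : measurableType d') (E : set T') (x y : T' -> R) :
  measurable_fun E x -> measurable_fun E y -> measurable_fun E (fun z => al (x z) (y z)).
Proof.
move=> mx my mE; have [K K0 [lip _]] := lipschitz2_bound.
apply: (measurability _ (RGenOInfty.measurableE R)) => //.
move=> _ [_ [a ->] <-].
pose V (p q : rat) : set T' := E `&` (fun z => al (ratr p) (ratr q) -
  K * (`|x z - ratr p| + `|y z - ratr q|)) @^-1` `]a, +oo[.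
have -> : E `&` (fun z => al (x z) (y z)) @^-1` `]a, +oo[ = \bigcup_p \bigcup_q V p q.
  apply/seteqP; split => z.
    move=> [Ez] /=; rewrite in_itv/= andbT => az.
    (* Rational approximation of both coordinates within [e] costs at most [4 K e] ([2 K e] from the
       function, [2 K e] from the cone), less than the gap [4 (K + 1) e]. *)
    pose e := (al (x z) (y z) - a) / (4 * (K + 1)).
    have K1 : 0 < 4 * (K + 1) by rewrite mulr_gt0// ltr_wpDl.
    have e0 : 0 < e by rewrite divr_gt0// subr_gt0.
    have near_rat (u : R) : exists p : rat, `|u - ratr p| <= e.
      have ue : u < u + e by rewrite ltrDl.
      have [p] := rat_in_itvoo ue; rewrite in_itv/= => /andP[up pu].
      by exists p; rewrite distrC ger0_norm ?subr_ge0 1?ltW// ltrBlDl.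
    have [p xp] := near_rat (x z); have [q yq] := near_rat (y z).
    exists p => //; exists q => //; split => //=; rewrite in_itv/= andbT.
    have := lip (x z) (ratr p) (y z) (ratr q); rewrite ler_norml => /andP[_].
    set N := `|x z - ratr p| + `|y z - ratr q| => h.
    have N0 : N <= 2 * e by rewrite mulr_natl mulr2n; exact: lerD.
    have aE : al (x z) (y z) = a + 4 * (K + 1) * e by rewrite /e; field; rewrite gt_eqF// ltr_wpDl.
    have KN := ler_wpM2l K0 N0; rewrite aE in h.
    have -> : a = (a + 4 * (K + 1) * e) - 4 * K * e - 4 * e by ring.
    have e4 : 0 < 4 * e by rewrite mulr_gt0.
    have KN2 : 2 * (K * N) <= 4 * K * e.
      have -> : 4 * K * e = 2 * (K * (2 * e)) by ring.
      by rewrite ler_wpM2l.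
    lra.
  move=> [p _ [q _ [Ez]]] /=; rewrite !in_itv/= !andbT => az; split => //.
  have := lip (ratr p) (x z) (ratr q) (y z); rewrite ler_norml => /andP[_].
  rewrite (distrC (ratr p)) (distrC (ratr q)); lra.
apply: bigcupT_measurable_rat => p; apply: bigcupT_measurable_rat => q.
have mh : measurable_fun E (fun z => al (ratr p) (ratr q) -
    K * (`|x z - ratr p| + `|y z - ratr q|)).
  apply: measurable_funB => //; apply: measurable_funM => //.
  by apply: measurable_funD; apply: measurableT_comp => //; exact: measurable_funB.
exact: mh mE _ (measurable_itv _).
Qed.

End lipschitz_feedback.

Section feedback_process.
Context {d : measure_display} {T : measurableType d} {R : realType}.
Variables (P : probability T R) (F : R -> set (set T)).
Variables (r : R) (A : set R) (b f : @coefficient R) (al : R -> R -> R).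
Hypotheses (hr : 0 < r) (h2 : structure_assumption A b f al).
Variables X Y : R -> T -> R.
Let c := r / 2.

Lemma disc_sqint_feedback : disc_sqint P c X -> disc_sqint P c Y ->
  disc_sqint P c (fun t w => al (X t w) (Y t w)).
Proof.
move=> sX sY; have [K K0 [_ bd]] := lipschitz2_bound (alpha_lipschitz h2).
have c0 : 0 < c by rewrite divr_gt0.
have s1 := disc_sqintD (disc_sqint_cst P `|al 0 0| c0)
  (disc_sqintZ K (disc_sqintD (disc_sqint_norm sX) (disc_sqint_norm sY))).
apply: (disc_sqint_le _ s1) => [|t w _].
  by apply: (measurable_lipschitz2 (alpha_lipschitz h2)); [case: sX|case: sY].
by apply: le_trans (bd _ _) _; exact: ler_norm.
Qed.

(** Presenting each [F t] by generators turns adaptedness into measurability on a measurable type,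
    to which the composition with [al] applies. *)
Lemma admissible_feedback (C : R -> set (set T)) : F = (fun t => <<s C t>>) ->
  L2r P F r X -> L2r P F r Y ->
  admissible P F r A (fun t w => al (X t w) (Y t w)).
Proof.
move=> FE lX lY; have aX := lX.1; have aY := lY.1.
split; last by move=> t w _; exact: (alpha_minimizer h2 _ _).1.
have aal : adapted_process F (fun t w => al (X t w) (Y t w)).
  split.
    exact: (measurable_lipschitz2 (alpha_lipschitz h2) (adapted_measurable aX) (adapted_measurable aY)).
  move=> t t0; rewrite FE; apply/RV_wrtP.
  apply: (measurable_lipschitz2 (alpha_lipschitz h2)).
    by apply/RV_wrtP; have := adapted_to aX t0; rewrite FE.
  by apply/RV_wrtP; have := adapted_to aY t0; rewrite FE.
apply: (iffRL (L2rP P r aal)); apply: disc_sqint_feedback.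
- exact: (iffLR (L2rP P r aX) lX).
- exact: (iffLR (L2rP P r aY) lY).
Qed.

End feedback_process.

Section running_cost.
Context {d : measure_display} {T : measurableType d} {R : realType}.
Variables (P : probability T R) (r : R) (A : set R) (b f : @coefficient R).
Hypotheses (hr : 0 < r) (hA : @convex_set R R^o A) (h1 : growth_assumption A b f r).
Hypothesis hfm : measurable_coefficient A f.
Variable Xi : R -> T -> R.
Let m t := law P (Xi t).
Let c := r / 2.
Notation mu := (@lebesgue_measure R).
Notation L := (mu \x P)%E.
Hypotheses (sXi : forall t, 0 <= t -> sqint P setT (Xi t)) (dXi : disc_sqint P c Xi).
Hypothesis mm : @measurable_fun _ _ R (@P2Borel R) `[0, +oo[ m.

Let D : set (measurableTypeR R) := [set` `[0, +oo[].
Let DT : set (measurableTypeR R * T) := D `*` setT.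
Let mD : measurable D. Proof. exact: measurable_itv. Qed.
Let mDT : measurable DT. Proof. exact: measurable_strip. Qed.
Let DTP z : DT z -> 0 <= z.1.
Proof. by move=> [+ _]; rewrite /D/= in_itv/= andbT. Qed.

Lemma measurable_process_coefficient (g : @coefficient R) (X be : R -> T -> R) :
  measurable_coefficient A g -> measurable_process X -> measurable_process be ->
  (forall t w, 0 <= t -> A (be t w)) ->
  measurable_process (fun t w => g (X t w) (m t) (be t w)).
Proof.
move=> mg mX mbe Abe.
have mmT : @measurable_fun _ _ (measurableTypeR R * T)%type (@P2Borel R) DT (fun z => m z.1).
  have mfst : measurable_fun DT (fst : measurableTypeR R * T -> measurableTypeR R).
    exact: measurable_funS measurableT (@subsetT _ _) measurable_fst.
  apply: (measurable_comp mD _ mm mfst).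
  by move=> _ [[t w] [/= tD _] <-].
apply: (measurable_coefficient_comp hA mg mDT mX mmT mbe).
- by move=> z /DTP z0; apply: P2_law; exact: sXi.
- by move=> z /DTP z0; exact: Abe.
Qed.

Lemma RV_wrt_coefficient (C : set (set T)) (g : @coefficient R) (t : R) (X be : T -> R) :
  measurable_coefficient A g -> 0 <= t -> RV_wrt <<s C>> X -> RV_wrt <<s C>> be ->
  (forall w, A (be w)) -> RV_wrt <<s C>> (fun w => g (X w) (m t) (be w)).
Proof.
move=> mg t0 /RV_wrtP mX /RV_wrtP mbe Abe; apply/RV_wrtP.
have mc : @measurable_fun _ _ (g_sigma_algebraType C) (@P2Borel R) setT (fun=> m t).
  exact: measurable_cst.
apply: (measurable_coefficient_comp hA mg measurableT mX mc mbe) => // z _.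
exact/P2_law/sXi.
Qed.

Variables X be : R -> T -> R.
Hypotheses (sX : disc_sqint P c X) (sbe : disc_sqint P c be).
Hypothesis Abe : forall t w, 0 <= t -> A (be t w).

(** Quadratic growth bounds the discounted cost by a multiple of four discounted squares: those of
    1, of the state, of the moment of the law and of the control. *)
Lemma integrable_running_cost :
  L.-integrable DT (fun z => (expR (- r * z.1) * f (X z.1 z.2) (m z.1) (be z.1 z.2))%:E).
Proof.
have [C C0 fb] := running_cost_bound P h1 Xi.
have mf := measurable_process_coefficient hfm sX.1 sbe.1 Abe.
have c0 : 0 < c by rewrite divr_gt0.
have i1 := (disc_sqint_cst P 1 c0).2.2; have i2 := sX.2.2.
have i3 := (disc_sqint_moment dXi).2.2; have i4 := sbe.2.2.
have i := integrableZl mDT C (integrableD mDT (integrableD mDT (integrableD mDT i1 i2) i3) i4).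
apply: le_integrable i => //.
  apply/measurable_EFinP; apply: measurable_funM => //.
  exact: measurable_discount.
move=> [t w] /DTP /= t0; rewrite /= -?EFinD -?EFinM /= lee_fin.
have e2 : expR (- r * t) = expR (- c * t) ^+ 2.
  by rewrite expr2 -expRD; congr expR; rewrite /c; field.
rewrite /discounted/= e2 normrM ger0_norm ?sqr_ge0//.
set e := expR _; have e0 : 0 <= e ^+ 2 := sqr_ge0 e.
have := fb t (X t w) (be t w) (sXi t0) (Abe w t0); set q := Num.sqrt _ => h.
apply: le_trans (ler_norm _).
have -> : C * ((e * 1) ^+ 2 + (e * X t w) ^+ 2 + (e * q) ^+ 2 + (e * be t w) ^+ 2) =
  e ^+ 2 * (C * (1 + X t w ^+ 2 + q ^+ 2 + be t w ^+ 2)) by ring.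
exact: ler_wpM2l.
Qed.

Lemma costE : cost P r f m X be =
  (\int[L]_(z in DT) (expR (- r * z.1) * f (X z.1 z.2) (m z.1) (be z.1 z.2))%:E)%E.
Proof.
by rewrite (@fubini_strip21 _ _ _ _ _ mu P D mD _ integrable_running_cost).
Qed.

End running_cost.

Section verification.
Context {d : measure_display} {T : measurableType d} {R : realType}.
Variables (P : probability T R) (B : R -> T -> R) (F0 : set (set T)).
Hypotheses (hB : brownian_motion P B) (hF0 : initial_sigma_algebra P B F0).
Let F := augmented_filtration P B F0.
Variables (r : R) (A : set R) (b f : @coefficient R) (al : R -> R -> R).
Hypotheses (hr : 0 < r) (hA : @convex_set R R^o A).
Hypotheses (hbm : measurable_coefficient A b) (hfm : measurable_coefficient A f).
Hypotheses (h1 : growth_assumption A b f r) (h2 : structure_assumption A b f al).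
Hypothesis hH : forall mu y, P2 mu -> convex_xa A (fun x a => Hamiltonian b f r x mu a y).
Variable Xi : R -> T -> R.
Let m t := law P (Xi t).
Let c := r / 2.
Notation mu := (@lebesgue_measure R).
Notation L := (mu \x P)%E.
Hypotheses (sXi : forall t, 0 <= t -> sqint P setT (Xi t)) (dXi : disc_sqint P c Xi).
Hypothesis mm : @measurable_fun _ _ R (@P2Borel R) `[0, +oo[ m.
Variables (x : R) (X Y Z M : R -> T -> R).
Hypotheses (lX : L2r P F r X) (lY : L2r P F r Y).
Let ast t w := al (X t w) (Y t w).
Hypothesis XE : integral_equation P X (fun=> x) (fun s w => b (X s w) (m s) (ast s w)) B.
Hypothesis ZM : ito_integral P F B Z M.
Let h s w := - dx_Hamiltonian b f r (X s w) (m s) (ast s w) (Y s w).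
Hypothesis YE : integral_equation P Y (Y 0) h M.
Variables (X' be : R -> T -> R).
Hypotheses (abe : admissible P F r A be) (cX' : controlled_state P F B b x m be X').

Let c0 : 0 < c. Proof. by rewrite divr_gt0. Qed.

Let D : set (measurableTypeR R) := [set` `[0, +oo[].
Let DT : set (measurableTypeR R * T) := D `*` setT.
Let mD : measurable D. Proof. exact: measurable_itv. Qed.
Let mDT : measurable DT. Proof. exact: measurable_strip. Qed.
Let DTP z : DT z -> 0 <= z.1.
Proof. by move=> [+ _]; rewrite /D/= in_itv/= andbT. Qed.

Let sX : disc_sqint P c X. Proof. exact: (iffLR (L2rP P r lX.1) lX). Qed.
Let sY : disc_sqint P c Y. Proof. exact: (iffLR (L2rP P r lY.1) lY). Qed.
Let sbe : disc_sqint P c be. Proof. exact: (iffLR (L2rP P r abe.1.1) abe.1). Qed.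

Let aast : admissible P F r A ast.
Proof. exact: (admissible_feedback hr h2 (erefl F) lX lY). Qed.

Let sast : disc_sqint P c ast. Proof. exact: (iffLR (L2rP P r aast.1.1) aast.1). Qed.

Let cX : controlled_state P F B b x m ast X. Proof. by split => //; exact: lX.1. Qed.

Let dX t w := X' t w - X t w.
Let dl t w := b (X' t w) (m t) (be t w) - b (X t w) (m t) (ast t w).

Let sdX : disc_sqint P c dX.
Proof. exact: (disc_sqint_state_difference h1 sXi cX' cX abe aast). Qed.

Let sX' : disc_sqint P c X'.
Proof.
have := disc_sqintD sdX sX; congr disc_sqint.
by apply/funext => t; apply/funext => w; rewrite subrK.
Qed.

Let sdl : disc_sqint P c dl.
Proof.
have [K K0 lip] := drift_lipschitz P h1 Xi.
have mb1 := measurable_process_coefficient hA sXi mm hbm sX'.1 sbe.1 abe.2.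
have mb2 := measurable_process_coefficient hA sXi mm hbm sX.1 sast.1 aast.2.
have s1 := disc_sqintZ K (disc_sqintD (disc_sqint_norm sdX) (disc_sqint_norm (disc_sqintB sbe sast))).
apply: (disc_sqint_le _ s1) => [|t w t0]; first exact: measurable_funB.
apply: le_trans (ler_norm _).
exact: lip (sXi t0) (abe.2 t w t0) (aast.2 t w t0).
Qed.

(** The partial derivatives are given without joint measurability; these quotients are measurable
    and converge to the derivative of the Hamiltonian. *)
Let mH (n : nat) : measurable_process (fun t w => n.+1%:R *
  (Hamiltonian b f r (n.+1%:R^-1 + X t w) (m t) (ast t w) (Y t w) -
   Hamiltonian b f r (X t w) (m t) (ast t w) (Y t w))).
Proof.
have mHa (V : R -> T -> R) : measurable_process V ->
    measurable_process (fun t w => Hamiltonian b f r (V t w) (m t) (ast t w) (Y t w)).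
  move=> mV.
  have mb := measurable_process_coefficient hA sXi mm hbm mV sast.1 aast.2.
  have mf := measurable_process_coefficient hA sXi mm hfm mV sast.1 aast.2.
  apply: measurable_funB; first by apply: measurable_funD => //; apply: measurable_funM => //; exact: sY.1.
  by apply: measurable_funM; [exact: measurable_funM|exact: sY.1].
have mX1 : measurable_process (fun t w => n.+1%:R^-1 + X t w).
  by apply: measurable_funD => //; exact: sX.1.
apply: measurable_funM => //; apply: measurable_funB; first exact: (mHa _ mX1).
exact: (mHa _ sX.1).
Qed.

(** Needed to make [h * G] integrable over finite strips; the linear bound on the derivative of the
    Hamiltonian reduces it to processes already in the space. *)
Let sh : disc_sqint P c h.
Proof.
have a0P : A (al 0 0) := (alpha_minimizer h2 0 0).1.
have [Cb Cb0 bb] := drift_bound P h1 Xi a0P.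
have [Cf Cf0 ff] := running_cost_bound P h1 Xi.
have mh : measurable_process h.
  apply: measurableT_comp => //.
  apply: (measurable_fun_cvg mH) => -[t w] /DTP/= t0.
  exact: (hamiltonian_quotient_cvg h2 (P2_law (sXi t0))).

have s1 := disc_sqintZ (2 * (2 * Cb + 4 * Cf + 2 * r)) (disc_sqintD (disc_sqintD (disc_sqintD
  (disc_sqintD (disc_sqint_cst P 1 c0) (disc_sqint_norm sX)) (disc_sqint_moment dXi))
  (disc_sqint_norm sast)) (disc_sqint_norm sY)).
apply: (disc_sqint_le mh s1) => t w t0; rewrite normrN.
apply: le_trans (ler_norm _).
apply: (dx_hamiltonian_bound hA h2 hH (ltW hr) Cb0 Cf0 (sqrtr_ge0 _) (P2_law (sXi t0))).
- by move=> y a Aa; exact: bb (sXi t0) Aa.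
- by move=> y a Aa; exact: ff (sXi t0) Aa.
Qed.

(** [g] is the density of [G]. The exponent is the full [r], not [c], because [G * Y] has to carry
    the discount of the cost. *)
Let g t w := expR (- r * t) * (dl t w - r * dX t w).
Let G t w := expR (- r * t) * dX t w.

Let exp_le1 t : 0 <= t -> `|expR (- r * t)| <= 1.
Proof.
by move=> t0; rewrite ger0_norm ?expR_ge0// -expR0 ler_expR mulNr oppr_le0 mulr_ge0// ltW.
Qed.

Let sg : disc_sqint P c g.
Proof.
have s1 := disc_sqintB sdl (disc_sqintZ r sdX).
apply: (disc_sqint_le _ s1) => [|t w t0].
  by apply: measurable_funM; [exact: measurable_discount|exact: s1.1].
by rewrite /g normrM ler_piMl//; exact: exp_le1.
Qed.

Let sG : disc_sqint P c G.
Proof.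
apply: (disc_sqint_le _ sdX) => [|t w t0].
  by apply: measurable_funM; [exact: measurable_discount|exact: sdX.1].
by rewrite /G normrM ler_piMl//; exact: exp_le1.
Qed.

Let Fg s : 0 <= s -> RV_wrt (F s) (g s).
Proof.
move=> s0; apply/RV_wrtP; apply: measurable_funM => //.
have FX := adapted_to lX.1 s0; have FX' := adapted_to cX'.1 s0.
have Fbe := adapted_to abe.1.1 s0; have Fast := adapted_to aast.1.1 s0.
apply: measurable_funB.
  apply: measurable_funB; apply/RV_wrtP.
    by apply: (RV_wrt_coefficient hA sXi hbm s0 FX' Fbe) => w; exact: abe.2.
  by apply: (RV_wrt_coefficient hA sXi hbm s0 FX Fast) => w; exact: aast.2.
apply: measurable_funM => //; apply: measurable_funB; first exact/RV_wrtP.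
exact/RV_wrtP.
Qed.

Let GE t : 0 <= t -> {ae P, forall w,
  mu.-integrable `[0, t] (EFin \o (g ^~ w)) /\
  forall s, 0 <= s -> s <= t -> G s w = \int[mu]_(u in `[0, s]) g u w}.
Proof.
move=> t0; have := state_difference cX' cX; apply: filterS => w Dw.
exact: (discounted_primitive r t0 (Dw t t0).1 (fun s s0 _ => (Dw s s0).2)).
Qed.

Let psi t w := expR (- r * t) * f (X' t w) (m t) (be t w) -
  expR (- r * t) * f (X t w) (m t) (ast t w).

Let ipsi : L.-integrable DT (fun z => (psi z.1 z.2)%:E).
Proof.
have i1 := integrable_running_cost hr hA h1 hfm sXi dXi mm sX' sbe abe.2.
have i2 := integrable_running_cost hr hA h1 hfm sXi dXi mm sX sast aast.2.
by have := integrableB mDT i1 i2; apply: eq_integrable.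
Qed.

(** This is [e^(-rs)] times the tangent inequality: the [- r x y] of the Hamiltonian supplies
    exactly the [- r dX] contained in [g]. *)
Let psiE s w : 0 <= s -> - psi s w <= g s w * Y s w + h s w * G s w.
Proof.
move=> s0.
have := hamiltonian_tangent hA h2 hH (X s w) (Y s w) (X' s w) (P2_law (sXi s0)) (abe.2 s w s0).
rewrite /psi /g /G /h /dl /dX /Hamiltonian -/(ast s w) -/(m s).
set p := dx_Hamiltonian _ _ _ _ _ _ _ => tan.
rewrite -subr_ge0; set e := expR _.
have e0 : 0 <= e by rewrite expR_ge0.
rewrite -subr_ge0 in tan; have := mulr_ge0 e0 tan; congr (_ <= _); ring.
Qed.

Lemma cost_optimal : (cost P r f m X ast <= cost P r f m X' be)%E.
Proof.
have i1 := integrable_running_cost hr hA h1 hfm sXi dXi mm sX' sbe abe.2.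
have i2 := integrable_running_cost hr hA h1 hfm sXi dXi mm sX sast aast.2.
rewrite (costE hr hA h1 hfm sXi dXi mm sX' sbe abe.2).
rewrite (costE hr hA h1 hfm sXi dXi mm sX sast aast.2).
rewrite -sube_ge0; last by rewrite (integrable_fin_num mDT i2).
rewrite -(integralB mDT i1 i2).
have -> : (\int[L]_(z in DT) ((expR (- r * z.1) * f (X' z.1 z.2) (m z.1) (be z.1 z.2))%:E -
    (expR (- r * z.1) * f (X z.1 z.2) (m z.1) (ast z.1 z.2))%:E) =
    \int[L]_(z in DT) (psi z.1 z.2)%:E)%E.
  by apply: eq_integral => z _.
rewrite (Rintegral_strip12 mD ipsi) lee_fin.
have mGY : @measurable_fun _ _ (measurableTypeR R * T)%type (\bar R) DT
    (fun z => (`|G z.1 z.2 * Y z.1 z.2|)%:E).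
  apply/measurable_EFinP; apply: measurableT_comp => //.
  by apply: measurable_funM; [exact: sG.1|exact: sY.1].
have GY0 z : (0 <= (`|G z.1 z.2 * Y z.1 z.2|)%:E)%E by rewrite lee_fin.
apply: (@transversality R _ (fun t => \int[P]_w (`|G t w * Y t w|)%:E)%E).
- exact: (integrable_expectation_process mD ipsi).
- exact: (@measurable_strip_integral2 _ _ _ _ _ P D mD _ mGY (fun z _ => GY0 z)).
- by move=> t _; apply: integral_ge0 => w _; rewrite lee_fin.
(* The weight [e^(-rt)] splits into two factors [e^(-ct)], one for [dX] and one for [Y], and the
   product of two square integrable functions is integrable. *)
- rewrite -(@tonelli_strip12 _ _ _ _ _ mu P D mD _ mGY (fun z _ => GY0 z)).
  have /integrableP[_] := sqintM mDT sdX.2 sY.2; congr (_ < _)%E.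
  apply: eq_integral => -[t w] _; congr EFin; rewrite /discounted /G /=; congr `|_|.
  have -> : expR (- r * t) = expR (- c * t) * expR (- c * t).
    by rewrite -expRD; congr expR; rewrite /c; field.
  ring.
move=> t t0.
have sub : [set` `[0, t]] `*` [set: T] `<=` DT.
  by move=> [s w] [/=]; rewrite in_itv/= => /andP[s0 _] _; split => //; rewrite /D/= in_itv/= s0.
have mS : measurable ([set` `[0, t]] `*` [set: T] : set (measurableTypeR R * T)).
  by apply: measurable_strip; exact: measurable_itv.
apply: (adjoint_duality hB hF0 ZM t0 _ _ _ _ Fg (GE t0) YE).
- exact: disc_sqint_strip (ltW c0) sg.
- exact: disc_sqint_strip (ltW c0) sh.
- exact: disc_sqint_strip (ltW c0) sG.
- exact: disc_sqint_strip (ltW c0) sY.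
- exact: integrableS ipsi.
- by move=> s w s0 _; exact: psiE.
Qed.

End verification.

(** * The state of the mean-field system *)

Section mean_field.
Context {d : measure_display} {T : measurableType d} {R : realType}.
Variables (P : probability T R) (B : R -> T -> R) (r : R) (A : set R) (b f : @coefficient R).
Hypotheses (hB : brownian_motion P B) (hr : 0 < r) (h1 : growth_assumption A b f r).
Variables (X be : R -> T -> R) (x0 : T -> R).
Hypotheses (sx0 : sqint P setT x0) (sX : disc_sqint P (r / 2) X) (sbe : disc_sqint P (r / 2) be).
Hypothesis Abe : forall t w, 0 <= t -> A (be t w).
Hypothesis XE :
  integral_equation P X x0 (fun s w => b (X s w) (law P (X s)) (be s w)) B.
Notation mu := (@lebesgue_measure R).

Let c0 : 0 < r / 2. Proof. by rewrite divr_gt0. Qed.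

(** The linear growth of [b] gives the bound at every time where the state has a finite second
    moment; its own law contributes through that moment. *)
Let dominated : exists2 phi, disc_sqint P (r / 2) phi &
  {ae mu, forall s, 0 <= s -> forall w, `|b (X s w) (law P (X s)) (be s w)| <= phi s w}.
Proof.
(* The sample space is nonempty because [P] has mass 1; a value of the control there is the point of
   [A] that anchors the growth bound. *)
have [w _] : exists w : T, True.
  apply: contrapT => noT; have := @probability_setT _ _ _ P.
  rewrite (_ : setT = set0) ?measure0; last by apply/seteqP; split => // w _; apply: noT; exists w.
  by move/eqP; rewrite eq_sym onee_eq0.
have [C C0 bC] := drift_bound P h1 X (Abe w (lexx 0)).
exists (fun s w => C * (1 + `|X s w| + Num.sqrt (\int[P]_u (X s u ^+ 2)) + `|be s w|)).
  apply: disc_sqintZ; apply: disc_sqintD (disc_sqint_norm sbe).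
  apply: disc_sqintD (disc_sqint_moment sX).
  exact: disc_sqintD (disc_sqint_cst P 1 c0) (disc_sqint_norm sX).
move: (ae_disc_sqint_time sX); apply: ae_lebesgueS => s sXs s0 w'.
by apply: bC; [exact: sXs|exact: Abe].
Qed.

(** From almost every to every time, so that the law of the state belongs to [P2] throughout. *)
Lemma mean_field_sqint t : 0 <= t -> sqint P setT (X t).
Proof.
have [phi sphi bphi] := dominated.
exact: (drift_sqint hB (ltW c0) sX.1 sx0 XE sphi bphi).
Qed.

Lemma mean_field_measurable_law :
  @measurable_fun _ _ R (@P2Borel R) `[0, +oo[ (fun t => law P (X t)).
Proof.
have [phi sphi bphi] := dominated.
exact: (drift_measurable_law hB (ltW c0) sX.1 sx0 XE sphi bphi).
Qed.

End mean_field.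

Lemma cost_ae_eq d (T : measurableType d) (R : realType) (P : probability T R)
    (r : R) (f : @coefficient R) (m : R -> prob R) (X1 X2 be : R -> T -> R) :
  let L := (@lebesgue_measure R \x P)%E in
  let DT := ([set` `[0, +oo[] : set (measurableTypeR R)) `*` [set: T] in
  L.-integrable DT (fun z => (expR (- r * z.1) * f (X1 z.1 z.2) (m z.1) (be z.1 z.2))%:E) ->
  L.-integrable DT (fun z => (expR (- r * z.1) * f (X2 z.1 z.2) (m z.1) (be z.1 z.2))%:E) ->
  {ae P, forall w t, 0 <= t -> X1 t w = X2 t w} ->
  cost P r f m X1 be = cost P r f m X2 be.
Proof.
move=> L DT i1 i2 eX.
have mD : @measurable _ (measurableTypeR R) ([set` `[0, +oo[] : set R) by exact: measurable_itv.
have j1 := @integrable_strip1 _ _ _ _ _ (@lebesgue_measure R) P _ mD _ i1.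
have j2 := @integrable_strip1 _ _ _ _ _ (@lebesgue_measure R) P _ mD _ i2.
apply: ae_eq_integral => //.
- exact: measurable_int j1.
- exact: measurable_int j2.
- apply: filterS eX => w eX _; apply: eq_integral => t.
  by rewrite inE/= in_itv/= andbT => t0; rewrite eX.
Qed.

Theorem theorem4p2 (R : realType) (d : measure_display) (T : measurableType d)
    (P : probability T R) (B : R -> T -> R) (F0 : set (set T))
    (F := augmented_filtration P B F0)
    (hB : brownian_motion P B) (hF0 : initial_sigma_algebra P B F0)
    (r : R) (hr : 0 < r)
    (A : set R) (hA : @convex_set R R^o A)
    (b f : @coefficient R)
    (hbm : measurable_coefficient A b) (hfm : measurable_coefficient A f)
    (halpha : R -> R -> R)
    (h1 : growth_assumption A b f r)
    (h2 : structure_assumption A b f halpha)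
    (hH : forall mu y, P2 mu ->
       convex_xa A (fun x a => Hamiltonian b f r x mu a y))
    (x : R) (xi : T -> R)
    (hxi : RV_wrt (F 0) xi) (hxi2 : (\int[P]_w ((xi w) ^+ 2)%:E < +oo)%E)
    (Xxi Yxi Zxi : R -> T -> R)
    (hsolxi : unique_solution P
       (fun X Y Z =>
          fbsde_solution P F B r b f halpha xi (fun t => law P (X t)) X Y Z)
       Xxi Yxi Zxi)
    (Xx Yx Zx : R -> T -> R)
    (hsolx : unique_solution P
       (fun X Y Z =>
          fbsde_solution P F B r b f halpha (fun=> x)
            (fun t => law P (Xxi t)) X Y Z)
       Xx Yx Zx) :
  optimal_control P F B r A b f x (fun t => law P (Xxi t))
    (fun t w => halpha (Xx t w) (Yx t w)).
Proof.
have [[lXi lYi _ XiE _] _] := hsolxi.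
have [[lX lY _ XE [M ZM YE]] _] := hsolx.
have sXi := iffLR (L2rP P r lXi.1) lXi; have sYi := iffLR (L2rP P r lYi.1) lYi.
have sxi : sqint P setT xi.
  apply: sqint_lty hxi2; apply: (RV_wrt_measurable _ hxi); exact: (filtration_measurable hB hF0).
have sai := disc_sqint_feedback hr h2 sXi sYi.
have Aai t w : 0 <= t -> A (halpha (Xxi t w) (Yxi t w)) by move=> _; exact: (alpha_minimizer h2 _ _).1.
have sXit := mean_field_sqint hB hr h1 sxi sXi sai Aai XiE.
have mm := mean_field_measurable_law hB hr h1 sxi sXi sai Aai XiE.
have aal := admissible_feedback hr h2 (erefl F) lX lY.
split; [exact: aal|by exists Xx; split; [exact: lX.1|exact: XE]|].
move=> X be X' cX abe cX'.
have cXx : controlled_state P F B b x (fun t => law P (Xxi t))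
    (fun t w => halpha (Xx t w) (Yx t w)) Xx by split => //; exact: lX.1.
have sXx := iffLR (L2rP P r lX.1) lX.
(* [X] is an arbitrary solution for the optimal control; stability places its difference to [Xx] in
   the space, hence [X] itself. *)
have sX : disc_sqint P (r / 2) X.
  have := disc_sqintD (disc_sqint_state_difference h1 sXit cX cXx aal aal) sXx.
  by congr disc_sqint; apply/funext => t; apply/funext => w; rewrite subrK.
have sal := iffLR (L2rP P r aal.1.1) aal.1.
(* The two states driven by the same control agree almost surely at all times, so the cost along [X]
   is the cost along [Xx], the path that is coupled with [Yx]. *)
have eX := state_unique h1 sXit cX cXx aal aal (fun t w _ => erefl).
rewrite (cost_ae_eq _ _ eX).
- exact: (cost_optimal hB hF0 hr hA hbm hfm h1 h2 hH sXit sXi mm lX lY XE ZM YE abe cX').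
- exact: (integrable_running_cost hr hA h1 hfm sXit sXi mm sX sal aal.2).
- exact: (integrable_running_cost hr hA h1 hfm sXit sXi mm sXx sal aal.2).
Qed.
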